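(* Let $T_*:\mathbb S^1\to\mathbb S^1$ be a $C^4$, mixing, uniformly expanding map of degree $d\ge2$, and let $\delta_\ast>0$ be admissible for $T_*$ (see context). Let $(T_n)_{n\in\mathbb Z}$ be a sequence of $C^4$ expanding maps in $\mathcal S_{T_*}(\delta_\ast)$ with $\sup_n\|T_n\|_{C^4}<\infty$. Let $(h_\varepsilon)_{\varepsilon\in[0,\varepsilon_0)}$ be a $C^3$ family of $C^3$ diffeomorphisms of $\mathbb S^1$ with $h_0=\mathrm{id}$ and $$h_\varepsilon(x)=x+\varepsilon Y(x)+r^\varepsilon(x),\qquad Y\in C^3(\mathbb S^1),\qquad \frac{\|r^\varepsilon\|_{C^3}}{|\varepsilon|}\xrightarrow[\varepsilon\to0]{}0.$$ Let $T_n^\varepsilon:=h_\varepsilon\circ T_n$, with Perron--Frobenius operators $L_n^\varepsilon$, and $L_n=L_n^0$. Then, after possibly decreasing $\varepsilon_0$, the following hold. (a) The operators $L_n^\varepsilon$ are uniformly bounded on $W^{1,1}(\mathbb S^1)$ and on $L^1(\mathbb S^1)$, are positive and preserve integrals, and the operators $\mathbb T_\varepsilon$, $(\mathbb T_\varepsilon \boldsymbol v)_n=L^\varepsilon_{n-1}v_{n-1}$, have powers bounded, uniformly in the power and in $\varepsilon$, on the space of sequences in $\ell^\infty(\mathbb Z;L^1)$ with zero-integral entries. (b) For each $\varepsilon\in[0,\varepsilon_0)$ there is an equivariant family of probability densities $\boldsymbol\mu^\varepsilon=(\mu_n^\varepsilon)_{n\in\mathbb Z}$, $\mu_{n+1}^\varepsilon=L_n^\varepsilon\mu_n^\varepsilon$,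 with $\sup_{\varepsilon,n}\|\mu^\varepsilon_n\|_{W^{1,1}}<\infty$. (c) With $\mu_n=\mu_n^0$ and $g_n:=-(Y\,L_n\mu_n)'$, one has $\sup_n\|g_n\|_{W^{1,1}}<\infty$, $\sup_n\|\varepsilon^{-1}(L_n^\varepsilon\mu_n-L_n\mu_n)-g_n\|_{W^{1,1}}\to0$ and $\sup_{n,\ \|v\|_{W^{1,1}}=1}\|(L_n^\varepsilon-L_n)v\|_{L^1}\to0$ as $\varepsilon\to0$. (d) There are $C\ge1$, $\rho\in(0,1)$ with $\|L_{n-1}^\varepsilon\cdots L_m^\varepsilon v\|_{W^{1,1}}\le C\rho^{n-m}\|v\|_{W^{1,1}}$ for all $\varepsilon\in[0,\varepsilon_0)$, $m<n$, and $v\in W^{1,1}$ with $\int v\,dm=0$. Consequently the linear response $$\boldsymbol\eta=\lim_{\varepsilon\to0}\frac{\boldsymbol\mu^\varepsilon-\boldsymbol\mu^0}{\varepsilon}$$ exists, with convergence in $\ell^\infty(\mathbb Z;L^1)$; it is the unique solution in $\ell^\infty(\mathbb Z;\{v\in W^{1,1}:\int v\,dm=0\})$ of $\eta_n-L_{n-1}\eta_{n-1}=g_{n-1}$ $(n\in\mathbb Z)$; and $$\eta_n=\sum_{k=0}^\infty L_{n-1}\cdots L_{n-k}\,g_{n-k-1}\qquad(n\in\mathbb Z)$$ (empty product $=$ identity for $k=0$), with absolute convergence in $W^{1,1}$, uniformly in $n$.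
   Context: $m$ is Lebesgue measure on $\mathbb S^1=\mathbb R/\mathbb Z$; measures are identified with densities. $L_T$ denotes the Perron--Frobenius (transfer) operator of $T$ with respect to $m$. For circle maps of the same degree, $\|T-T'\|_{C^2}$ is the $C^2$ norm of the periodic difference of (nearby) lifts. $Y$ is identified with a 1-periodic scalar function. Let $T_*$ be $C^4$, mixing, of degree $d\ge2$, with $\lambda_0:=\inf|T_*'|>1$, $M_2:=\|T_*''\|_\infty$. Fix constants $\lambda_1\in(0,1)$, $B\ge0$ such that for $L_*=L_{T_*}$: $\|L_*f\|_{L^1}\le\|f\|_{L^1}$ and $\|L_*f\|_{W^{1,1}}\le\lambda_1\|f\|_{W^{1,1}}+B\|f\|_{L^1}$ for all $f\in W^{1,1}(\mathbb S^1)$. Let $M\in\mathbb N$ satisfy $\lambda_1^M\le\frac{1}{10(\frac{B}{1-\lambda_1}+1)}$ and $\|L_*^Mv\|_{L^1}\le\frac{1}{10B}\|v\|_{W^{1,1}}$ for all $v\in W^{1,1}$ with $\int v\,dm=0$. Let $$C(T_* )=2d\bigl(\|T_*'\|_\infty+\lambda_0-1\bigr)\Bigl(\frac1{\lambda_0^2}+\frac{M_2}{\lambda_0^3}+\frac1{\lambda_0}\Bigr).$$ A number $\delta_\ast$ is called admissible for $T_*$ if $0<\delta_\ast<\lambda_0-1$ and $C(T_* )\delta_\ast\le\frac{7(1-\lambda_1)^2}{10MB(\frac1{1-\lambda_1}+B)}$. Set $$\mathcal S_{T_*}(\delta_\ast):=\{T:\mathbb S^1\to\mathbb S^1\ C^3\text{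 uniformly expanding of degree }d:\ \|T-T_*\|_{C^2}<\delta_\ast\}.$$ *)

(* Defs.v *)
From HB Require Import structures.
From mathcomp Require Import all_boot all_order all_algebra.
From mathcomp Require Import all_classical all_reals all_analysis.
Set Implicit Arguments.
Unset Strict Implicit.
Unset Printing Implicit Defensive.
Import Order.TTheory GRing.Theory Num.Theory.
Import numFieldNormedType.Exports.
Local Open Scope classical_set_scope.
Local Open Scope ring_scope.

(* The circle is R/Z: functions on it are 1-periodic
   functions on R, integrated over `[0, 1]; circle maps are given by lifts to R.
   Elements of L^1 and W^{1,1} are given by representatives, and equalities
   between them are stated almost everywhere.  Norms take values in \bar R, so
   that suprema of unbounded families are +oo. *)

Section CircleFunctions.
Context {R : realType}.
Implicit Types (f g : R -> R) (k : nat).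

Definition Ck k f : Prop :=
  (forall j x, (j < k)%N -> derivable (derive1n j f) x 1) /\
  (forall j, (j <= k)%N -> continuous (derive1n j f)).

(* The maximum (not the sum) of the sup norms of the derivatives up to order k. *)
Definition Cnorm k f : \bar R :=
  \big[maxe/0%E]_(j < k.+1) ereal_sup (range (fun x : R => (`|derive1n j f x|)%:E)).

(* Real-valued; only applied to bounded functions. *)
Definition supnorm f : R := sup (range (fun x : R => `|f x|)).

Definition cint f : R := \int[lebesgue_measure]_(x in `[0, 1]) f x.

Definition L1norm f : \bar R :=
  (\int[lebesgue_measure]_(x in `[0%R, 1%R]) (`|f x|)%:E)%E.

Definition inL1 f : Prop :=
  periodic f 1 /\ lebesgue_measure.-integrable `[0, 1] (EFin \o f).

(* Integration by parts against periodic C^1 test functions. *)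
Definition is_weak_deriv f g : Prop :=
  inL1 g /\
  forall phi : R -> R, Ck 1 phi -> periodic phi 1 ->
    cint (fun x => f x * derive1 phi x) = - cint (fun x => g x * phi x).

Definition inW11 f : Prop := inL1 f /\ exists g, is_weak_deriv f g.

(* A representative of the weak derivative, unique up to a null set; 0 when
   there is no weak derivative in L^1. *)
Definition weak_deriv f : R -> R := xget (fun=> 0) (is_weak_deriv f).

Definition W11norm f : \bar R :=
  if `[< inW11 f >] then (L1norm f + L1norm (weak_deriv f))%E else +oo%E.

Definition inL10 f : Prop := inL1 f /\ cint f = 0.
Definition inW110 f : Prop := inW11 f /\ cint f = 0.

Definition density f : Prop :=
  [/\ inL1 f, (\forall x \ae lebesgue_measure, 0 <= f x) & cint f = 1].

End CircleFunctions.

Section CircleMaps.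
Context {R : realType}.
Implicit Types (T h : R -> R) (d k : nat).

Definition is_lift d T : Prop := forall x, T (x + 1) = T x + d%:R.

Definition min_expansion T : R := inf (range (fun x : R => `|derive1 T x|)).

Definition uniformly_expanding T : Prop := 1 < min_expansion T.

(* Topological mixing; open subsets of the circle are 1-periodic open sets. *)
Definition mixing T : Prop :=
  forall U V : set R,
    open U -> U !=set0 -> (forall x, U (x + 1) <-> U x) ->
    open V -> V !=set0 -> (forall x, V (x + 1) <-> V x) ->
    exists N, forall n, (N <= n)%N -> exists2 x, U x & V (iter n T x).

(* Lifts of orientation-preserving C^k diffeomorphisms of the circle. *)
Definition circle_diffeo k h : Prop :=
  [/\ is_lift 1 h, Ck k h &
      exists g : R -> R, [/\ cancel h g, cancel g h & Ck k g]].

(* Sum over the preimages, on the circle, of the class of x. *)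
Definition transfer T (f : R -> R) : R -> R := fun x =>
  \sum_(y \in [set y : R | 0 <= y < 1 /\ exists z : int, T y = x + z%:~R])
    (f y / `|derive1 T y|).

Definition pert_const d T : R :=
  2 * d%:R * (supnorm (derive1 T) + min_expansion T - 1) *
  (1 / min_expansion T ^+ 2 + supnorm (derive1n 2 T) / min_expansion T ^+ 3
   + 1 / min_expansion T).

(* When the Lasota-Yorke inequality of LY_constants holds, applying it to the
   constant 1 gives B >= 1 - l1 > 0, so no division below is by zero. *)
Definition LY_constants T (l1 B : R) : Prop :=
  [/\ 0 < l1 < 1, 0 <= B &
   forall f, inW11 f ->
     (L1norm (transfer T f) <= L1norm f)%E /\
     (W11norm (transfer T f) <= l1%:E * W11norm f + B%:E * L1norm f)%E].

Definition mixing_time T (l1 B : R) (M : nat) : Prop :=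
  l1 ^+ M <= 1 / (10 * (B / (1 - l1) + 1)) /\
  forall v, inW110 v ->
    (L1norm (iter M (transfer T) v) <= (1 / (10 * B))%:E * W11norm v)%E.

Definition admissible d T (l1 B : R) (M : nat) (delta : R) : Prop :=
  0 < delta < min_expansion T - 1 /\
  pert_const d T * delta <=
    7 * (1 - l1) ^+ 2 / (10 * M%:R * B * (1 / (1 - l1) + B)).

(* The lift of T is chosen so that it is C^2-close to the given lift of Ts. *)
Definition near_maps d Ts (delta : R) : set (R -> R) :=
  [set T | [/\ is_lift d T, Ck 3 T, uniformly_expanding T &
    (Cnorm 2 (fun x => (T x - Ts x)%R) < delta%:E)%E]].

(* Joint C^k regularity of (e, x) |-> h e x on [0, e0) x R: D i j is the partial
   derivative of order i in e (one-sided at e = 0) and j in x. *)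
Definition Ck_family k (e0 : R) (h : R -> R -> R) : Prop :=
  exists D : nat -> nat -> R -> R -> R,
  [/\ forall (e x : R), 0 <= e < e0 -> D 0%N 0%N e x = h e x,
      forall i j, (i + j <= k)%N ->
        {within [set p : R * R | 0 <= p.1 < e0],
          continuous (fun p : R * R => D i j p.1 p.2)} &
      forall i j (e x : R), (i + j < k)%N -> 0 <= e < e0 ->
        is_derive x (1 : R) (D i j e) (D i j.+1 e x) /\
        ((D i j e' x - D i j e x) / (e' - e) : R)
          @[e' --> within `[0, e0[ e^'] --> D i.+1 j e x].

End CircleMaps.

Section SequentialOperators.
Context {R : realType}.
Implicit Types (L : int -> (R -> R) -> R -> R) (v : int -> R -> R).

(* cocycle L m k = L_(m+k-1) o ... o L_m *)
Fixpoint cocycle L (m : int) (k : nat) (f : R -> R) : R -> R :=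
  if k is k'.+1 then L (m + k'%:Z) (cocycle L m k' f) else f.

Definition shift_op L v : int -> R -> R := fun n => L (n - 1) (v (n - 1)).

Definition linf (N : (R -> R) -> \bar R) v : \bar R :=
  ereal_sup (range (fun n : int => N (v n))).

Definition linf_L10 v : Prop :=
  (forall n, inL10 (v n)) /\ (linf L1norm v < +oo)%E.

Definition linf_W110 v : Prop :=
  (forall n, inW110 (v n)) /\ (linf W11norm v < +oo)%E.

Definition pert_op (h : R -> R -> R) (T : int -> R -> R) (e : R) (n : int) :
  (R -> R) -> R -> R := transfer (h e \o T n).

(* - (Y L_n mu_n)' *)
Definition source (Y : R -> R) L (mu : int -> R -> R) : int -> R -> R :=
  fun n x => - weak_deriv (fun y => Y y * L n (mu n) y) x.

Definition response_eq L (g eta : int -> R -> R) : Prop :=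
  forall n, \forall x \ae lebesgue_measure,
    eta n x - L (n - 1) (eta (n - 1)) x = g (n - 1) x.

(* L_(n-1) ... L_(n-k) g_(n-k-1) *)
Definition response_term L (g : int -> R -> R) (n : int) (k : nat) : R -> R :=
  cocycle L (n - k%:Z) k (g (n - k%:Z - 1)).

End SequentialOperators.

(* Main.v *)
Require Import Defs.
From HB Require Import structures.
From mathcomp Require Import all_boot all_order all_algebra.
From mathcomp Require Import all_classical all_reals all_analysis.
From mathcomp Require Import measurable_realfun.
From mathcomp Require Import ring lra.
Import Order.TTheory GRing.Theory Num.Theory.
Import numFieldNormedType.Exports.
Local Open Scope classical_set_scope.
Local Open Scope ring_scope.

(** The transfer operator L of an expanding lift T sums over the inverse branches
    S of T, which contract by 1 / lam, with the weight p = 1 / T': at x it is the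
    sum of (f p) (S (x + j)) over j < d (transferE). The proof consists of
    estimates on this formula whose constants depend on the lower bound lam > 1
    for the derivatives and on the bounds K for the higher derivatives, so that
    they are uniform over sequences of maps and over the parameter e.

    Loss of memory. Densities with a c-Lipschitz logarithm are mapped to
    densities with a (c / lam + K)-Lipschitz logarithm. For large c this leaves
    room to subtract a fixed fraction of the mass at each step, so two such
    densities of equal mass are coupled at a geometric rate (cone_contraction),
    and Lipschitz functions of mean zero decay in sup norm (lip_decay). The
    derivatives of a transported function obey the same recursion, damped by
    powers of p and forced by the derivatives of lower order, and decay as well
    (C1_decay, C3_decay). In W^{1,1} one tests with smooth functions
    (l1_duality): the fluctuation of phi o T^k is the derivative of a uniformly
    small function (flow_equidistribution), which gives decay in L^1, and the
    Lasota-Yorke inequality then gives decay of the weak derivative (W11_decay).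

    Densities. The equivariant density mu_n is the limit of the transfers of 1
    from the distant past. Written as a telescoping sum over the past
    (equivariant_density) it converges in C^1, uniformly in e, and for e = 0 in
    C^3 (equivariant_density_spec, equivariant_density_C3).

    Perturbation. The operator of h o T is that of T followed by the
    push-forward by h, so that (L^e f) (h y) = (L f) y / h' y (transfer_comp).
    Expanding in e gives L^e mu = L mu - e (Y L mu)' + o(e) in C^1
    (transfer_expansion), and by duality L^e is close to L from W^{1,1} to L^1
    (transfer_comp_near).

    Response. The sum over the past of the sources g solves the response
    equation, and decay gives uniqueness and the convergence of the series. The
    difference xi between (mu^e - mu) / e and this sum satisfies
    xi_{n+1} = L^e xi_n + r_n with a forcing r that is small in sup norm and
    bounded in C^1. Such a recursion has small bounded solutions: the recent
    terms of the sum over the past of r are few and small, the old ones are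
    forgotten (small_forcing, response_cvg). *)

Set Implicit Arguments.
Unset Strict Implicit.
Unset Printing Implicit Defensive.

(** * Calculus with explicit derivatives *)

Section Calculus.
Context {R : realType}.
Implicit Types f g : R -> R.

Lemma contM f g : continuous f -> continuous g -> continuous (fun x => f x * g x).
Proof. by move=> cf cg x; exact: (continuousM (cf x) (cg x)). Qed.

Lemma contD f g : continuous f -> continuous g -> continuous (fun x => f x + g x).
Proof. by move=> cf cg x; exact: (continuousD (cf x) (cg x)). Qed.

Lemma contN f : continuous f -> continuous (fun x => - f x).
Proof. by move=> cf x; exact: (continuousN (cf x)). Qed.

Lemma contB f g : continuous f -> continuous g -> continuous (fun x => f x - g x).
Proof. by move=> cf cg; apply: contD => //; exact: contN. Qed.

Lemma cont_cst (c : R) : continuous (fun _ : R => c).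
Proof. by move=> x; exact: cvg_cst. Qed.

Lemma contZ (c : R) f : continuous f -> continuous (fun x => c * f x).
Proof. by move=> cf; apply: contM => //; exact: cont_cst. Qed.

Lemma cont_comp f g : continuous f -> continuous g -> continuous (fun x => f (g x)).
Proof. by move=> cf cg x; exact: (continuous_comp (cg x) (cf _)). Qed.

Lemma cont_sum n (f : 'I_n -> R -> R) : (forall i, continuous (f i)) ->
  continuous (fun x => \sum_i f i x).
Proof.
elim: n f => [|n ih] f cf.
  rewrite (_ : (fun x => _) = (fun=> 0)); first exact: cont_cst.
  by apply/funext => x; rewrite big_ord0.
rewrite (_ : (fun x => _) =
  (fun x => \sum_(i < n) f (widen_ord (leqnSn n) i) x + f ord_max x)).
  by apply: contD => //; exact: (ih (fun i => f (widen_ord (leqnSn n) i))).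
by apply/funext => x; rewrite big_ord_recr.
Qed.

Lemma norm_mul (a b A B : R) : `|a| <= A -> `|b| <= B -> `|a * b| <= A * B.
Proof. by move=> ha hb; rewrite normrM ler_pM. Qed.

Lemma norm_add (a b A B : R) : `|a| <= A -> `|b| <= B -> `|a + b| <= A + B.
Proof. by move=> ha hb; apply: le_trans (ler_normD _ _) _; exact: lerD. Qed.

Lemma norm_sub (a b A B : R) : `|a| <= A -> `|b| <= B -> `|a - b| <= A + B.
Proof. by move=> ha hb; apply: norm_add; rewrite ?normrN. Qed.

(** Carrying the derivative as an explicit function avoids derivability side
    conditions when formulas are differentiated repeatedly. *)
Definition has_deriv f g : Prop := forall x, is_derive x (1 : R) f (g x).

Lemma has_deriv_continuous f g : has_deriv f g -> continuous f.
Proof.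
by move=> fg x; apply/differentiable_continuous/derivable1_diffP; case: (fg x).
Qed.

Lemma has_deriv_eq f g g' : has_deriv f g -> g =1 g' -> has_deriv f g'.
Proof. by move=> fg e x; rewrite -e. Qed.

Lemma has_deriv_ext f f' g : has_deriv f g -> f =1 f' -> has_deriv f' g.
Proof. by move=> fg /funext <-. Qed.

Lemma has_deriv_uniq f g g' : has_deriv f g -> has_deriv f g' -> g =1 g'.
Proof.
move=> fg fg' x; have <- := @derive_val _ _ _ _ _ _ _ (fg x).
by rewrite (@derive_val _ _ _ _ _ _ _ (fg' x)).
Qed.

Lemma has_derivE f g : has_deriv f g -> derive1 f = g.
Proof.
by move=> fg; apply/funext => x; rewrite derive1E (@derive_val _ _ _ _ _ _ _ (fg x)).
Qed.

Lemma has_deriv1 f : (forall x, derivable f x 1) -> has_deriv f (derive1 f).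
Proof. by move=> df x; rewrite derive1E; exact/derivableP. Qed.

Lemma has_deriv_cst (c : R) : has_deriv (fun=> c) (fun=> 0).
Proof. by move=> x; exact: is_derive_cst. Qed.

Lemma has_deriv_id : has_deriv id (fun=> 1).
Proof. by move=> x; exact: is_derive_id. Qed.

Lemma has_derivD f f1 g g1 : has_deriv f f1 -> has_deriv g g1 ->
  has_deriv (fun x => f x + g x) (fun x => f1 x + g1 x).
Proof. by move=> hf hg x; have := hf x; have := hg x => ? ?; exact: is_deriveD. Qed.

Lemma has_derivN f f1 : has_deriv f f1 ->
  has_deriv (fun x => - f x) (fun x => - f1 x).
Proof. by move=> hf x; have := hf x => ?; exact: is_deriveN. Qed.

Lemma has_derivB f f1 g g1 : has_deriv f f1 -> has_deriv g g1 ->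
  has_deriv (fun x => f x - g x) (fun x => f1 x - g1 x).
Proof. by move=> hf hg; apply: has_derivD => //; exact: has_derivN. Qed.

Lemma has_derivM f f1 g g1 : has_deriv f f1 -> has_deriv g g1 ->
  has_deriv (fun x => f x * g x) (fun x => f1 x * g x + f x * g1 x).
Proof.
move=> hf hg x; have := hf x; have := hg x => ? ?.
have -> : f1 x * g x + f x * g1 x = f x *: g1 x + g x *: f1 x.
  by rewrite /GRing.scale/= addrC [f1 x * _]mulrC.
exact: is_deriveM.
Qed.

Lemma has_derivZ (c : R) f f1 : has_deriv f f1 ->
  has_deriv (fun x => c * f x) (fun x => c * f1 x).
Proof.
move=> hf; apply: has_deriv_eq (has_derivM (has_deriv_cst c) hf) _ => x /=.
by rewrite mul0r add0r.
Qed.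

Lemma has_deriv_comp f f1 g g1 : has_deriv f f1 -> has_deriv g g1 ->
  has_deriv (fun x => f (g x)) (fun x => f1 (g x) * g1 x).
Proof.
by move=> hf hg x; have := hf (g x); have := hg x => ? ?; exact: is_derive1_comp.
Qed.

Lemma has_derivV f f1 : (forall x, f x != 0) -> has_deriv f f1 ->
  has_deriv (fun x => (f x)^-1) (fun x => - f1 x / f x ^+ 2).
Proof.
move=> f0 hf x; have := hf x => ?.
have -> : - f1 x / f x ^+ 2 = - (f x) ^- 2 *: f1 x.
  by rewrite /GRing.scale/= mulNr mulrC mulNr.
exact: is_deriveV.
Qed.

Lemma has_deriv_sum n (f f1 : 'I_n -> R -> R) :
  (forall i, has_deriv (f i) (f1 i)) ->
  has_deriv (fun x => \sum_i f i x) (fun x => \sum_i f1 i x).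
Proof.
move=> hf x; rewrite (_ : (fun x => _) = \sum_i f i); last first.
  by apply/funext => y; rewrite fct_sumE.
by have hfx i := hf i x; exact: is_derive_sum.
Qed.

Lemma mvt f g x y : has_deriv f g ->
  exists2 z, `|z - x| <= `|y - x| & f y - f x = g z * (y - x).
Proof.
move=> fg; have cf := has_deriv_continuous fg.
have [xy|yx] := leP x y.
  have [||z] := @MVT_segment R f g x y xy.
  - by move=> z _; exact: fg.
  - exact: continuous_subspaceT.
  rewrite in_itv/= => /andP[xz zy] e; exists z => //.
  by rewrite !ger0_norm ?subr_ge0// lerD2r.
have [||z] := @MVT_segment R f g y x (ltW yx).
- by move=> z _; exact: fg.
- exact: continuous_subspaceT.
rewrite in_itv/= => /andP[yz zx] e; exists z.
  by rewrite !(distrC _ x) !ger0_norm ?subr_ge0 ?(ltW yx)// lerD2l lerN2.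
by rewrite -opprB e -mulrN opprB.
Qed.

Lemma deriv_lip f g (K : R) : has_deriv f g -> (forall z, `|g z| <= K) ->
  forall x y, `|f x - f y| <= K * `|x - y|.
Proof.
move=> fg gK x y; have [z _ ->] := mvt y x fg.
by rewrite normrM ler_wpM2r.
Qed.

Lemma lip_continuous f (K : R) :
  (forall x y, `|f x - f y| <= K * `|x - y|) -> continuous f.
Proof.
move=> fK x; apply/cvgrPdist_le => e e0.
have K0 : 0 <= K by have := fK 1 0; rewrite subr0 normr1 mulr1; apply: le_trans.
have K1 : 0 < K + 1 by rewrite ltr_wpDl.
have eK : 0 < e / (K + 1) by exact: divr_gt0.
have xe : \forall y \near x, `|x - y| <= e / (K + 1).
  exact: (@cvgr_dist_le _ _ _ (nbhs x) _ id x cvg_id).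
apply: filterS xe => y yx; apply: (le_trans (fK _ _)).
apply: (@le_trans _ _ ((K + 1) * `|x - y|)).
  by rewrite ler_wpM2r// lerDl.
by rewrite mulrC -ler_pdivlMr.
Qed.

Lemma taylor1 f g h (K : R) : has_deriv f g -> has_deriv g h ->
  (forall z, `|h z| <= K) ->
  forall x y, `|f y - f x - g x * (y - x)| <= K * `|y - x| ^+ 2.
Proof.
move=> fg gh hK x y; have [z zx ->] := mvt x y fg.
rewrite -mulrBl normrM expr2 mulrA ler_wpM2r//.
apply: le_trans (deriv_lip gh hK _ _) _.
by rewrite ler_wpM2l// (le_trans _ (hK x)).
Qed.

Lemma Ck1P f : Ck 1 f <-> exists2 g, has_deriv f g & continuous g.
Proof.
split => [[h1 h2]|[g fg cg]].
  exists (derive1 f); last by have := h2 1%N isT; rewrite derive1n1.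
  by apply: has_deriv1 => x; exact: (h1 0%N x isT).
split => [[|//] x _|[|[|//]]].
- by case: (fg x).
- by move=> _; exact: (has_deriv_continuous fg).
- by move=> _; rewrite derive1n1 (has_derivE fg).
Qed.

Lemma Ck_deriv k f j : Ck k f -> (j < k)%N ->
  has_deriv (derive1n j f) (derive1n j.+1 f).
Proof. by move=> [h _] jk; rewrite derive1nS; apply: has_deriv1 => x; exact: h. Qed.

End Calculus.

(** * Change of variables for measurable functions *)

Section Substitution.
Context {R : realType}.
Notation mu := (@lebesgue_measure R).
Variables (S s : R -> R).
Hypotheses (hS : has_deriv S s) (cs : continuous s) (s0 : forall x, 0 < s x).
Variable T : R -> R.
Hypothesis TS : cancel T S.

Let Smono x y : (S x <= S y) = (x <= y).
Proof.
have lt x' y' : x' < y' -> S x' < S y'.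
  move=> xy; rewrite -subr_gt0.
  by have [z _ ->] := mvt x' y' hS; rewrite mulr_gt0 ?subr_gt0.
have [xy|yx] := leP x y; last by apply/negbTE; rewrite -ltNge; exact: lt.
by move: xy; rewrite le_eqVlt => /predU1P[->|/lt/ltW]; rewrite ?lexx.
Qed.

(** The measure that the change of variables turns into Lebesgue measure. *)
Definition density_measure (A : set (measurableTypeR R)) : \bar R :=
  (\int[mu]_(x in A) (s x)%:E)%E.

Local Notation nu := density_measure.

Let ms : measurable_fun setT (EFin \o s).
Proof. by apply/measurable_EFinP; exact: continuous_measurable_fun. Qed.

Let nu0 : nu set0 = 0%E. Proof. by rewrite /nu integral_set0. Qed.

Let nu_ge0 A : (0 <= nu A)%E.
Proof. by apply: integral_ge0 => x _; rewrite lee_fin ltW. Qed.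

Let nu_sigma : semi_sigma_additive nu.
Proof.
apply: (@semi_sigma_additive_nng_induced _ (measurableTypeR R) R mu (EFin \o s)) => //.
by move=> x; rewrite lee_fin ltW.
Qed.

HB.instance Definition _ := isMeasure.Build _ _ _ nu nu0 nu_ge0 nu_sigma.

Let S' : measurableTypeR R -> measurableTypeR R := S.

Let mS : measurable_fun [set: measurableTypeR R] S'.
Proof. exact: continuous_measurable_fun (has_deriv_continuous hS). Qed.

Lemma pushforward_density A : measurable A -> mu A = pushforward nu S A.
Proof.
pose nuS := [the {measure set (measurableTypeR R) -> \bar R} of pushforward nu S'].
move=> mA; rewrite -[RHS]/(nuS mS A); apply: lebesgue_measure_unique mA => //= _ [[a b]] _ <- /=.
rewrite lebesgue_measure_itv/= /pushforward.
rewrite (_ : S @^-1` _ = `]T a, T b]%classic); last first.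
  apply/seteqP; split => x /=; rewrite !in_itv/= -(TS a) -(TS b) !ltNge !Smono !TS//.
rewrite /nu; case: ifPn => ab.
  have TT : T a < T b by rewrite ltNge -Smono !TS -ltNge.
  rewrite integral_itv_obnd_cbnd; last exact: measurable_funTS.
  rewrite (@continuous_FTC2 _ s S) ?TS//.
  - exact: continuous_subspaceT.
  - split; last 2 first.
    + exact/cvg_at_right_filter/(has_deriv_continuous hS).
    + exact/cvg_at_left_filter/(has_deriv_continuous hS).
    by move=> x _; case: (hS x).
  - by move=> x _; rewrite (has_derivE hS).
rewrite set_itv_ge ?integral_set0// bnd_simp -leNgt.
by rewrite -Smono !TS leNgt.
Qed.

Import HBNNSimple.

Let subst_indic A : measurable A ->
  (\int[mu]_x (\1_A x)%:E = \int[mu]_x ((\1_A (S x))%:E * (s x)%:E))%E.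
Proof.
move=> mA; transitivity (nu (S @^-1` A)).
  by rewrite integral_indic// setIT; exact: pushforward_density.
have mSA : measurable (S @^-1` A) by rewrite -[X in measurable X]setTI; exact: mS.
rewrite /nu integral_mkcond; apply: eq_integral => x _.
rewrite patchE indicE; case: ifPn => xA.
  by rewrite (_ : (S x \in A) = true) ?mul1e//; move: xA; rewrite !inE.
by rewrite (_ : (S x \in A) = false) ?mul0e//; apply: contraNF xA; rewrite !inE.
Qed.

Let subst_nnsfun (h : {nnsfun R >-> R}) :
  (\int[mu]_x (h x)%:E = \int[mu]_x ((h (S x))%:E * (s x)%:E))%E.
Proof.
have mind r : measurable_fun setT (fun x : R => (r * \1_(h @^-1` [set r]) x)%:E).
  by apply/measurable_EFinP; exact: measurable_funM.
transitivity (\int[mu]_x \sum_(y \in range h) (y * \1_(h @^-1` [set y]) x)%:E)%E.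
  by apply: eq_integral => x _; rewrite fimfunE -fsumEFin.
transitivity (\int[mu]_x \sum_(y \in range h)
    ((y * \1_(h @^-1` [set y]) (S x))%:E * (s x)%:E))%E; last first.
  apply: eq_integral => x _; rewrite -ge0_mule_fsuml; last first.
    by move=> y; exact: nnfun_muleindic_ge0.
  by rewrite fsumEFin// -fimfunE.
rewrite !ge0_integral_fsum//; last 3 first.
- move=> y; apply: emeasurable_funM => //.
  exact: (measurableT_comp (mind y) mS).
- move=> y x _; rewrite mule_ge0 ?lee_fin ?(ltW (s0 x))//.
  exact: nnfun_muleindic_ge0.
- by move=> y x _; exact: nnfun_muleindic_ge0.
apply: eq_fsbigr => y; rewrite inE => -[t _ yE].
have y0 : 0 <= y by rewrite -yE.
have mhy : measurable (h @^-1` [set y]) by exact: measurable_sfunP.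
under eq_integral do rewrite EFinM.
under [RHS]eq_integral do rewrite EFinM -muleA.
rewrite ge0_integralZl ?lee_fin//; last exact/measurable_EFinP.
rewrite [RHS]ge0_integralZl ?lee_fin//; last first.
- by move=> x _; rewrite mule_ge0 ?lee_fin ?(ltW (s0 x)).
- apply: emeasurable_funM => //; apply/measurable_EFinP.
  by apply: (measurableT_comp _ mS).
by rewrite subst_indic.
Qed.

(** Proved on indicators, where it is the uniqueness of Lebesgue measure, and
    extended by monotone approximation. *)
Lemma ge0_substitution (D : set R) (G : R -> \bar R) : measurable D ->
  measurable_fun D G -> (forall x, D x -> 0 <= G x)%E ->
  (\int[mu]_(x in D) G x = \int[mu]_(x in S @^-1` D) (G (S x) * (s x)%:E))%E.
Proof.
move=> mD mG G0.
have mSD : measurable (S @^-1` D) by rewrite -[X in measurable X]setTI; exact: mS.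
rewrite integral_mkcond [RHS]integral_mkcond.
have mH : measurable_fun setT (G \_ D).
  exact: ((measurable_restrictT G mD).1 mG).
set H := G \_ D in mH *.
have H0 x : (0 <= H x)%E by rewrite /H patchE; case: ifPn => // /set_mem /G0.
transitivity (\int[mu]_x (H (S x) * (s x)%:E))%E; last first.
  apply: eq_integral => x _; rewrite /H !patchE.
  rewrite (_ : (x \in S @^-1` D) = (S x \in D)); last by apply/idP/idP; rewrite !inE.
  by case: ifP => //; rewrite mul0e.
pose h := nnsfun_approx measurableT mH.
have hH x : (EFin \o h^~ x) @ \oo --> H x by exact: cvg_nnsfun_approx.
have hm x : {homo h^~ x : m n / (m <= n)%N >-> m <= n}.
  by move=> m n mn; exact/lefP/nd_nnsfun_approx.
transitivity (limn (fun n => \int[mu]_x (h n x)%:E)%E).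
  rewrite -monotone_convergence//.
  - by apply: eq_integral => x _; apply/esym/cvg_lim => //; exact: hH.
  - by move=> n; apply/measurable_EFinP; exact: (@measurable_funPT _ _ _ _ (h n)).
  - by move=> n x _; rewrite lee_fin.
  - by move=> x _ m n mn; rewrite lee_fin; exact: hm.
transitivity (limn (fun n => \int[mu]_x ((h n (S x))%:E * (s x)%:E))%E).
  by congr (limn _); apply/funext => n; exact: subst_nnsfun.
rewrite -monotone_convergence//.
- apply: eq_integral => x _; apply/cvg_lim => //.
  by apply: cvgeZr => //; exact: hH.
- move=> n; apply: emeasurable_funM => //; apply/measurable_EFinP.
  by apply: (measurable_comp measurableT).
- by move=> n x _; rewrite mule_ge0 ?lee_fin ?(ltW (s0 x)).
- by move=> x _ m n mn; rewrite lee_wpmul2r ?lee_fin ?(ltW (s0 x))//; exact: hm.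
Qed.

End Substitution.

(** * Integrable functions on the circle *)

Section CircleIntegration.
Context {R : realType}.
Notation mu := (@lebesgue_measure R).
Implicit Types (f g h : R -> R).

Lemma aeS (P Q : R -> Prop) : (forall x, P x -> Q x) ->
  (\forall x \ae mu, P x) -> \forall x \ae mu, Q x.
Proof. by move=> PQ; apply: filterS => //; exact: (ae_filter_ringOfSetsType mu). Qed.

Lemma aeS2 (P Q S : R -> Prop) : (forall x, P x -> Q x -> S x) ->
  (\forall x \ae mu, P x) -> (\forall x \ae mu, Q x) -> \forall x \ae mu, S x.
Proof. by move=> PQ; apply: filterS2 => //; exact: (ae_filter_ringOfSetsType mu). Qed.

Lemma aeT (P : R -> Prop) : (forall x, P x) -> \forall x \ae mu, P x.
Proof. by move=> h; apply: aeW. Qed.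

Lemma periodicz f : periodic f 1 -> forall x (z : int), f (x + z%:~R) = f x.
Proof.
move=> pf x [n|n].
  by have := periodicn pf n x; rewrite -mulr_natl mulr1.
have := periodicn pf n.+1 (x - n.+1%:R); rewrite -mulr_natl mulr1 subrK => ->.
by rewrite NegzE mulrNz.
Qed.

Lemma periodic_frac f : periodic f 1 ->
  forall x, f x = f (x - (Num.floor x)%:~R).
Proof. by move=> pf x; rewrite -mulrNz periodicz. Qed.

Lemma frac_itv (x : R) : 0 <= x - (Num.floor x)%:~R < 1.
Proof.
have /andP[h1 h2] := floor_itv x.
by rewrite subr_ge0 h1/= ltrBlDr addrC -[1]/(1%:~R) -intrD.
Qed.

Lemma periodic_ind (P : R -> Prop) f : periodic f 1 ->
  (forall x, 0 <= x < 1 -> P (f x)) -> forall x, P (f x).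
Proof. by move=> pf h x; rewrite periodic_frac//; apply: h; exact: frac_itv. Qed.

Lemma periodic_max f : continuous f -> periodic f 1 ->
  exists c, forall x, `|f x| <= `|f c|.
Proof.
move=> cf pf.
have cn : {within `[0, 1], continuous (fun x => `|f x|)}.
  apply: continuous_subspaceT => x.
  exact: (continuous_comp (cf x) (@norm_continuous _ _ _)).
have [c _ hc] := @EVT_max R (fun x => `|f x|) 0 1 ler01 cn.
exists c; apply: (@periodic_ind (fun y => `|y| <= `|f c|)) => // x /andP[x0 x1].
by apply: hc; rewrite in_itv/= x0 ltW.
Qed.

Lemma periodic_bounded f : continuous f -> periodic f 1 ->
  exists2 K, 0 <= K & forall x, `|f x| <= K.
Proof. by move=> cf pf; have [c hc] := periodic_max cf pf; exists `|f c|. Qed.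

Lemma measurable_frac : measurable_fun setT (fun x : R => x - (Num.floor x)%:~R).
Proof.
apply: measurable_funB => //.
apply: nondecreasing_measurable => // x y xy.
by rewrite ler_int; exact: le_floor.
Qed.

Lemma inL1_measurable f : inL1 f -> measurable_fun setT f.
Proof.
move=> [pf /integrableP[/measurable_EFinP mf _]].
rewrite (_ : f = f \o (fun x => x - (Num.floor x)%:~R)); last first.
  by apply/funext => x /=; exact: periodic_frac.
apply: measurable_comp mf measurable_frac => //.
move=> _ [x _ <-] /=; have /andP[? ?] := frac_itv x.
by rewrite in_itv/=; apply/andP; split => //; exact: ltW.
Qed.

Let mu01 : mu `[0, 1]%classic = 1%E.
Proof.
have := @lebesgue_measure_itv R `[0, 1].
by rewrite /= lte_fin ltr01 -EFinB subr0.
Qed.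

Lemma inL1_bounded f (K : R) : measurable_fun setT f -> periodic f 1 ->
  (forall x, `|f x| <= K) -> inL1 f.
Proof.
move=> mf pf fK; split => //; apply: measurable_bounded_integrable => //.
- by rewrite [X in (X < _)%E]mu01 ltry.
- exact: measurable_funTS.
- exists K; split; first exact: num_real.
  by move=> M KM x _; exact: le_trans (fK x) (ltW KM).
Qed.

Lemma inL1_continuous f : continuous f -> periodic f 1 -> inL1 f.
Proof.
move=> cf pf; have [K _ fK] := periodic_bounded cf pf.
by apply: (@inL1_bounded _ K) => //; exact: continuous_measurable_fun.
Qed.

Lemma inL1D f g : inL1 f -> inL1 g -> inL1 (fun x => f x + g x).
Proof.
move=> [pf If] [pg Ig]; split; first by move=> x; rewrite pf pg.
exact: (integrableD _ If Ig).
Qed.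

Lemma inL1Z (c : R) f : inL1 f -> inL1 (fun x => c * f x).
Proof.
move=> [pf If]; split; first by move=> x; rewrite pf.
exact: (integrableZl _ c If).
Qed.

Lemma inL1N f : inL1 f -> inL1 (fun x => - f x).
Proof.
by move=> /(inL1Z (-1)); congr inL1; apply/funext => x; rewrite mulN1r.
Qed.

Lemma inL1B f g : inL1 f -> inL1 g -> inL1 (fun x => f x - g x).
Proof. by move=> If Ig; apply: inL1D => //; exact: inL1N. Qed.

Lemma inL1_cst (c : R) : inL1 (fun=> c : R).
Proof. by apply: inL1_continuous => // x; exact: cvg_cst. Qed.

Lemma inL1_sum n (f : 'I_n -> R -> R) : (forall i, inL1 (f i)) ->
  inL1 (fun x => \sum_i f i x).
Proof.
elim: n f => [|n ih] f hf.
  have := inL1_cst 0; congr inL1; apply/funext => x; by rewrite big_ord0.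
have := inL1D (ih (fun i => f (widen_ord (leqnSn n) i)) (fun i => hf _)) (hf ord_max).
by congr inL1; apply/funext => x; rewrite big_ord_recr.
Qed.

Lemma inL1_norm f : inL1 f -> inL1 (fun x => `|f x|).
Proof.
move=> [pf If]; split; first by move=> x; rewrite pf.
exact: integrable_norm.
Qed.

Lemma inL1M f h (K : R) : inL1 f -> measurable_fun setT h -> periodic h 1 ->
  (forall x, `|h x| <= K) -> inL1 (fun x => f x * h x).
Proof.
move=> [pf If] mh ph hK; split; first by move=> x; rewrite pf ph.
apply: (@integrableMl _ _ _ mu _ _ (EFin \o f) h) => //; first exact: measurable_funTS.
exists K; split; first exact: num_real.
by move=> M KM x _; exact: le_trans (hK x) (ltW KM).
Qed.

Lemma inL1Mc f h : inL1 f -> continuous h -> periodic h 1 ->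
  inL1 (fun x => f x * h x).
Proof.
move=> If ch ph; have [K _ hK] := periodic_bounded ch ph.
by apply: (inL1M If _ ph hK); exact: continuous_measurable_fun.
Qed.

Lemma cintD f g : inL1 f -> inL1 g ->
  cint (fun x => f x + g x) = cint f + cint g.
Proof. by move=> [_ If] [_ Ig]; exact: RintegralD. Qed.

Lemma cintB f g : inL1 f -> inL1 g ->
  cint (fun x => f x - g x) = cint f - cint g.
Proof. by move=> [_ If] [_ Ig]; exact: RintegralB. Qed.

Lemma cintZ (c : R) f : inL1 f -> cint (fun x => c * f x) = c * cint f.
Proof. by move=> [_ If]; exact: RintegralZl. Qed.

Lemma cintN f : inL1 f -> cint (fun x => - f x) = - cint f.
Proof.
move=> If; rewrite -mulN1r -cintZ//; congr cint.
by apply/funext => x; rewrite mulN1r.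
Qed.

Lemma le_cint f g : inL1 f -> inL1 g -> (forall x, f x <= g x) ->
  cint f <= cint g.
Proof. by move=> [_ If] [_ Ig] fg; exact: le_Rintegral. Qed.

Lemma cint_cst (c : R) : cint (fun=> c) = c.
Proof.
rewrite /cint Rintegral_cst//.
by rewrite [X in fine X]mu01/= mulr1.
Qed.

Lemma cint_ge0 f : (forall x, 0 <= f x) -> 0 <= cint f.
Proof. by move=> f0; apply: Rintegral_ge0. Qed.

Lemma cint_bound f (a b : R) : inL1 f -> (forall x, a <= f x <= b) ->
  a <= cint f <= b.
Proof.
move=> If fab; rewrite -[X in X <= cint f <= _]cint_cst -[X in _ <= cint f <= X]cint_cst.
by apply/andP; split; apply: le_cint => //;
  try exact: inL1_cst; move=> x; case/andP: (fab x).
Qed.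

Definition l1 f : R := cint (fun x => `|f x|).

Lemma L1normE f : inL1 f -> L1norm f = (l1 f)%:E.
Proof.
move=> [_ If]; rewrite /l1 /cint /Rintegral fineK//.
by apply: integrable_fin_num => //; exact: integrable_norm.
Qed.

Lemma l1_ge0 f : 0 <= l1 f. Proof. exact: cint_ge0. Qed.

Lemma l1D f g : inL1 f -> inL1 g -> l1 (fun x => f x + g x) <= l1 f + l1 g.
Proof.
move=> If Ig; rewrite /l1 -cintD; try exact: inL1_norm.
apply: le_cint => [||x]; last exact: ler_normD.
  by apply: inL1_norm; exact: inL1D.
by apply: inL1D; exact: inL1_norm.
Qed.

Lemma l1N f : l1 (fun x => - f x) = l1 f.
Proof. by congr cint; apply/funext => x; rewrite normrN. Qed.

Lemma l1B f g : inL1 f -> inL1 g -> l1 (fun x => f x - g x) <= l1 f + l1 g.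
Proof. by move=> If Ig; rewrite -(l1N g); apply: l1D => //; exact: inL1N. Qed.

Lemma l1_le f (K : R) : inL1 f -> (forall x, `|f x| <= K) -> l1 f <= K.
Proof.
move=> If fK; suff /andP[] : 0 <= l1 f <= K by [].
by apply: (cint_bound (inL1_norm If)) => x; rewrite normr_ge0 fK.
Qed.

Lemma le_cint_l1 f : inL1 f -> `|cint f| <= l1 f.
Proof. by move=> [_ If]; exact: le_normr_Rintegral. Qed.

Lemma cintM_le f h (K : R) : inL1 f -> measurable_fun setT h -> periodic h 1 ->
  (forall x, `|h x| <= K) -> `|cint (fun x => f x * h x)| <= K * l1 f.
Proof.
move=> If mh ph hK; apply: (le_trans (le_cint_l1 (inL1M If mh ph hK))).
rewrite /l1 -cintZ; last exact: inL1_norm.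
apply: le_cint => [||x].
- by apply: inL1_norm; exact: inL1M hK.
- by apply: inL1Z; exact: inL1_norm.
- by rewrite normrM mulrC ler_wpM2r.
Qed.

Lemma ae_eq_l1 f g : inL1 f -> inL1 g ->
  (\forall x \ae mu, f x = g x) -> l1 (fun x => f x - g x) = 0.
Proof.
move=> If Ig fg; apply/eqP; rewrite -eqe -L1normE; last exact: inL1B.
set w := fun x => f x - g x.
have mw : measurable_fun (`[0, 1]%classic : set R) (EFin \o w).
  have mw := inL1_measurable (inL1B If Ig).
  exact/measurable_EFinP/measurable_funTS.
apply/eqP; have := (ae_eq_integral_abs mu (measurable_itv `[0, 1]) mw).2; apply.
by apply: aeS fg => x fgx _ /=; rewrite /w fgx subrr.
Qed.

Lemma cint_ae_eq f g : inL1 f -> inL1 g ->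
  (\forall x \ae mu, f x = g x) -> cint f = cint g.
Proof.
move=> If Ig fg; apply/eqP; rewrite -subr_eq0 -cintB// -normr_le0.
by rewrite -(ae_eq_l1 If Ig fg); apply: le_cint_l1; exact: inL1B.
Qed.

End CircleIntegration.

(** * Null sets, translations and periods *)

Section CircleMeasure.
Context {R : realType}.
Notation mu := (@lebesgue_measure R).
Implicit Types (f g h : R -> R).

Lemma has_deriv_shift (t : R) : has_deriv (fun x : R => x + t) (fun=> 1).
Proof.
apply: has_deriv_eq (has_derivD (@has_deriv_id R) (has_deriv_cst t)) _ => x.
by rewrite addr0.
Qed.

Lemma lift_deriv_periodic d (T T1 : R -> R) : is_lift d T -> has_deriv T T1 ->
  periodic T1 1.
Proof.
move=> lT hT x; have h1 := has_deriv_comp hT (has_deriv_shift 1).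
have h2 := has_derivD hT (has_deriv_cst d%:R).
by have := has_deriv_uniq (has_deriv_ext h1 lT) h2 x; rewrite mulr1 addr0.
Qed.

Lemma periodic_increment (f f1 : R -> R) : has_deriv f f1 -> periodic f1 1 ->
  forall x, f (x + 1) - f x = f 1 - f 0.
Proof.
move=> hf pf1 x; have hd := has_derivB (has_deriv_comp hf (has_deriv_shift 1)) hf.
have hd0 : forall y, is_derive y (1 : R) (fun x => f (x + 1) - f x) 0.
  by move=> y; have := hd y; rewrite pf1 mulr1 subrr.
by rewrite (is_derive_0_is_cst x 0 hd0) add0r.
Qed.

Lemma ge0_integral_shift (t : R) (D : set R) (G : R -> \bar R) : measurable D ->
  measurable_fun D G -> (forall x, D x -> 0 <= G x)%E ->
  (\int[mu]_(x in D) G x = \int[mu]_(x in [set x | D (x + t)%R]) G (x + t)%R)%E.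
Proof.
move=> mD mG G0.
have TS : cancel (fun x => x - t) (fun x => x + t) by move=> x; exact: subrK.
have c1 : continuous (fun _ : R => 1 : R) by move=> x; exact: cvg_cst.
rewrite (ge0_substitution (has_deriv_shift t) c1 (fun=> ltr01) TS mD mG G0).
by apply: eq_integral => x _; rewrite mule1.
Qed.

Lemma negligible_shift (t : R) (N : set R) : mu.-negligible N ->
  mu.-negligible [set x | N (x + t)].
Proof.
move=> [M [mM M0 NM]]; exists [set x | M (x + t)].
have mMt : measurable [set x | M (x + t)].
  rewrite -[X in measurable X]setTI.
  exact: (measurable_funD (@measurable_id _ _ setT) (measurable_cst t)).
split => //; last by move=> x /NM.
have := @ge0_integral_shift t M (cst 1%E) mM (measurable_cst _) (fun _ _ => lee01).
by rewrite !integral_cst// !mul1e => MM; exact: etrans (esym MM) M0.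
Qed.

Lemma periodic_ae (P : set R) : (forall x (z : int), P (x + z%:~R) -> P x) ->
  (\forall x \ae mu, `[0, 1]%classic x -> P x) -> \forall x \ae mu, P x.
Proof.
move=> pP h; set N := ~` [set x | `[0, 1]%classic x -> P x].
have N0 : mu.-negligible N by [].
have : mu.-negligible
    (\bigcup_n ([set x | N (x + n%:R)] `|` [set x | N (x + - n%:R)])).
  by apply: negligible_bigcup => n; apply: negligibleU; exact: negligible_shift.
apply: negligibleS.
move=> x /= nPx; set z := - Num.floor x.
have Nz : N (x + z%:~R).
  rewrite /N/= => /(_ _) H; apply: nPx; apply: (pP _ z); apply: H.
  rewrite /z mulrNz in_itv/=; have /andP[-> /ltW ->//] := frac_itv x.
by case: z Nz => n Nn; [exists n => //; left | exists n.+1 => //; right].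
Qed.

Lemma l1_eq0 f : inL1 f -> l1 f = 0 -> \forall x \ae mu, f x = 0.
Proof.
move=> If f0; apply: periodic_ae => [x z|].
  by rewrite periodicz//; case: If.
have mw := inL1_measurable If.
have mf : measurable_fun (`[0, 1]%classic : set R) (EFin \o f).
  exact/measurable_EFinP/measurable_funTS.
have := (ae_eq_integral_abs mu (measurable_itv `[0, 1]) mf).1.
move=> /(_ _)/aeS; apply => [x h /h [] //|].
by have := L1normE If; rewrite f0.
Qed.

Lemma ge0_integral_itv_split (a b c : R) (G : R -> \bar R) : a <= b -> b <= c ->
  measurable_fun setT G -> (forall x, 0 <= G x)%E ->
  (\int[mu]_(x in `[a, c]) G x =
   \int[mu]_(x in `[a, b]) G x + \int[mu]_(x in `[b, c]) G x)%E.
Proof.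
move=> ab bc mG G0.
rewrite -(integral_itv_obnd_cbnd (r := b)); last exact: measurable_funTS.
rewrite -ge0_integral_setU//=; last 2 first.
- exact: measurable_funTS.
- apply/disj_setPS => y [/=]; rewrite !in_itv/= => /andP[_ yb] /andP[].
  by rewrite ltNge yb.
congr integral; apply/seteqP; split => x /=; rewrite !in_itv/=.
  by move=> /andP[-> ->]; rewrite andbT; case: leP; [left|right].
by move=> [/andP[-> /le_trans->//]|/andP[/ltW bx ->]]; rewrite andbT (le_trans ab).
Qed.

Lemma ge0_integral_period (a : R) (G : R -> \bar R) :
  measurable_fun setT G -> (forall x, 0 <= G x)%E ->
  (forall x (z : int), G (x + z%:~R) = G x) ->
  (\int[mu]_(x in `[a, (a + 1)%R]) G x = \int[mu]_(x in `[0%R, 1%R]) G x)%E.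
Proof.
move=> mG G0 pG.
have sh (b c : R) (z : int) : (\int[mu]_(x in `[(b + z%:~R)%R, (c + z%:~R)%R]) G x =
    \int[mu]_(x in `[b, c]) G x)%E.
  rewrite (ge0_integral_shift z%:~R)//; last exact: measurable_funTS.
  under eq_integral do rewrite pG.
  by congr integral; apply/seteqP; split => x /=; rewrite !in_itv/= !lerD2r.
set n := Num.floor a; have /andP[na an] := floor_itv a.
rewrite -/n intrD in na an.
rewrite (@ge0_integral_itv_split a (n%:~R + 1)) ?(ltW an) ?lerD2r//.
rewrite -[(n%:~R + 1)%R]/(n%:~R + 1%:~R)%R (sh n%:~R a 1) addeC.
rewrite -ge0_integral_itv_split ?(ltW an)//.
by rewrite -(sh 0 1 n) add0r addrC.
Qed.

End CircleMeasure.

(** * Expanding lifts and their inverse branches *)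

Section ExpandingLifts.
Context {R : realType}.

(** One lift with its first two derivatives and the two constants that govern
    all the estimates: lam for the expansion, K for the distortion. *)
Record expanding (d : nat) (lam K : R) (T T1 T2 : R -> R) : Prop := Expanding {
  exp_gt1 : 1 < lam;
  exp_lift : is_lift d T;
  exp_d1 : has_deriv T T1;
  exp_d2 : has_deriv T1 T2;
  exp_cont : continuous T2;
  exp_lam : forall x, lam <= T1 x;
  exp_K : forall x, `|T2 x| <= K }.

(** The derivative of the inverse branch at T x, as a function of x: the weight
    of the transfer operator. *)
Definition invd (T1 : R -> R) : R -> R := fun x => (T1 x)^-1.

(** The derivative of the weight. *)
Definition invd1 (T1 T2 : R -> R) : R -> R := fun x => - T2 x / T1 x ^+ 2.

Definition branch (T : R -> R) (y : R) : R := xget 0 [set x | T x = y].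

Variables (d : nat) (lam K : R) (T T1 T2 : R -> R).
Hypothesis E : expanding d lam K T T1 T2.
Local Notation p := (invd T1).
Local Notation p1 := (invd1 T1 T2).
Local Notation S := (branch T).

Let lam1 := exp_gt1 E.
Let lam0 : 0 < lam. Proof. exact: lt_trans ltr01 lam1. Qed.

Lemma exp_T1_gt0 x : 0 < T1 x. Proof. exact: lt_le_trans lam0 (exp_lam E x). Qed.

Lemma exp_K_ge0 : 0 <= K. Proof. exact: le_trans (normr_ge0 _) (exp_K E 0). Qed.

Lemma exp_mono x y : x <= y -> lam * (y - x) <= T y - T x.
Proof.
move=> xy; have [z _ ->] := mvt x y (exp_d1 E).
by rewrite ler_wpM2r ?subr_ge0//; exact: (exp_lam E).
Qed.

Lemma exp_dist x y : lam * `|x - y| <= `|T x - T y|.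
Proof.
wlog xy : x y / x <= y => [h|].
  by have [/h//|/ltW/h] := leP x y; rewrite distrC (distrC (T y)).
have := exp_mono xy; rewrite distrC ger0_norm ?subr_ge0// => /le_trans; apply.
by rewrite distrC ler_norm.
Qed.

Lemma exp_inj : injective T.
Proof.
move=> x y Txy; apply/eqP; rewrite -subr_eq0 -normr_le0 -(pmulr_rle0 _ lam0).
by rewrite (le_trans (exp_dist x y))// Txy subrr normr0.
Qed.

Lemma exp_liftz x (m : int) : T (x + m%:~R) = T x + m%:~R * d%:R.
Proof.
have pT : periodic (fun x => T x - x * d%:R) 1.
  by move=> y; rewrite (exp_lift E) mulrDl mul1r opprD addrACA subrr addr0.
have /eqP := periodicz pT x m.
by rewrite subr_eq => /eqP ->; rewrite mulrDl addrA subrK.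
Qed.

Lemma exp_d_gt0 : (0 < d)%N.
Proof.
case: (posnP d) => // d0; have := exp_mono (ler01 : (0 : R) <= 1).
rewrite -[X in T X - _]add0r (exp_lift E) d0 addr0 subrr subr0 mulr1.
by rewrite leNgt lam0.
Qed.

Lemma branchK : cancel S T.
Proof.
move=> y; suff [x Txy] : exists x, T x = y by exact: (@xgetPex _ 0 [set z | T z = y] (ex_intro _ x Txy)).
set a := `|y - T 0|.
have a0 : 0 <= a by exact: normr_ge0.
have la : a <= lam * a by rewrite ler_peMl// ltW.
have up : y <= T a.
  have := exp_mono a0; rewrite subr0 => h.
  by have := ler_norm (y - T 0); rewrite -/a; lra.
have dn : T (- a) <= y.
  have := @exp_mono (- a) 0; rewrite oppr_le0 => /(_ a0); rewrite sub0r opprK => h.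
  by have := ler_norm (T 0 - y); rewrite distrC -/a; lra.
have [|||c _ Tc] := @IVT R T (- a) a y; last by exists c.
- by rewrite (le_trans _ a0)// oppr_le0.
- by apply: continuous_subspaceT; exact: has_deriv_continuous (exp_d1 E).
- by rewrite ge_min dn le_max up orbT.
Qed.

Lemma Kbranch : cancel T S.
Proof. by move=> x; apply: exp_inj; rewrite branchK. Qed.

Lemma branch_lip x y : `|S x - S y| <= lam^-1 * `|x - y|.
Proof. by rewrite ler_pdivlMl// (le_trans (exp_dist _ _))// !branchK. Qed.

Lemma branch_continuous : continuous S.
Proof. exact: lip_continuous branch_lip. Qed.

Lemma branch_deriv : has_deriv S (fun y => p (S y)).
Proof.
move=> y; rewrite -{1}(branchK y); apply: (@is_derive_inverse _ T).
- exact: (@filterE _ (nbhs (S y)) _ _ Kbranch).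
- exact: (@filterE _ (nbhs (S y)) _ _ (has_deriv_continuous (exp_d1 E))).
- exact: (exp_d1 E).
- by rewrite gt_eqF// exp_T1_gt0.
Qed.

Lemma branchDz y (m : int) : S (y + m%:~R * d%:R) = S y + m%:~R.
Proof. by apply: exp_inj; rewrite exp_liftz !branchK. Qed.

Lemma T1_periodic : periodic T1 1.
Proof. exact: lift_deriv_periodic (exp_lift E) (exp_d1 E). Qed.

Lemma periodic_deriv f f1 : has_deriv f f1 -> periodic f 1 -> periodic f1 (1 : R).
Proof.
move=> hf pf x; have h1 := has_deriv_comp hf (has_deriv_shift 1).
by have := has_deriv_uniq (has_deriv_ext h1 pf) hf x; rewrite mulr1.
Qed.

Lemma p_periodic : periodic p 1.
Proof. by move=> x; rewrite /invd T1_periodic. Qed.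

Lemma p1_periodic : periodic p1 1.
Proof.
move=> x; rewrite /invd1 T1_periodic.
by rewrite (periodic_deriv (exp_d2 E) T1_periodic).
Qed.

Lemma p_gt0 x : 0 < p x. Proof. by rewrite invr_gt0 exp_T1_gt0. Qed.

Lemma p_le x : p x <= lam^-1.
Proof. by rewrite lef_pV2 ?posrE ?exp_T1_gt0//; exact: (exp_lam E). Qed.

Lemma lamV_lt1 : lam^-1 < 1. Proof. by rewrite invf_lt1. Qed.

Lemma p_le1 x : p x <= 1. Proof. exact: le_trans (p_le x) (ltW lamV_lt1). Qed.

Lemma p_deriv : has_deriv p p1.
Proof.
by apply: has_derivV (exp_d2 E) => x; rewrite gt_eqF// exp_T1_gt0.
Qed.

Lemma p_continuous : continuous p.
Proof. exact: has_deriv_continuous p_deriv. Qed.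

Lemma p1_continuous : continuous p1.
Proof.
have -> : p1 = (fun x => - T2 x * (p x * p x)).
  by apply/funext => x; rewrite /invd1 /invd expr2 invfM.
apply: contM; last by apply: contM; exact: p_continuous.
by apply: contN; exact: (exp_cont E).
Qed.

Lemma p1_le x : `|p1 x| <= K.
Proof.
rewrite /invd1 normrM normrN normfV -[leRHS]mulr1; apply: ler_pM => //.
  exact: (exp_K E).
rewrite invf_le1 ?normr_gt0 ?expf_neq0 ?gt_eqF ?exp_T1_gt0//.
rewrite ger0_norm ?exprn_ge0 ?(ltW (exp_T1_gt0 _))// exprn_ege1//.
exact: le_trans (ltW lam1) (exp_lam E x).
Qed.

(** The logarithm of the weight is K-Lipschitz, because T1 >= 1. *)
Lemma distortion x y : p x <= expR (K * `|x - y|) * p y.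
Proof.
rewrite /invd ler_pdivlMr ?exp_T1_gt0// mulrC ler_pdivrMr ?exp_T1_gt0//.
have h := deriv_lip (exp_d2 E) (exp_K E) y x.
have h1 : T1 y <= T1 x + K * `|x - y|.
  by rewrite -lerBlDl (le_trans (ler_norm _))// (le_trans h)// distrC.
apply: (le_trans h1); have e1 := expR_ge1Dx (K * `|x - y|).
apply: (@le_trans _ _ ((1 + K * `|x - y|) * T1 x)); last first.
  by rewrite ler_wpM2r// ltW// exp_T1_gt0.
rewrite mulrDl mul1r lerD2l ler_peMr ?mulr_ge0 ?exp_K_ge0//.
exact: le_trans (ltW lam1) (exp_lam E x).
Qed.

(** On the real line T has a single inverse branch; the d preimages on the
    circle are its values at the translates x + j. *)
Lemma transferE f x : periodic f 1 ->
  transfer T f x = \sum_(j < d) f (S (x + j%:R)) * p (S (x + j%:R)).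
Proof.
move=> pf; have d0 := exp_d_gt0.
have dz : (d%:Z != 0)%R by rewrite eqz_nat -lt0n.
have dR : (d%:R : R) != 0 by rewrite pnatr_eq0 -lt0n.
pose fr (y : R) := y - (Num.floor y)%:~R.
pose r := [seq fr (S (x + (j : 'I_d)%:R)) | j <- enum 'I_d].
rewrite /transfer (_ : [set y | _] = [set` r]); last first.
  apply/seteqP; split => y /=.
    move=> [/andP[y0 y1] [z Tyz]]; apply/mapP.
    have jd : (`|(z %% d%:Z)%Z| < d)%N.
      by rewrite -ltz_nat gez0_abs ?modz_ge0// ltz_pmod.
    exists (Ordinal jd); rewrite ?mem_enum//=.
    set q := (z %/ d%:Z)%Z.
    have Ty : T (y - q%:~R) = x + (`|(z %% d%:Z)%Z|%N)%:R.
      have -> : (`|(z %% d%:Z)%Z|%N)%:R = ((z %% d%:Z)%Z)%:~R :> R.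
        by rewrite -[in RHS](gez0_abs (modz_ge0 z dz)).
      rewrite -mulrNz exp_liftz Tyz mulrNz mulNr.
      rewrite [in LHS](divz_eq z d%:Z) -/q intrD intrM.
      by rewrite addrA [_ + q%:~R * _ + _]addrAC addrK.
    rewrite -Ty Kbranch /fr; suff -> : Num.floor (y - q%:~R) = - q.
      by rewrite mulrNz opprK subrK.
    apply: floor_def; rewrite intrD mulrNz; lra.
  move=> /mapP[j _ ->]; rewrite frac_itv; split => //.
  exists (j%:Z - Num.floor (S (x + j%:R)) * d%:Z).
  rewrite /fr -mulrNz exp_liftz branchK mulrNz mulNr intrB intrM.
  by rewrite addrA.
rewrite -fsbig_seq; last first.
  rewrite map_inj_uniq ?enum_uniq// => i j.
  rewrite /fr => /eqP; rewrite subr_eq -addrA -mulrNz -intrD => /eqP eij.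
  have := congr1 T eij; rewrite -[X in T (_ + X)]/(_%:~R) exp_liftz !branchK.
  set m := (_ + _)%R; rewrite -addrA => /addrI.
  rewrite -[i%:R]/((i%:Z)%:~R) -[j%:R]/((j%:Z)%:~R) -[d%:R]/((d%:Z)%:~R) -intrM -intrD.
  move=> /intr_inj ijm; apply: val_inj => /=.
  have : (i%:Z = j%:Z %[mod d%:Z])%Z by rewrite ijm addrC modzMDl.
  by rewrite !modz_small ?ltz_nat ?ltn_ord// => -[].
rewrite big_map big_enum /=; apply: eq_bigr => j _.
rewrite /fr -mulrNz periodicz//.
rewrite (has_derivE (exp_d1 E)) (periodicz T1_periodic) gtr0_norm//.
exact: exp_T1_gt0.
Qed.

End ExpandingLifts.

(** * The transfer operator *)

Section TransferOperator.
Context {R : realType}.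
Notation mu := (@lebesgue_measure R).

Lemma transfer_periodic (T : R -> R) f : periodic (transfer T f) 1.
Proof.
move=> x; rewrite /transfer.
rewrite (_ : [set y | 0 <= y < 1 /\ exists z : int, T y = x + 1 + z%:~R] =
  [set y | 0 <= y < 1 /\ exists z : int, T y = x + z%:~R])//.
apply/seteqP; split => y /=.
  move=> [y01 [z ->]]; split => //; exists (1 + z).
  by rewrite intrD addrA.
move=> [y01 [z ->]]; split => //; exists (z - 1).
by rewrite intrB -[1%:~R]/(1 : R); ring.
Qed.

Variables (d : nat) (lam K : R) (T T1 T2 : R -> R).
Hypothesis E : expanding d lam K T T1 T2.
Local Notation p := (invd T1).
Local Notation p1 := (invd1 T1 T2).
Local Notation S := (branch T).
Local Notation L := (transfer T).
Implicit Types f g : R -> R.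

Lemma transferD f g : periodic f 1 -> periodic g 1 ->
  L (fun x => f x + g x) = (fun x => L f x + L g x).
Proof.
move=> pf pg; apply/funext => x; rewrite !(transferE E)//; last first.
  by move=> y; rewrite pf pg.
by rewrite -big_split/=; apply: eq_bigr => j _; rewrite mulrDl.
Qed.

Lemma transferZ (c : R) f : periodic f 1 ->
  L (fun x => c * f x) = (fun x => c * L f x).
Proof.
move=> pf; apply/funext => x; rewrite !(transferE E)//; last first.
  by move=> y; rewrite pf.
by rewrite big_distrr/=; apply: eq_bigr => j _; rewrite mulrA.
Qed.

Lemma transferB f g : periodic f 1 -> periodic g 1 ->
  L (fun x => f x - g x) = (fun x => L f x - L g x).
Proof.
move=> pf pg; apply/funext => x; rewrite !(transferE E)//; last first.
  by move=> y; rewrite pf pg.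
by rewrite -sumrB/=; apply: eq_bigr => j _; rewrite mulrBl.
Qed.

Lemma transfer_le f g : periodic f 1 -> periodic g 1 ->
  (forall x, f x <= g x) -> forall x, L f x <= L g x.
Proof.
move=> pf pg fg x; rewrite !(transferE E)//; apply: ler_sum => j _.
by rewrite ler_wpM2r// ltW// (p_gt0 E).
Qed.

Lemma transfer_ge0 f : periodic f 1 -> (forall x, 0 <= f x) ->
  forall x, 0 <= L f x.
Proof.
move=> pf f0 x; rewrite (transferE E)//; apply: sumr_ge0 => j _.
by rewrite mulr_ge0// ltW// (p_gt0 E).
Qed.

Lemma transfer_norm f : periodic f 1 ->
  forall x, `|L f x| <= L (fun y => `|f y|) x.
Proof.
move=> pf x; rewrite !(transferE E)//; last by move=> y; rewrite pf.
apply: le_trans (ler_norm_sum _ _ _) _; apply: ler_sum => j _.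
by rewrite normrM (ger0_norm (ltW (p_gt0 E _))).
Qed.

Lemma transferM f (psi : R -> R) : periodic f 1 -> periodic psi 1 ->
  L (fun x => f x * psi (T x)) = (fun x => L f x * psi x).
Proof.
move=> pf ppsi; apply/funext => x; rewrite !(transferE E)//; last first.
  move=> y; rewrite pf (exp_lift E); have := periodicz ppsi (T y) d%:Z.
  by move=> ->.
rewrite big_distrl/=; apply: eq_bigr => j _; rewrite (branchK E).
by have := periodicz ppsi x j%:Z => ->; rewrite mulrAC.
Qed.

Lemma transfer_continuous f : continuous f -> periodic f 1 -> continuous (L f).
Proof.
move=> cf pf; rewrite (_ : L f = (fun x => \sum_(j < d)
    f (S (x + j%:R)) * p (S (x + j%:R)))); last first.
  by apply/funext => x; exact: (transferE E).
have cS (j : nat) : continuous (fun x : R => S (x + j%:R)).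
  apply: cont_comp; first exact: (branch_continuous E).
  by apply: contD; [move=> x; exact: cvg_id | exact: cont_cst].
apply: cont_sum => j; apply: contM.
- exact: (cont_comp cf (cS j)).
- exact: (cont_comp (p_continuous E) (cS j)).
Qed.

(** Differentiating an inverse branch produces one more factor p, so the
    derivative of a transfer is again a transfer, with f1 damped by p. *)
Lemma transfer_deriv f f1 : has_deriv f f1 -> periodic f 1 ->
  has_deriv (L f) (L (fun x => p x * f1 x + p1 x * f x)).
Proof.
move=> hf pf; have pf1 := periodic_deriv hf pf.
have hG : has_deriv (fun x => f x * p x) (fun x => p x * f1 x + p1 x * f x).
  apply: has_deriv_eq (has_derivM hf (p_deriv E)) _ => x.
  by rewrite mulrC (mulrC (f x)).
have hs (j : nat) := has_deriv_comp (branch_deriv E) (has_deriv_shift j%:R).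
have := has_deriv_sum (fun j : 'I_d => has_deriv_comp hG (hs j)).
move=> /has_deriv_ext/(_ (fun x => esym (transferE E x pf)))/has_deriv_eq; apply => x.
rewrite (transferE E); first by apply: eq_bigr => j _; rewrite mulr1.
by move=> y; rewrite pf pf1 (p_periodic E) (p1_periodic E).
Qed.

Let mbranch : measurable_fun setT S.
Proof. exact: continuous_measurable_fun (branch_continuous E). Qed.

Lemma transfer_measurable f : measurable_fun setT f -> periodic f 1 ->
  measurable_fun setT (L f).
Proof.
move=> mf pf; rewrite (_ : L f = (fun x => \sum_(j < d)
    f (S (x + j%:R)) * p (S (x + j%:R)))); last first.
  by apply/funext => x; exact: (transferE E).
apply: measurable_sum => j.
have mj : measurable_fun setT (fun x : R => S (x + j%:R)).
  apply: (measurableT_comp mbranch).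
  exact: (measurable_funD (@measurable_id _ _ setT) (measurable_cst _)).
apply: measurable_funM; first exact: (measurableT_comp mf mj).
exact: (measurableT_comp (continuous_measurable_fun (p_continuous E)) mj).
Qed.

Let branch_le x y : (S x <= S y) = (x <= y).
Proof.
have T_lt a b : a < b -> T a < T b.
  move=> ab; rewrite -subr_gt0 (lt_le_trans _ (exp_mono E (ltW ab)))//.
  by rewrite mulr_gt0 ?subr_gt0// (lt_trans ltr01 (exp_gt1 E)).
apply/idP/idP => [|xy].
  rewrite le_eqVlt => /predU1P[/(congr1 T)|/T_lt/ltW]; rewrite !(branchK E)//.
  by move=> ->.
by rewrite leNgt; apply/negP => /T_lt; rewrite !(branchK E) ltNge xy.
Qed.

(** The substitution y = S (x + j) in each summand cuts the integral of f into
    adjacent intervals that make up one period. *)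
Lemma ge0_integral_transfer f : inL1 f -> (forall x, 0 <= f x) ->
  (\int[mu]_(x in `[0%R, 1%R]) (L f x)%:E = \int[mu]_(x in `[0%R, 1%R]) (f x)%:E)%E.
Proof.
move=> If f0; have [pf _] := If; have mf := inL1_measurable If.
have mF : measurable_fun setT (EFin \o f) by exact/measurable_EFinP.
have F0 x : (0 <= (f x)%:E)%E by rewrite lee_fin.
have mG : measurable_fun setT (fun x => f (S x) * p (S x)).
  apply: measurable_funM; first exact: (measurableT_comp mf mbranch).
  exact: (measurableT_comp (continuous_measurable_fun (p_continuous E)) mbranch).
have G0 x : 0 <= f (S x) * p (S x) by rewrite mulr_ge0// ltW// (p_gt0 E).
transitivity (\sum_(j < d) \int[mu]_(x in `[0%R, 1%R])
    (f (S (x + j%:R)) * p (S (x + j%:R)))%:E)%E.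
  rewrite -ge0_integral_sum//; first last.
  - by move=> j x _; rewrite lee_fin G0.
  - move=> j; apply/measurable_EFinP/measurable_funTS.
    apply: (measurableT_comp mG).
    exact: (measurable_funD (@measurable_id _ _ setT) (measurable_cst _)).
  by apply: eq_integral => x _; rewrite sumEFin (transferE E).
have h (j : nat) : (\int[mu]_(x in `[0%R, 1%R])
    (f (S (x + j%:R)) * p (S (x + j%:R)))%:E =
    \int[mu]_(x in `[S j%:R, S j.+1%:R]) (f x)%:E)%E.
  have cs := cont_comp (p_continuous E) (branch_continuous E).
  rewrite (ge0_substitution (branch_deriv E) cs (fun x => p_gt0 E (S x))
    (Kbranch E) (measurable_itv _) (measurable_funTS mF) (fun x _ => F0 x)).
  rewrite (_ : S @^-1` _ = `[j%:R, j.+1%:R]%classic); last first.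
    by apply/seteqP; split => x /=; rewrite !in_itv/= !branch_le.
  under [RHS]eq_integral do rewrite -EFinM.
  have mGE : measurable_fun setT (fun x => (f (S x) * p (S x))%:E).
    exact/measurable_EFinP.
  have GE0 x : (0 <= (f (S x) * p (S x))%:E)%E by rewrite lee_fin.
  rewrite [RHS](ge0_integral_shift j%:R (measurable_itv _) (measurable_funTS mGE)
    (fun x _ => GE0 x)).
  congr integral; apply/seteqP; split => x /=; rewrite !in_itv/=.
    by rewrite lerDr -natr1 addrC lerD2l.
  by rewrite lerDr -natr1 addrC lerD2l.
under eq_bigr do rewrite h.
have merge (n : nat) : (\sum_(j < n) \int[mu]_(x in `[S j%:R, S j.+1%:R]) (f x)%:E =
    \int[mu]_(x in `[S 0, S n%:R]) (f x)%:E)%E.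
  elim: n => [|n ih]; first by rewrite big_ord0 set_itv1 integral_set1.
  rewrite big_ord_recr/= ih.
  by rewrite -(ge0_integral_itv_split _ _ mF F0)// branch_le ?ler0n ?ler_nat.
rewrite merge (_ : S d%:R = S 0 + 1); last first.
  by rewrite -[d%:R]add0r -[X in 0 + X]mul1r (branchDz E 0 1).
rewrite (ge0_integral_period (S 0) mF F0)// => x z.
by rewrite /= periodicz.
Qed.

Lemma transfer_inL1 f : inL1 f -> inL1 (L f).
Proof.
move=> If; have [pf _] := If.
have mLf := transfer_measurable (inL1_measurable If) pf.
split; first exact: transfer_periodic.
have [pn In] := inL1_norm If.
have : mu.-integrable `[0, 1] (EFin \o L (fun x => `|f x|)).
  apply/integrableP; split.
    have mLn := transfer_measurable (inL1_measurable (inL1_norm If)) pn.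
    exact/measurable_EFinP/measurable_funTS.
  move/integrableP : In => [_]; congr (_ < _)%E.
  transitivity (\int[mu]_(x in `[0%R, 1%R]) (`|f x|)%:E)%E.
    by apply: eq_integral => x _; rewrite /= normr_id.
  rewrite -ge0_integral_transfer//; last exact: inL1_norm.
  apply: eq_integral => x _; rewrite /= ger0_norm//.
  exact: transfer_ge0.
apply: le_integrable => //.
  exact/measurable_EFinP/measurable_funTS.
move=> x _; rewrite lee_fin; apply: le_trans (transfer_norm pf x) _.
exact: ler_norm.
Qed.

Lemma cint_transfer f : inL1 f -> cint (L f) = cint f.
Proof.
move=> If.
have ge0 g : inL1 g -> (forall x, 0 <= g x) -> cint (L g) = cint g.
  by move=> Ig g0; rewrite /cint /Rintegral ge0_integral_transfer.
have In := inL1_norm If.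
have Is := inL1D In If.
have -> : f = (fun x => (`|f x| + f x) - `|f x|).
  by apply/funext => x; rewrite addrC addKr.
rewrite cintB// transferB; [|by case: Is|by case: In].
rewrite cintB; [|exact: transfer_inL1..].
rewrite !ge0// => x; have := ler_norm (- f x); rewrite normrN; lra.
Qed.

Lemma l1_transfer f : inL1 f -> l1 (L f) <= l1 f.
Proof.
move=> If; rewrite /l1 -(cint_transfer (inL1_norm If)).
apply: le_cint => [||x].
- by apply: inL1_norm; exact: transfer_inL1.
- by apply: transfer_inL1; exact: inL1_norm.
- by apply: transfer_norm; case: If.
Qed.

Lemma cint_transferM f (psi : R -> R) : inL1 f -> continuous psi -> periodic psi 1 ->
  cint (fun x => L f x * psi x) = cint (fun x => f x * psi (T x)).
Proof.
move=> If cpsi ppsi; rewrite -(transferM _ ppsi); last by case: If.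
apply: cint_transfer; apply: (@inL1Mc _ _ (psi \o T)) => //.
  exact: cont_comp cpsi (has_deriv_continuous (exp_d1 E)).
by move=> x /=; rewrite (exp_lift E); have := periodicz ppsi (T x) d%:Z => ->.
Qed.

(** The operator is an L^1 contraction, hence insensitive to null sets. *)
Lemma transfer_ae f g : inL1 f -> inL1 g ->
  (\forall x \ae mu, f x = g x) -> \forall x \ae mu, L f x = L g x.
Proof.
move=> If Ig fg; have Ifg := inL1B If Ig.
have : l1 (L (fun x => f x - g x)) = 0.
  by apply/eqP; rewrite eq_le l1_ge0 andbT -(ae_eq_l1 If Ig fg) l1_transfer.
move=> /(l1_eq0 (transfer_inL1 Ifg)); rewrite transferB; [|by case: If|by case: Ig].
by apply: aeS => x /eqP; rewrite subr_eq0 => /eqP.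
Qed.

End TransferOperator.

(** * Cones of densities and loss of memory *)

Section Cone.
Context {R : realType}.
Implicit Types f g : R -> R.

(** Nonnegative functions whose logarithm is c-Lipschitz. *)
Definition cone (c : R) f : Prop :=
  (forall x, 0 <= f x) /\ forall x y, f x <= expR (c * `|x - y|) * f y.

Lemma cone_le (c c' : R) f : c <= c' -> cone c f -> cone c' f.
Proof.
move=> cc [f0 h]; split => // x y; apply: le_trans (h x y) _.
by rewrite ler_wpM2r// ler_expR ler_wpM2r.
Qed.

Lemma cone_cst (c a : R) : 0 <= c -> 0 <= a -> cone c (fun=> a).
Proof.
move=> c0 a0; split => // x y; rewrite ler_peMl// -expR0 ler_expR.
by rewrite mulr_ge0.
Qed.

(** Convexity of the exponential between 0 and t. *)
Lemma expR_amgm (s t : R) : 0 <= s <= 1 ->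
  expR ((1 - s) * t) <= (1 - s) * expR t + s.
Proof.
move=> /andP[s0 s1]; set u := (1 - s) * t.
have e1 := expR_ge1Dx (t - u); have e2 := expR_ge1Dx (- u).
have -> : expR t = expR u * expR (t - u) by rewrite -expRD addrC subrK.
have e3 : 1 = expR u * expR (- u) by rewrite -expRD subrr expR0.
have eu := expR_gt0 u.
have h : 1 <= (1 - s) * expR (t - u) + s * expR (- u).
  apply: (@le_trans _ _ ((1 - s) * (1 + (t - u)) + s * (1 + - u))).
    by rewrite /u; lra.
  by apply: lerD; apply: ler_wpM2l => //; rewrite subr_ge0.
rewrite -[leLHS]mulr1; apply: le_trans (ler_wpM2l (ltW eu) h) _.
rewrite mulrDr mulrCA; apply: lerD => //.
by rewrite mulrCA -e3 mulr1.
Qed.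

(** Subtracting a constant that is at most the fraction s of f costs a
    factor 1 / (1 - s) in the cone parameter. *)
Lemma cone_sub (c s k : R) f : 0 <= c -> 0 <= s < 1 -> 0 <= k ->
  (forall x, k <= s * f x) -> cone c f -> cone (c / (1 - s)) (fun x => f x - k).
Proof.
move=> c0 /andP[s0 s1] k0 kf [f0 h].
have s1' : 0 < 1 - s by rewrite subr_gt0.
split => [x|x y].
  by rewrite subr_ge0 (le_trans (kf x))// ler_piMl// ltW.
set t := c / (1 - s) * `|x - y|.
have am := @expR_amgm s t; rewrite s0 ltW//= in am; have {}am := am isT.
have tE : (1 - s) * t = c * `|x - y| by rewrite /t mulrA mulrCA mulfV ?gt_eqF// mulr1.
rewrite tE in am; have hxy := h x y; have ky := kf y.
have t0 : 1 <= expR t by rewrite -expR0 ler_expR mulr_ge0// divr_ge0// ltW.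
set a := expR (c * _) in am hxy; set b := expR t in am t0 *.
have fy := f0 y.
have h1 : a * f y <= ((1 - s) * b + s) * f y by rewrite ler_wpM2r.
have h2 : (b - 1) * k <= (b - 1) * (s * f y) by rewrite ler_wpM2l// subr_ge0.
by move: h1 h2; nra.
Qed.

Lemma cone_oscillation (c : R) f : 0 <= c -> periodic f 1 -> cone c f ->
  forall x y, f x <= expR c * f y.
Proof.
move=> c0 pf [f0 h] x y; set z := Num.floor (x - y).
have /andP[h1 h2] := frac_itv (x - y).
rewrite -(periodicz pf y z); apply: le_trans (h x (y + z%:~R)) _.
rewrite ler_wpM2r// ler_expR ler_piMr// opprD addrA ger0_norm//.
exact: ltW.
Qed.

Lemma cone_bounds (c : R) f : 0 <= c -> inL1 f -> cone c f ->
  forall x, expR (- c) * cint f <= f x <= expR c * cint f.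
Proof.
move=> c0 If cf x; have [pf _] := If; have osc := cone_oscillation c0 pf cf.
apply/andP; split.
  rewrite expRN ler_pdivrMl ?expR_gt0// -[leRHS]cint_cst.
  apply: le_cint => [//||y]; [exact: inL1_cst|exact: osc].
rewrite -cintZ// -[leLHS]cint_cst; apply: le_cint => [||y].
- exact: inL1_cst.
- exact: inL1Z.
- exact: osc.
Qed.

(** Inverse branches contract distances by 1 / lam; the distortion of the weight
    contributes K. *)
Lemma cone_transfer d (lam K c : R) T T1 T2 f : expanding d lam K T T1 T2 ->
  0 <= c -> periodic f 1 -> cone c f -> cone (c / lam + K) (transfer T f).
Proof.
move=> E c0 pf [f0 h]; split; first exact: (transfer_ge0 E).
move=> x y; rewrite !(transferE E)// big_distrr/=; apply: ler_sum => j _.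
set a := branch T _; set b := branch T _.
have ab : `|a - b| <= lam^-1 * `|x - y|.
  by rewrite (le_trans (branch_lip E _ _))// opprD addrACA subrr addr0.
have hab := h a b; have dab := distortion E a b.
have pa := ltW (p_gt0 E a); have pb := ltW (p_gt0 E b).
apply: (@le_trans _ _ (expR (c * `|a - b|) * f b * (expR (K * `|a - b|) * invd T1 b))).
  by apply: ler_pM.
rewrite mulrACA -expRD -mulrDl ler_wpM2r ?mulr_ge0// ler_expR.
apply: (@le_trans _ _ ((c + K) * (lam^-1 * `|x - y|))).
  by rewrite ler_wpM2l// addr_ge0// (exp_K_ge0 E).
rewrite mulrA mulrDl ler_wpM2r// lerD2l ler_piMr//.
  exact: (exp_K_ge0 E).
by rewrite ltW// (lamV_lt1 E).
Qed.

End Cone.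

Section Cocycle.
Context {R : realType}.
Notation mu := (@lebesgue_measure R).
Implicit Types f g : R -> R.

(** The parameter c = cone_param and the fraction s = cone_frac are chosen so
    that c / (1 - s) / lam + K <= c: after removing the fraction s from a density
    of the cone, a transfer brings it back into the cone. The mass that can be
    removed at each step is 1 - cone_rate. *)
Definition cone_param (lam K : R) : R := (K + 1) * (lam + 1) / (lam - 1).
Definition cone_frac (lam : R) : R := (lam - 1) / (2 * lam).
Definition cone_rate (lam K : R) : R :=
  1 - cone_frac lam * expR (- cone_param lam K).

Section Constants.
Variables (lam K : R).
Hypotheses (lam1 : 1 < lam) (K0 : 0 <= K).
Local Notation c := (cone_param lam K).
Local Notation s := (cone_frac lam).
Local Notation th := (cone_rate lam K).

Lemma cone_param_gt0 : 0 < c.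
Proof.
have k1 : 0 < K + 1 by move: K0; lra.
have l1 : 0 < lam + 1 by move: lam1; lra.
by rewrite /cone_param divr_gt0 ?subr_gt0// mulr_gt0.
Qed.

Lemma cone_frac_itv : 0 < s < 1.
Proof.
have l2 : 0 < 2 * lam by move: lam1; lra.
rewrite /cone_frac divr_gt0 ?subr_gt0//= ltr_pdivrMr//.
by move: lam1; lra.
Qed.

Lemma cone_rate_itv : 0 < th < 1.
Proof.
have /andP[s0 s1] := cone_frac_itv; have c0 := cone_param_gt0.
have e0 := expR_gt0 (- c).
have e1 : expR (- c) <= 1 by rewrite -expR0 ler_expR oppr_le0 ltW.
by rewrite /cone_rate; apply/andP; split; nra.
Qed.

Lemma cone_param_step : c / (1 - s) / lam + K <= c.
Proof.
have l0 : lam != 0 by rewrite gt_eqF// (lt_trans ltr01).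
have l1 : lam - 1 != 0 by rewrite subr_eq0 gt_eqF.
have l2 : lam + 1 != 0 by rewrite gt_eqF// (lt_trans ltr01)// (lt_trans lam1)// ltrDl.
have -> : c / (1 - s) / lam = 2 * (K + 1) / (lam - 1).
  rewrite /cone_param /cone_frac; field.
  by rewrite l0 l1/=; apply: contra l2 => /eqP e; apply/eqP; lra.
rewrite -lerBrDl /cone_param -mulrBl.
have -> : (K + 1) * (lam + 1) - 2 * (K + 1) = (K + 1) * (lam - 1) by ring.
rewrite mulfK//; lra.
Qed.

Lemma cone_param_step1 : c / lam + K <= c.
Proof.
apply: le_trans cone_param_step; rewrite lerD2r ler_wpM2r ?invr_ge0//.
  by move: lam1; lra.
have /andP[s0 s1] := cone_frac_itv.
by rewrite ler_peMr ?(ltW cone_param_gt0)// invf_ge1 ?subr_gt0// lerBlDr lerDl ltW.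
Qed.

End Constants.

Lemma cocycle_first (L : int -> (R -> R) -> R -> R) (m : int) k f :
  cocycle L m k.+1 f = cocycle L (m + 1) k (L m f).
Proof.
elim: k => [|k ih]; first by rewrite /= addr0.
rewrite -[LHS]/(L (m + k.+1%:Z) (cocycle L m k.+1 f)) ih /=; congr (L _ _).
by rewrite -addn1 PoszD addrA addrAC.
Qed.

Variables (d : nat) (lam K : R) (T T1 T2 : int -> R -> R).
Hypothesis E : forall n, expanding d lam K (T n) (T1 n) (T2 n).
Local Notation L := (fun n => transfer (T n)).
Local Notation c := (cone_param lam K).
Local Notation s := (cone_frac lam).
Local Notation th := (cone_rate lam K).

Let lam1 := exp_gt1 (E 0).
Let K0 := exp_K_ge0 (E 0).
Let c0 : 0 < c. Proof. exact: cone_param_gt0. Qed.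

Lemma cocycle_periodic m k f : periodic f 1 -> periodic (cocycle L m k f) 1.
Proof. by case: k => //= k _; exact: transfer_periodic. Qed.

Lemma cocycleD m k f g : periodic f 1 -> periodic g 1 ->
  cocycle L m k (fun x => f x + g x) =
  (fun x => cocycle L m k f x + cocycle L m k g x).
Proof.
move=> pf pg; elim: k => //= k ->.
by apply: (transferD (E _)); exact: cocycle_periodic.
Qed.

Lemma cocycleB m k f g : periodic f 1 -> periodic g 1 ->
  cocycle L m k (fun x => f x - g x) =
  (fun x => cocycle L m k f x - cocycle L m k g x).
Proof.
move=> pf pg; elim: k => //= k ->.
by apply: (transferB (E _)); exact: cocycle_periodic.
Qed.

Lemma cocycleZ m k (a : R) f : periodic f 1 ->
  cocycle L m k (fun x => a * f x) = (fun x => a * cocycle L m k f x).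
Proof.
move=> pf; elim: k => //= k ->.
by apply: (transferZ (E _)); exact: cocycle_periodic.
Qed.

Lemma cocycle_le m k f g : periodic f 1 -> periodic g 1 ->
  (forall x, f x <= g x) -> forall x, cocycle L m k f x <= cocycle L m k g x.
Proof.
move=> pf pg fg; elim: k => //= k ih.
by apply: (transfer_le (E _)) => //; exact: cocycle_periodic.
Qed.

Lemma cocycle_inL1 m k f : inL1 f -> inL1 (cocycle L m k f).
Proof. by move=> If; elim: k => //= k; exact: (transfer_inL1 (E _)). Qed.

Lemma cint_cocycle m k f : inL1 f -> cint (cocycle L m k f) = cint f.
Proof.
move=> If; elim: k => //= k <-.
by apply: (cint_transfer (E _)); exact: cocycle_inL1.
Qed.

Lemma cocycle_continuous m k f : continuous f -> periodic f 1 ->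
  continuous (cocycle L m k f).
Proof.
move=> cf pf; elim: k => //= k ih.
by apply: (transfer_continuous (E _)) => //; exact: cocycle_periodic.
Qed.

Lemma cocycle_ae m k f g : inL1 f -> inL1 g ->
  (\forall x \ae mu, f x = g x) ->
  \forall x \ae mu, cocycle L m k f x = cocycle L m k g x.
Proof.
move=> If Ig fg; elim: k => //= k.
by apply: (transfer_ae (E _)); exact: cocycle_inL1.
Qed.

Local Notation w m k := (cocycle L m k (fun=> 1)).

Lemma cocycle1_cone m k : cone c (w m k).
Proof.
elim: k => /= [|k ih]; first by apply: cone_cst; [exact: ltW|exact: ler01].
apply: (cone_le (cone_param_step1 lam1 K0)).
by apply: (cone_transfer (E _)); [exact: ltW|exact: cocycle_periodic|].
Qed.

Lemma cocycle1_bounds m k x : expR (- c) <= w m k x <= expR c.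
Proof.
have I1 := inL1_cst (1 : R).
have := cone_bounds (ltW c0) (cocycle_inL1 m k I1) (cocycle1_cone m k) x.
by rewrite cint_cocycle// cint_cst !mulr1.
Qed.

Lemma cocycle_norm_le m k (A : R) f : periodic f 1 -> (forall x, `|f x| <= A) ->
  forall x, `|cocycle L m k f x| <= A * w m k x.
Proof.
move=> pf fA x; have p1 : periodic (fun _ : R => 1 : R) 1 by [].
have pA (a : R) : periodic (fun _ : R => a * 1 : R) 1 by [].
have hZ (a : R) : cocycle L m k (fun=> a * 1) x = a * w m k x.
  by rewrite (cocycleZ _ _ _ p1).
rewrite ler_norml -mulNr -!hZ; apply/andP; split; apply: cocycle_le => // y;
  by rewrite mulr1; have := fA y; rewrite ler_norml => /andP[].
Qed.

Lemma cocycle_sup m k (A : R) f : periodic f 1 -> (forall x, `|f x| <= A) ->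
  forall x, `|cocycle L m k f x| <= A * expR c.
Proof.
move=> pf fA x; apply: le_trans (cocycle_norm_le m k pf fA x) _.
rewrite ler_wpM2l//; first exact: le_trans (normr_ge0 _) (fA 0).
by have /andP[] := cocycle1_bounds m k x.
Qed.

(** Coupling: from two elements of the cone of equal mass the same constant is
    subtracted at each step, so that the mass that remains uncoupled decays. *)
Lemma cone_contraction k m (a : R) f g : inL1 f -> inL1 g ->
  cone c f -> cone c g -> cint f = a -> cint g = a ->
  forall x, `|cocycle L m k (fun y => f y - g y) x| <= expR c * a * th ^+ k.
Proof.
elim: k m a f g => [|k ih] m a f g If Ig cf cg fa ga x.
  rewrite expr0 mulr1 /=.
  have := cone_bounds (ltW c0) If cf x; have := cone_bounds (ltW c0) Ig cg x.
  rewrite fa ga; have f0 := cf.1 x; have g0 := cg.1 x.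
  by move=> /andP[_ h1] /andP[_ h2]; rewrite ler_norml; apply/andP; split; lra.
have /andP[s0 s1] := cone_frac_itv lam1.
set kp := s * expR (- c) * a.
have a0 : 0 <= a by rewrite -fa; apply: cint_ge0; case: cf.
have kp0 : 0 <= kp by rewrite mulr_ge0// mulr_ge0// ?expR_ge0// ltW.
have step u : inL1 u -> cone c u -> cint u = a ->
    [/\ inL1 (L m (fun x => u x - kp)), cone c (L m (fun x => u x - kp)) &
      cint (L m (fun x => u x - kp)) = th * a].
  move=> Iu cu ua; have Ik := inL1_cst kp; have Iuk := inL1B Iu Ik.
  split.
  - exact: (transfer_inL1 (E _)).
  - apply: (@cone_le _ (c / (1 - s) / lam + K) c); first exact: cone_param_step.
    apply: (cone_transfer (E _)); last 2 first.
    + by case: Iuk.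
    + apply: cone_sub => //; rewrite ?(ltW s0)// ?(ltW c0)// => y.
      rewrite /kp -mulrA ler_wpM2l ?(ltW s0)//.
      by have := cone_bounds (ltW c0) Iu cu y; rewrite ua => /andP[].
    + by rewrite divr_ge0 ?(ltW c0)// subr_ge0 ltW.
  - rewrite (cint_transfer (E _))// cintB// cint_cst ua /kp /cone_rate.
    by rewrite mulrBl mul1r.
have [If' cf' fa'] := step f If cf fa.
have [Ig' cg' ga'] := step g Ig cg ga.
have := ih (m + 1) (th * a) _ _ If' Ig' cf' cg' fa' ga' x.
have pfk h : inL1 h -> periodic (fun x => h x - kp) 1 by case=> ph _ y; rewrite ph.
have e : (fun y => L m (fun x => f x - kp) y - L m (fun x => g x - kp) y) =
    L m (fun y => f y - g y).
  rewrite -(transferB (E _)); [|exact: pfk|exact: pfk].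
  by congr (transfer _ _); apply/funext => y; ring.
rewrite e -cocycle_first.
by have -> : expR c * (th * a) * th ^+ k = expR c * a * th ^+ k.+1 by rewrite exprS; ring.
Qed.

(** After adding a large constant a, the function f + a lies in the cone, and so
    does the constant a, which has the same mass. *)
Lemma lip_decay k m (A : R) f : inL1 f -> cint f = 0 ->
  (forall x y, `|f x - f y| <= A * `|x - y|) ->
  forall x, `|cocycle L m k f x| <= expR c * (1 + c^-1) * A * th ^+ k.
Proof.
move=> If f0 fA x; have [pf _] := If.
have A0 : 0 <= A by have := fA 1 0; rewrite subr0 normr1 mulr1; apply: le_trans.
have fge y : - A <= f y.
  rewrite lerNl -subr_ge0 opprK.
  have -> : A + f y = cint (fun z => A + f y - f z).
    by rewrite cintB// ?f0 ?cint_cst ?subr0//; exact: inL1_cst.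
  apply: cint_ge0 => z; rewrite subr_ge0.
  set n := Num.floor (z - y); have /andP[h1 h2] := frac_itv (z - y).
  rewrite -lerBlDr -(periodicz pf y n); apply: le_trans (ler_norm _) _.
  apply: le_trans (fA _ _) _; rewrite ler_piMr// opprD addrA ger0_norm//.
  exact: ltW.
set a := (1 + c^-1) * A.
have a0 : 0 <= a by rewrite mulr_ge0// addr_ge0// invr_ge0 ltW.
have fa y : A / c <= f y + a by have := fge y; rewrite /a; lra.
have Ifa := inL1D If (inL1_cst a).
have cfa : cone c (fun y => f y + a).
  split => [y|y z].
    by rewrite (le_trans _ (fa y))// divr_ge0// ltW.
  apply: (@le_trans _ _ ((1 + c * `|y - z|) * (f z + a))); last first.
    rewrite ler_wpM2r ?expR_ge1Dx//.
    by rewrite (le_trans _ (fa z))// divr_ge0// ltW.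
  have h1 : f y <= f z + A * `|y - z|.
    by rewrite -lerBlDl (le_trans (ler_norm _))// fA.
  have h2 : A * `|y - z| <= c * `|y - z| * (f z + a).
    rewrite mulrC -mulrA [in leRHS]mulrC -mulrA ler_wpM2l//.
    by rewrite mulrC -ler_pdivrMl// mulrC fa.
  by lra.
have := cone_contraction k m Ifa (inL1_cst a) cfa (cone_cst (ltW c0) a0) _
  (cint_cst a) x.
rewrite cintD ?f0 ?add0r ?cint_cst//; last exact: inL1_cst.
move=> /(_ erefl); under [X in cocycle _ _ _ X]eq_fun do rewrite addrK.
by rewrite /a !mulrA.
Qed.

(** The recursion obeyed by the derivatives of a cocycle. The bound is propagated
    against the cocycle of 1, which lies between exp (- c) and exp c, because a
    single transfer need not contract the sup norm. *)
Lemma forced_decay m (sg rho A G : R) (u r a : nat -> R -> R) :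
  0 <= sg < rho -> 0 <= G -> (forall x, `|u 0%N x| <= A) ->
  (forall k, periodic (u k) 1) -> (forall k, periodic (r k) 1) ->
  (forall k, periodic (a k) 1) ->
  (forall k x, `|a k x| <= sg) -> (forall k x, `|r k x| <= G * rho ^+ k) ->
  (forall k, u k.+1 = L (m + k%:Z) (fun x => a k x * u k x + r k x)) ->
  forall k x, `|u k x| <= (A + G * expR c / (rho - sg)) * expR c * rho ^+ k.
Proof.
move=> /andP[sg0 sgr] G0 uA pu pr pa asg rG uS.
have rho0 : 0 < rho := le_lt_trans sg0 sgr.
have A0 : 0 <= A := le_trans (normr_ge0 _) (uA 0).
set B := A + G * expR c / (rho - sg).
have B0 : 0 <= B.
  by rewrite addr_ge0// divr_ge0 ?subr_ge0 ?(ltW sgr)// mulr_ge0// expR_ge0.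
suff h k x : `|u k x| <= B * rho ^+ k * w m k x.
  move=> k x; apply: le_trans (h k x) _; rewrite mulrAC.
  rewrite ler_wpM2r ?exprn_ge0 ?(ltW rho0)// ler_wpM2l//.
  by have /andP[] := cocycle1_bounds m k x.
elim: k x => [x|k ih x].
  rewrite expr0 !mulr1; apply: le_trans (uA x) _.
  by rewrite lerDl divr_ge0 ?subr_ge0 ?(ltW sgr)// mulr_ge0// expR_ge0.
have pw : periodic (w m k) 1 by exact: cocycle_periodic.
have pau : periodic (fun x => a k x * u k x + r k x) 1.
  by move=> y; rewrite pa pu pr.
rewrite uS [w m k.+1]/=; apply: le_trans (transfer_norm (E _) pau x) _.
have -> : B * rho ^+ k.+1 * transfer (T (m + k%:Z)) (w m k) x =
    transfer (T (m + k%:Z)) (fun y => B * rho ^+ k.+1 * w m k y) x.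
  by rewrite (transferZ (E _)).
apply: (transfer_le (E _)) => [y|y|y]; rewrite ?pau ?pw//.
have /andP[w1 w2] := cocycle1_bounds m k y.
have rk : 0 <= rho ^+ k by rewrite exprn_ge0// ltW.
have w0 : 0 <= w m k y := le_trans (expR_ge0 _) w1.
have w1' : 1 <= expR c * w m k y.
  by rewrite -ler_pdivrMl ?expR_gt0// mulr1 -expRN.
apply: le_trans (ler_normD _ _) _.
apply: (@le_trans _ _ (sg * (B * rho ^+ k * w m k y) +
    G * rho ^+ k * (expR c * w m k y))).
  apply: lerD; first by rewrite normrM; apply: ler_pM.
  by apply: le_trans (rG k y) _; rewrite ler_peMr// mulr_ge0.
have -> : sg * (B * rho ^+ k * w m k y) + G * rho ^+ k * (expR c * w m k y) =
  (sg * B + G * expR c) * (rho ^+ k * w m k y) by ring.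
have -> : B * rho ^+ k.+1 * w m k y = rho * B * (rho ^+ k * w m k y).
  by rewrite exprS; ring.
rewrite ler_wpM2r ?mulr_ge0//.
have h : (rho - sg) * B = (rho - sg) * A + G * expR c.
  by rewrite /B mulrDr mulrCA mulfV ?mulr1// subr_eq0 gt_eqF.
have : 0 <= (rho - sg) * A by rewrite mulr_ge0// subr_ge0 ltW.
by move: h; lra.
Qed.

End Cocycle.

(** * Geometrically convergent series of functions *)

Section GeometricSeries.
Context {R : realType}.
Implicit Types f g : nat -> R -> R.

Lemma geometric_small (rho C e : R) : 0 <= rho < 1 -> 0 < e ->
  exists N, C * rho ^+ N < e.
Proof.
move=> /andP[r0 r1] e0.
have h : (fun n => C * rho ^+ n) @ \oo --> (0 : R).
  rewrite -[X in _ --> X](mulr0 C); apply: cvgMr.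
  by apply: cvg_expr; rewrite ger0_norm.
have [N _ hN] := @cvgr_dist_lt _ _ _ _ _ _ _ h _ e0.
exists N; have := hN N (leqnn N); rewrite sub0r normrN.
exact: le_lt_trans (ler_norm _).
Qed.

Lemma geometric_eq0 (rho C a : R) : 0 <= rho < 1 ->
  (forall N, `|a| <= C * rho ^+ N) -> a = 0.
Proof.
move=> r h; apply/eqP; rewrite -normr_le0 leNgt; apply/negP => a0.
have [N hN] := geometric_small C r a0.
by have := le_lt_trans (h N) hN; rewrite ltxx.
Qed.

Definition gsum f : R -> R := fun x => limn (series (f ^~ x)).

Variables (rho G : R).
Hypothesis rho01 : 0 <= rho < 1.
Let rho0 : 0 <= rho. Proof. by case/andP: rho01. Qed.
Let rho1 : 0 < 1 - rho. Proof. by rewrite subr_gt0; case/andP: rho01. Qed.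

Lemma gsum_tail f (x : R) : (forall k, `|f k x| <= G * rho ^+ k) ->
  forall N, `|gsum f x - \sum_(k < N) f k x| <= G / (1 - rho) * rho ^+ N.
Proof.
move=> fG N.
have part m : (1 - rho) * `|\sum_(k < N + m) f k x - \sum_(k < N) f k x| <=
    G * rho ^+ N - G * rho ^+ (N + m).
  elim: m => [|m ih]; first by rewrite addn0 !subrr normr0 mulr0.
  rewrite addnS big_ord_recr/= addrAC.
  apply: le_trans (ler_wpM2l (ltW rho1) (ler_normD _ _)) _.
  have h := ler_wpM2l (ltW rho1) (fG (N + m)%N).
  by rewrite exprS; move: ih h; lra.
have G0 : 0 <= G by have := fG 0%N; rewrite expr0 mulr1; apply: le_trans.
have cv : cvgn (series (f ^~ x)).
  apply: normed_cvg; apply: (@series_le_cvg _ _ (fun k => G * rho ^+ k)) => [k|k|k|].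
  - exact: normr_ge0.
  - by rewrite mulr_ge0// exprn_ge0.
  - exact: fG.
  - by apply: is_cvg_geometric_series; rewrite ger0_norm//; case/andP: rho01.
apply/ler_addgt0Pr => e e0.
have [M _ hM] := @cvgr_dist_lt _ _ _ _ _ _ _ cv _ e0.
have /hM := leq_addr N M; rewrite /= seriesEord/= addnC => hNM.
rewrite -[gsum f x](subrK (\sum_(k < N + M) f k x)) -addrA.
have gE : gsum f x = limn (fun n => \sum_(k < n) f k x) by rewrite /gsum seriesEord.
rewrite -gE in hNM.
apply: le_trans (ler_normD _ _) _; rewrite [leRHS]addrC; apply: lerD; first exact: ltW.
rewrite mulrAC ler_pdivlMr// mulrC; apply: le_trans (part M) _.
by rewrite lerBlDr lerDl mulr_ge0// exprn_ge0.
Qed.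

Lemma gsum_uniq f (x l C : R) : (forall k, `|f k x| <= G * rho ^+ k) ->
  (forall N, `|l - \sum_(k < N) f k x| <= C * rho ^+ N) -> l = gsum f x.
Proof.
move=> fG lC; apply/eqP; rewrite -subr_eq0; apply/eqP.
apply: (geometric_eq0 (C := C + G / (1 - rho)) rho01) => N.
rewrite -[l](subrK (\sum_(k < N) f k x)) -addrA.
apply: le_trans (ler_normD _ _) _; rewrite mulrDl; apply: lerD => //.
by rewrite distrC gsum_tail.
Qed.

Lemma gsum_le f (x : R) : (forall k, `|f k x| <= G * rho ^+ k) ->
  `|gsum f x| <= G / (1 - rho).
Proof.
by move=> fG; have := gsum_tail fG 0; rewrite big_ord0 subr0 expr0 mulr1.
Qed.

Lemma gsum_recl f (x : R) : (forall k, `|f k x| <= G * rho ^+ k) ->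
  gsum f x = f 0%N x + gsum (fun k => f k.+1) x.
Proof.
move=> fG; apply/eqP; rewrite addrC -subr_eq; apply/eqP.
have G0 : 0 <= G by have := fG 0%N; rewrite expr0 mulr1; apply: le_trans.
have le1 k : rho ^+ k.+1 <= rho ^+ k.
  by rewrite exprS ler_piMl ?exprn_ge0// -subr_ge0 ltW.
apply: (@gsum_uniq _ _ _ (G / (1 - rho))) => [k|N].
  by apply: le_trans (fG _) _; rewrite ler_wpM2l.
rewrite -addrA -opprD -(big_ord_recl N (fun k : 'I_N.+1 => f k x)).
apply: le_trans (gsum_tail fG _) _.
by rewrite ler_wpM2l// divr_ge0// ltW.
Qed.

Lemma gsum_cont_at f (x : R) : (forall k y, `|f k y| <= G * rho ^+ k) ->
  (forall k, {for x, continuous (f k)}) -> {for x, continuous (gsum f)}.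
Proof.
move=> fG cf; apply/cvgrPdist_le => e e0.
have e3 : 0 < e / 3 by rewrite divr_gt0.
have [N hN] := geometric_small (G / (1 - rho)) rho01 e3.
have cS : {for x, continuous (fun y => \sum_(k < N) f k y)}.
  elim: N {hN} => [|N ih].
    rewrite (_ : (fun y => _) = (fun=> 0)); first exact: cvg_cst.
    by apply/funext => y; rewrite big_ord0.
  rewrite (_ : (fun y => _) = (fun y => \sum_(k < N) f k y + f N y)).
    exact: (continuousD ih (cf N)).
  by apply/funext => y; rewrite big_ord_recr.
move/cvgrPdist_le : cS => /(_ _ e3).
apply: filterS => y hy.
have t1 := gsum_tail (fG ^~ x) N; have t2 := gsum_tail (fG ^~ y) N.
rewrite -[gsum f x](subrK (\sum_(k < N) f k x)).
rewrite -[gsum f y](subrK (\sum_(k < N) f k y)).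
rewrite opprD addrACA; apply: le_trans (ler_normD _ _) _.
have := ler_normB (gsum f x - \sum_(k < N) f k x) (gsum f y - \sum_(k < N) f k y).
by move: hN t1 t2 hy; lra.
Qed.

Lemma gsum_continuous f : (forall k y, `|f k y| <= G * rho ^+ k) ->
  (forall k, continuous (f k)) -> continuous (gsum f).
Proof. by move=> fG cf x; apply: gsum_cont_at => // k; exact: cf. Qed.

(** The difference quotients at a point converge geometrically too, so that the
    sum of their continuous extensions is continuous. *)
Lemma gsum_deriv f g : (forall k, has_deriv (f k) (g k)) ->
  (forall k y, `|f k y| <= G * rho ^+ k) ->
  (forall k y, `|g k y| <= G * rho ^+ k) -> has_deriv (gsum f) (gsum g).
Proof.
move=> fg fG gG x.
have /choice[q hq] : forall k, exists q : R -> R,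
    [/\ forall z, f k z - f k x = q z * (z - x), {for x, continuous q} & q x = g k x].
  by move=> k; have /is_derive1_caratheodory := fg k x.
have qG k y : `|q k y| <= G * rho ^+ k.
  have [qE _ qx] := hq k; have [->|yx] := eqVneq y x; first by rewrite qx.
  have [z _] := mvt x y (fg k); rewrite qE => /mulIf -> //.
  by rewrite subr_eq0.
apply/is_derive1_caratheodory; exists (gsum q); split.
- move=> z; apply/eqP; rewrite -subr_eq0; apply/eqP.
  set D := _ - _.
  apply: (geometric_eq0 (C := G / (1 - rho) * (2 + `|z - x|)) rho01) => N.
  have t1 := gsum_tail (fG ^~ x) N; have t2 := gsum_tail (fG ^~ z) N.
  have t3 := gsum_tail (qG ^~ z) N.
  have e : D = (gsum f z - \sum_(k < N) f k z) - (gsum f x - \sum_(k < N) f k x)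
      - (gsum q z - \sum_(k < N) q k z) * (z - x).
    rewrite /D mulrBl; have : (\sum_(k < N) q k z) * (z - x) =
        \sum_(k < N) f k z - \sum_(k < N) f k x.
      rewrite big_distrl -sumrB/=; apply: eq_bigr => k _.
      by have [<-] := hq k.
    by move=> ->; ring.
  rewrite e; apply: le_trans (ler_normB _ _) _.
  apply: le_trans (lerD (ler_normB _ _) (lexx _)) _.
  rewrite normrM; have := ler_wpM2r (normr_ge0 (z - x)) t3.
  by move: t1 t2; lra.
- by apply: gsum_cont_at => // k; case: (hq k).
- rewrite /gsum; congr (limn (series _)); apply/funext => k.
  by case: (hq k).
Qed.

Lemma gsum_periodic f : (forall k, periodic (f k) 1) -> periodic (gsum f) 1.
Proof.
move=> pf x; rewrite /gsum; congr (limn (series _)); apply/funext => k.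
exact: pf.
Qed.

Lemma gsum_cint0 f : (forall k, continuous (f k)) ->
  (forall k, periodic (f k) 1) -> (forall k y, `|f k y| <= G * rho ^+ k) ->
  (forall k, cint (f k) = 0) -> cint (gsum f) = 0.
Proof.
move=> cf pf fG f0; have Ik k := inL1_continuous (cf k) (pf k).
have Ig := inL1_continuous (gsum_continuous fG cf) (gsum_periodic pf).
apply: (geometric_eq0 (C := G / (1 - rho)) rho01) => N.
have IS : inL1 (fun x => \sum_(k < N) f k x) by exact: inL1_sum.
have S0 : cint (fun x => \sum_(k < N) f k x) = 0.
  elim: N {IS} => [|N ih].
    under [X in cint X]eq_fun do rewrite big_ord0.
    exact: cint_cst.
  under [X in cint X]eq_fun do rewrite big_ord_recr/=.
  by rewrite cintD ?ih ?f0 ?addr0//; exact: inL1_sum.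
rewrite -[cint _]subr0 -S0 -cintB//.
apply: le_trans (le_cint_l1 (inL1B Ig IS)) _.
by apply: l1_le => [|x]; [exact: inL1B|exact: gsum_tail].
Qed.

End GeometricSeries.

Section TransferSeries.
Context {R : realType}.
Implicit Types f : nat -> R -> R.

Lemma transfer_gsum d (lam K rho G : R) T T1 T2 f : 0 <= rho < 1 ->
  expanding d lam K T T1 T2 ->
  (forall k, periodic (f k) 1) -> (forall k y, `|f k y| <= G * rho ^+ k) ->
  forall x, transfer T (gsum f) x = gsum (fun k => transfer T (f k)) x.
Proof.
move=> rho01 E pf fG x; pose r := (transfer T (fun=> 1) x) : R.
have p1 : periodic (fun _ : R => 1 : R) 1 by [].
have bd (u : R -> R) (A : R) : periodic u 1 -> (forall y, `|u y| <= A) ->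
    `|transfer T u x| <= A * r.
  move=> pu uA; apply: le_trans (transfer_norm E pu x) _.
  have -> : A * r = transfer T (fun y => A * 1) x by rewrite (transferZ E).
  apply: (transfer_le E) => // y; first by rewrite pu.
  by rewrite mulr1.
have G' k : `|transfer T (f k) x| <= (G * r) * rho ^+ k.
  by apply: le_trans (bd _ _ (pf k) (fG k)) _; rewrite mulrAC.
have pS N : periodic (fun y => \sum_(k < N) f k y) 1.
  by move=> y; apply: eq_bigr => k _; exact: pf.
have LS N : transfer T (fun y => \sum_(k < N) f k y) x = \sum_(k < N) transfer T (f k) x.
  rewrite (transferE E)//; under [RHS]eq_bigr do rewrite (transferE E)//.
  by rewrite exchange_big/=; apply: eq_bigr => j _; rewrite big_distrl.
apply: (gsum_uniq rho01 G' (C := G / (1 - rho) * r)) => N.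
have pg := gsum_periodic pf.
have -> : transfer T (gsum f) x - \sum_(k < N) transfer T (f k) x =
    transfer T (fun y => gsum f y - \sum_(k < N) f k y) x.
  by rewrite (transferB E)// LS.
rewrite mulrAC; apply: bd => y; first by rewrite pg pS.
exact: (gsum_tail rho01).
Qed.


End TransferSeries.

(** * First derivatives of cocycles and sums over the past *)

Section Jets.
Context {R : realType}.
Implicit Types f g : R -> R.

(** Above the square root of the cone rate, which is what the estimate in L^1
    retains, and above 1 / lam, by which derivatives are damped. *)
Definition decay_rate (lam K : R) : R :=
  (1 + Num.max (Num.sqrt (cone_rate lam K)) lam^-1) / 2.

Section Rate.
Variables (lam K : R).
Hypotheses (lam1 : 1 < lam) (K0 : 0 <= K).
Local Notation rho := (decay_rate lam K).
Local Notation th := (cone_rate lam K).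

Let lamV : 0 < lam^-1 < 1.
Proof. by rewrite invr_gt0 invf_lt1 (lt_trans ltr01). Qed.

Let sqrt_th : 0 < Num.sqrt th < 1.
Proof.
have /andP[t0 t1] := cone_rate_itv lam1 K0.
by rewrite sqrtr_gt0 t0/= -[X in _ < X]sqrtr1 ltr_sqrt.
Qed.

Lemma decay_rate_itv : 0 < rho < 1.
Proof.
have /andP[t0 t1] := sqrt_th; have /andP[l0 l1] := lamV.
rewrite /decay_rate; move: t0 t1 l0 l1; move: (Num.sqrt _) (lam^-1) => t l t0 t1 l0 l1.
by have [h|h] := leP t l; apply/andP; split; lra.
Qed.

Lemma decay_rate_itvW : 0 <= rho < 1.
Proof. by have /andP[/ltW -> ->] := decay_rate_itv. Qed.

Lemma sqrt_cone_rate_le : 0 <= Num.sqrt th <= rho.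
Proof.
have /andP[t0 t1] := sqrt_th; have /andP[l0 l1] := lamV.
rewrite /decay_rate; move: t0 t1 l0 l1; move: (Num.sqrt _) (lam^-1) => t l t0 t1 l0 l1.
by have [h|h] := leP t l; apply/andP; split; lra.
Qed.

Lemma cone_rate_le : 0 <= th <= rho.
Proof.
have /andP[t0 _] := cone_rate_itv lam1 K0; have /andP[s0 s1] := sqrt_th.
have /andP[_ h] := sqrt_cone_rate_le; rewrite ltW//= (le_trans _ h)//.
by rewrite -[leLHS]sqr_sqrtr ?(ltW t0)// expr2 ler_piMl// ltW.
Qed.

Lemma invlam_lt_rate : 0 <= lam^-1 < rho.
Proof.
have /andP[t0 t1] := sqrt_th; have /andP[l0 l1] := lamV.
rewrite /decay_rate; move: t0 t1 l0 l1; move: (Num.sqrt _) (lam^-1) => t l t0 t1 l0 l1.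
by have [h|h] := leP t l; apply/andP; split; lra.
Qed.

End Rate.

(** The common shape of the derivatives of a cocycle: multiplier a, forcing r by
    the derivatives of lower order. *)
Fixpoint forced_seq (L : int -> (R -> R) -> R -> R) (m : int)
    (a r : nat -> R -> R) u0 (k : nat) : R -> R :=
  if k is k'.+1 then
    L (m + k'%:Z) (fun x => a k' x * forced_seq L m a r u0 k' x + r k' x)
  else u0.

Definition cocycle_d1 (T T1 T2 : int -> R -> R) (m : int) f f1 : nat -> R -> R :=
  let L n := transfer (T n) in
  forced_seq L m (fun k => invd (T1 (m + k%:Z)))
    (fun k x => invd1 (T1 (m + k%:Z)) (T2 (m + k%:Z)) x * cocycle L m k f x) f1.

Lemma forced_seq_periodic (T : int -> R -> R) m a r u0 k : periodic u0 1 ->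
  periodic (forced_seq (fun n => transfer (T n)) m a r u0 k) 1.
Proof. by case: k => //= k _; exact: transfer_periodic. Qed.

Lemma cocycle_d1_periodic (T T1 T2 : int -> R -> R) m f f1 k :
  periodic f1 1 -> periodic (cocycle_d1 T T1 T2 m f f1 k) 1.
Proof. exact: forced_seq_periodic. Qed.

Section FirstOrder.
Variables (d : nat) (lam K : R) (T T1 T2 : int -> R -> R).
Hypothesis E : forall n, expanding d lam K (T n) (T1 n) (T2 n).
Local Notation L := (fun n => transfer (T n)).
Local Notation D1 := (cocycle_d1 T T1 T2).

Lemma cocycle_deriv m f f1 k : has_deriv f f1 -> periodic f 1 ->
  has_deriv (cocycle L m k f) (D1 m f f1 k).
Proof.
move=> hf pf; elim: k => [//|k ih] /=.
by apply: (transfer_deriv (E _)) ih _; exact: cocycle_periodic.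
Qed.

Lemma cocycle_d1_continuous m f f1 k : has_deriv f f1 -> periodic f 1 ->
  continuous f1 -> continuous (D1 m f f1 k).
Proof.
move=> hf pf cf1; have pf1 := periodic_deriv hf pf; elim: k => [//|k ih] /=.
have pc : periodic (cocycle L m k f) 1 by exact: cocycle_periodic.
apply: (transfer_continuous (E _)).
  apply: contD; apply: contM => //; try exact: (p_continuous (E _)).
    exact: (p1_continuous (E _)).
  by apply: (cocycle_continuous E) => //; exact: has_deriv_continuous hf.
move=> x; rewrite (p_periodic (E _)) (p1_periodic (E _)) pc.
by congr (_ * _ + _); exact: (cocycle_d1_periodic T T1 T2 m f k pf1).
Qed.

End FirstOrder.

(** The function decays by the coupling argument; its derivative obeys a recursion
    with multiplier p <= 1 / lam, forced by the function itself. *)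
Lemma C1_decay (lam K : R) : 1 < lam -> 0 <= K -> exists2 C, 0 <= C &
  forall d T T1 T2, (forall n, expanding d lam K (T n) (T1 n) (T2 n)) ->
  forall f f1 (A : R), periodic f 1 -> cint f = 0 -> has_deriv f f1 ->
  (forall x, `|f1 x| <= A) -> forall m k x,
  `|cocycle (fun n => transfer (T n)) m k f x| <= C * A * decay_rate lam K ^+ k /\
  `|cocycle_d1 T T1 T2 m f f1 k x| <= C * A * decay_rate lam K ^+ k.
Proof.
move=> lam1 K0; set rho := decay_rate _ _; set c := cone_param lam K.
have /andP[r0 r1] := decay_rate_itv lam1 K0.
have /andP[t0 tr] := cone_rate_le lam1 K0.
have /andP[s0 sr] := invlam_lt_rate lam1 K0.
rewrite -/rho in r0 r1 tr sr.
have c0 : 0 < c by exact: cone_param_gt0.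
have e0 := expR_gt0 c.
set C0 := expR c * (1 + c^-1).
have C00 : 0 <= C0 by rewrite mulr_ge0 ?(ltW e0)// addr_ge0// invr_ge0 ltW.
set C1 := (1 + K * C0 * expR c / (rho - lam^-1)) * expR c.
have rs0 : 0 < rho - lam^-1 by rewrite subr_gt0.
have C10 : 0 <= C1.
  rewrite mulr_ge0 ?(ltW e0)// addr_ge0// divr_ge0 ?(ltW rs0)//.
  by rewrite mulr_ge0 ?(ltW e0)// mulr_ge0.
exists (C0 + C1); first exact: addr_ge0.
move=> d T T1 T2 E f f1 A pf f0 hf fA m.
have A0 : 0 <= A := le_trans (normr_ge0 _) (fA 0).
have If := inL1_continuous (has_deriv_continuous hf) pf.
have h0 k x : `|cocycle (fun n => transfer (T n)) m k f x| <= C0 * A * rho ^+ k.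
  apply: le_trans (lip_decay E k m If f0 (deriv_lip hf fA) x) _.
  rewrite -/c -/C0; apply: ler_wpM2l; first exact: mulr_ge0.
  by apply: lerXn2r; rewrite ?nnegrE ?(ltW r0).
have pf1 := periodic_deriv hf pf.
have pc k : periodic (cocycle (fun n => transfer (T n)) m k f) 1.
  exact: cocycle_periodic.
have h1 k x : `|cocycle_d1 T T1 T2 m f f1 k x| <= C1 * A * rho ^+ k.
  have := @forced_decay _ d lam K T T1 T2 E m (lam^-1) rho A (K * C0 * A)
    (cocycle_d1 T T1 T2 m f f1)
    (fun k x => invd1 (T1 (m + k%:Z)) (T2 (m + k%:Z)) x * cocycle (fun n => transfer (T n)) m k f x)
    (fun k => invd (T1 (m + k%:Z))) _ _ _ _ _ _ _ _ _ k x.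
  have -> : (A + K * C0 * A * expR c / (rho - lam^-1)) * expR c = C1 * A.
    by rewrite /C1; ring.
  apply=> //.
  - by rewrite s0.
  - by apply: mulr_ge0 => //; exact: mulr_ge0.
  - by move=> j; exact: forced_seq_periodic.
  - by move=> j y; rewrite (p1_periodic (E _)) pc.
  - by move=> j; exact: (p_periodic (E _)).
  - by move=> j y; rewrite ger0_norm ?(ltW (p_gt0 (E _) _))//; exact: (p_le (E _)).
  - move=> j y; have -> : K * C0 * A * rho ^+ j = K * (C0 * A * rho ^+ j) by ring.
    by rewrite normrM; apply: ler_pM => //; exact: (p1_le (E _)).
have pos C k : 0 <= C -> 0 <= C * A * rho ^+ k.
  by move=> C0'; apply: mulr_ge0; [exact: mulr_ge0|exact/exprn_ge0/ltW].
move=> k x; rewrite mulrDl mulrDl; split.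
  apply: le_trans (h0 k x) _; rewrite lerDl; exact: pos.
apply: le_trans (h1 k x) _; rewrite lerDr; exact: pos.
Qed.

Definition response_sum (L : int -> (R -> R) -> R -> R) (s : int -> R -> R)
  (n : int) : R -> R := gsum (response_term L s n).

Section Response.
Variables (d : nat) (lam K : R) (T T1 T2 : int -> R -> R).
Hypothesis E : forall n, expanding d lam K (T n) (T1 n) (T2 n).
Local Notation L := (fun n => transfer (T n)).
Variables (s : int -> R -> R) (rho G : R).
Hypotheses (rho01 : 0 <= rho < 1) (ps : forall n, periodic (s n) 1)
  (sG : forall n k x, `|response_term L s n k x| <= G * rho ^+ k).
Local Notation sigma := (response_sum L s).

Lemma response_term_periodic n k : periodic (response_term L s n k) 1.
Proof. exact: cocycle_periodic. Qed.

Lemma response_sum_periodic n : periodic (sigma n) 1.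
Proof. by apply: gsum_periodic => k; exact: response_term_periodic. Qed.

(** Splitting off the most recent source and moving the operator inside the sum. *)
Lemma response_sumS n x : sigma (n + 1) x = L n (sigma n) x + s n x.
Proof.
rewrite /response_sum (gsum_recl rho01 (sG _ ^~ x)).
rewrite {1}/response_term /= subr0 addrK addrC; congr (_ + _).
rewrite (@transfer_gsum _ d lam K rho G _ _ _ _ rho01 (E n)) => [|k|k y]; [|exact: response_term_periodic|exact: sG].
congr (gsum _ x); apply/funext => k; rewrite /response_term /=.
have -> : n + 1 - k.+1%:Z + k%:Z = n by rewrite -addn1 PoszD; ring.
have -> : n + 1 - k.+1%:Z = n - k%:Z by rewrite -addn1 PoszD; ring.
by [].
Qed.

Lemma response_sum_cint n : (forall n, continuous (s n)) ->
  (forall n, cint (s n) = 0) -> cint (sigma n) = 0.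
Proof.
move=> cs s0; apply: (gsum_cint0 rho01 _ _ (sG n)) => k.
- by apply: (cocycle_continuous E).
- exact: response_term_periodic.
- by rewrite (cint_cocycle E)//; exact: inL1_continuous.
Qed.

End Response.

End Jets.

(** * Second and third derivatives of a transfer *)

Section ThirdOrder.
Context {R : realType}.
Implicit Types f g : R -> R.

Record expanding4 (d : nat) (lam K : R) (T T1 T2 T3 T4 : R -> R) : Prop := Expanding4 {
  exp4_exp : expanding d lam K T T1 T2;
  exp4_d3 : has_deriv T2 T3;
  exp4_d4 : has_deriv T3 T4;
  exp4_K3 : forall x, `|T3 x| <= K;
  exp4_K4 : forall x, `|T4 x| <= K }.

(** Second and third derivatives of the weight. *)
Definition invd2 (T1 T2 T3 : R -> R) : R -> R := fun x =>
  - T3 x * invd T1 x ^+ 2 + 2 * T2 x ^+ 2 * invd T1 x ^+ 3.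

Definition invd3 (T1 T2 T3 T4 : R -> R) : R -> R := fun x =>
  - T4 x * invd T1 x ^+ 2 + 6 * T2 x * T3 x * invd T1 x ^+ 3
  - 6 * T2 x ^+ 3 * invd T1 x ^+ 4.

(** Bounds the weight and its first three derivatives. *)
Definition jet_bound (K : R) : R := 1 + K + 6 * K ^+ 2 + 6 * K ^+ 3.

(** The lower-order terms in the second and third derivatives of a transfer, in
    terms of the weight p and of the function f. *)
Definition jet2 (p p1 p2 f f1 : R -> R) : R -> R := fun x =>
  3 * p x * p1 x * f1 x + (p1 x ^+ 2 + p x * p2 x) * f x.

Definition jet3 (p p1 p2 p3 f f1 f2 : R -> R) : R -> R := fun x =>
  6 * p x ^+ 2 * p1 x * f2 x + (7 * p x * p1 x ^+ 2 + 4 * p x ^+ 2 * p2 x) * f1 x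
  + (p1 x ^+ 3 + 4 * p x * p1 x * p2 x + p x ^+ 2 * p3 x) * f x.

Section OneMap.
Variables (d : nat) (lam K : R) (T T1 T2 T3 T4 : R -> R).
Hypothesis F : expanding4 d lam K T T1 T2 T3 T4.
Let E := exp4_exp F.
Local Notation p := (invd T1).
Local Notation p1 := (invd1 T1 T2).
Local Notation p2 := (invd2 T1 T2 T3).
Local Notation p3 := (invd3 T1 T2 T3 T4).
Local Notation L := (transfer T).
Local Notation P := (jet_bound K).

Let p1E x : p1 x = - T2 x * (p x * p x).
Proof. by rewrite /invd1 /invd expr2 invfM. Qed.

Lemma p1_deriv : has_deriv p1 p2.
Proof.
have h := has_derivM (has_derivN (exp4_d3 F)) (has_derivM (p_deriv E) (p_deriv E)).
apply: has_deriv_ext (has_deriv_eq h _) _ => x; last by rewrite p1E.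
by rewrite p1E /invd2; ring.
Qed.

Lemma p2_deriv : has_deriv p2 p3.
Proof.
have hpp := has_derivM (p_deriv E) (p_deriv E).
have hA := has_derivM (has_derivN (exp4_d4 F)) hpp.
have hB := has_derivZ 2 (has_derivM (has_derivM (exp4_d3 F) (exp4_d3 F))
  (has_derivM (p_deriv E) hpp)).
apply: has_deriv_ext (has_deriv_eq (has_derivD hA hB) _) _ => x.
  by rewrite p1E /invd3; ring.
by rewrite /invd2; ring.
Qed.

Lemma p2_periodic : periodic p2 1.
Proof. exact: periodic_deriv p1_deriv (p1_periodic E). Qed.

Lemma p3_periodic : periodic p3 1.
Proof. exact: periodic_deriv p2_deriv p2_periodic. Qed.

Lemma jet_bound_ge1 : 1 <= P.
Proof.
have K0 := exp_K_ge0 E; have := exprn_ge0 2 K0; have := exprn_ge0 3 K0.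
by rewrite /jet_bound; move: K0; lra.
Qed.

Let pn x : `|p x| <= 1.
Proof. by rewrite ger0_norm ?(ltW (p_gt0 E x))// (p_le1 E). Qed.

Let pXn x n : `|p x ^+ n| <= 1.
Proof. by rewrite normrX exprn_ile1. Qed.

Lemma p_le_jet x : `|p x| <= P.
Proof. exact: le_trans (pn x) jet_bound_ge1. Qed.

Lemma p1_le_jet x : `|p1 x| <= P.
Proof.
have K0 := exp_K_ge0 E; have := exprn_ge0 2 K0; have := exprn_ge0 3 K0.
by have := p1_le E x; rewrite /jet_bound; lra.
Qed.

Let normX (a A : R) n : `|a| <= A -> `|a ^+ n| <= A ^+ n.
Proof. by move=> aA; rewrite normrX; apply: lerXn2r; rewrite ?nnegrE// (le_trans _ aA). Qed.

Let normc (n : nat) : `|n%:R : R| <= n%:R. Proof. by rewrite ger0_norm. Qed.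

Lemma p2_le_jet x : `|p2 x| <= P.
Proof.
have K0 := exp_K_ge0 E; have K2 := exprn_ge0 2 K0; have K3 := exprn_ge0 3 K0.
have h : `|p2 x| <= K * 1 + 2 * K ^+ 2 * 1.
  apply: norm_add; apply: norm_mul => //; first by rewrite normrN; exact: (exp4_K3 F).
  by apply: norm_mul; [exact: normc|apply: normX; exact: (exp_K E)].
by apply: le_trans h _; rewrite /jet_bound; lra.
Qed.

Lemma p3_le_jet x : `|p3 x| <= P.
Proof.
have K0 := exp_K_ge0 E; have K2 := exprn_ge0 2 K0; have K3 := exprn_ge0 3 K0.
have h : `|p3 x| <= K * 1 + 6 * K * K * 1 + 6 * K ^+ 3 * 1.
  apply: norm_add; [apply: norm_add|rewrite normrN]; apply: norm_mul => //.
  - by rewrite normrN; exact: (exp4_K4 F).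
  - apply: norm_mul; last exact: (exp4_K3 F).
    by apply: norm_mul; [exact: normc|exact: (exp_K E)].
  - by apply: norm_mul; [exact: normc|apply: normX; exact: (exp_K E)].
have e : K * 1 + 6 * K * K * 1 + 6 * K ^+ 3 * 1 = K + 6 * K ^+ 2 + 6 * K ^+ 3 by ring.
by apply: le_trans h _; rewrite e /jet_bound; lra.
Qed.

Lemma jet2_le f f1 (A : R) x : `|f x| <= A -> `|f1 x| <= A ->
  `|jet2 p p1 p2 f f1 x| <= 5 * P ^+ 2 * A.
Proof.
move=> fA f1A; have A0 : 0 <= A := le_trans (normr_ge0 _) fA.
have P1 := jet_bound_ge1; have P0 : 0 <= P := le_trans ler01 P1.
have h : `|jet2 p p1 p2 f f1 x| <= 3 * P * P * A + (P ^+ 2 + P * P) * A.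
  apply: norm_add; apply: norm_mul => //.
    by apply: norm_mul (p1_le_jet x); apply: norm_mul (p_le_jet x); exact: normc.
  apply: norm_add; first by apply: normX; exact: p1_le_jet.
  by apply: norm_mul; [exact: p_le_jet|exact: p2_le_jet].
apply: le_trans h _; rewrite le_eqVlt; apply/orP; left; apply/eqP; ring.
Qed.

Lemma jet3_le f f1 f2 (A : R) x : `|f x| <= A -> `|f1 x| <= A -> `|f2 x| <= A ->
  `|jet3 p p1 p2 p3 f f1 f2 x| <= 23 * P ^+ 3 * A.
Proof.
move=> fA f1A f2A; have A0 : 0 <= A := le_trans (normr_ge0 _) fA.
have P1 := jet_bound_ge1; have P0 : 0 <= P := le_trans ler01 P1.
have pP := p_le_jet x; have p1P := p1_le_jet x.
have p2P := p2_le_jet x; have p3P := p3_le_jet x.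
have h : `|jet3 p p1 p2 p3 f f1 f2 x| <= 6 * P ^+ 2 * P * A +
    (7 * P * P ^+ 2 + 4 * P ^+ 2 * P) * A +
    (P ^+ 3 + 4 * P * P * P + P ^+ 2 * P) * A.
  apply: norm_add; [apply: norm_add|]; apply: norm_mul => //.
  - apply: norm_mul => //; apply: norm_mul; [exact: normc|exact: normX].
  - apply: norm_add; apply: norm_mul => //; try exact: normX.
      by apply: norm_mul => //; exact: normc.
    by apply: norm_mul; [exact: normc|exact: normX].
  - apply: norm_add; [apply: norm_add|]; try exact: normX.
      do 3 (apply: norm_mul => //); exact: normc.
    by apply: norm_mul => //; exact: normX.
apply: le_trans h _; rewrite le_eqVlt; apply/orP; left; apply/eqP; ring.
Qed.

Lemma jet2_periodic f f1 : periodic f 1 -> periodic f1 1 ->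
  periodic (jet2 p p1 p2 f f1) 1.
Proof.
by move=> pf pf1 x; rewrite /jet2 (p_periodic E) (p1_periodic E) p2_periodic pf pf1.
Qed.

Lemma jet3_periodic f f1 f2 : periodic f 1 -> periodic f1 1 -> periodic f2 1 ->
  periodic (jet3 p p1 p2 p3 f f1 f2) 1.
Proof.
move=> pf pf1 pf2 x.
by rewrite /jet3 (p_periodic E) (p1_periodic E) p2_periodic p3_periodic pf pf1 pf2.
Qed.

Lemma transfer_deriv2 f f1 f2 : periodic f 1 -> has_deriv f f1 -> has_deriv f1 f2 ->
  has_deriv (L (fun x => p x * f1 x + p1 x * f x))
    (L (fun x => p x ^+ 2 * f2 x + jet2 p p1 p2 f f1 x)).
Proof.
move=> pf h1 h2; have pf1 := periodic_deriv h1 pf.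
have hg := has_derivD (has_derivM (p_deriv E) h2) (has_derivM p1_deriv h1).
have pg : periodic (fun x => p x * f1 x + p1 x * f x) 1.
  by move=> x; rewrite (p_periodic E) (p1_periodic E) pf pf1.
apply: has_deriv_eq (transfer_deriv E hg pg) _ => x.
by congr (transfer _ _ _); apply/funext => y; rewrite /jet2; ring.
Qed.

Lemma transfer_deriv3 f f1 f2 f3 : periodic f 1 ->
  has_deriv f f1 -> has_deriv f1 f2 -> has_deriv f2 f3 ->
  has_deriv (L (fun x => p x ^+ 2 * f2 x + jet2 p p1 p2 f f1 x))
    (L (fun x => p x ^+ 3 * f3 x + jet3 p p1 p2 p3 f f1 f2 x)).
Proof.
move=> pf h1 h2 h3; have pf1 := periodic_deriv h1 pf; have pf2 := periodic_deriv h2 pf1.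
have hp := p_deriv E.
have hA := has_derivM (has_derivM hp hp) h3.
have hB := has_derivZ 3 (has_derivM (has_derivM hp p1_deriv) h2).
have hC := has_derivM (has_derivD (has_derivM p1_deriv p1_deriv)
  (has_derivM hp p2_deriv)) h1.
have hg := has_derivD hA (has_derivD hB hC).
have pg : periodic (fun x => p x ^+ 2 * f2 x + jet2 p p1 p2 f f1 x) 1.
  by move=> x; rewrite (jet2_periodic pf pf1) (p_periodic E) pf2.
have eg : (fun x => p x ^+ 2 * f2 x + jet2 p p1 p2 f f1 x) = (fun x =>
    p x * p x * f2 x + (3 * (p x * p1 x * f1 x) + (p1 x * p1 x + p x * p2 x) * f x)).
  by apply/funext => x; rewrite /jet2; ring.
rewrite eg in pg *; apply: has_deriv_eq (transfer_deriv E hg pg) _ => x.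
by congr (transfer _ _ _); apply/funext => y; rewrite /jet3; ring.
Qed.

End OneMap.
End ThirdOrder.

(** * Smooth sums over the past *)

Section SmoothResponse.
Context {R : realType}.
Implicit Types f g : R -> R.

Section ThirdOrderDecay.
Variables (d : nat) (lam K : R) (T T1 T2 T3 T4 : int -> R -> R).
Hypothesis F : forall n, expanding4 d lam K (T n) (T1 n) (T2 n) (T3 n) (T4 n).
Let E n := exp4_exp (F n).
Local Notation L := (fun n => transfer (T n)).
Local Notation rho := (decay_rate lam K).
Local Notation D1 := (cocycle_d1 T T1 T2).
Local Notation p n := (invd (T1 n)).
Local Notation p1 n := (invd1 (T1 n) (T2 n)).
Local Notation p2 n := (invd2 (T1 n) (T2 n) (T3 n)).
Local Notation p3 n := (invd3 (T1 n) (T2 n) (T3 n) (T4 n)).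
Local Notation P := (jet_bound K).

Definition cocycle_d2 m f f1 f2 : nat -> R -> R :=
  forced_seq L m (fun k x => p (m + k%:Z) x ^+ 2)
    (fun k => jet2 (p (m + k%:Z)) (p1 (m + k%:Z)) (p2 (m + k%:Z))
      (cocycle L m k f) (D1 m f f1 k)) f2.

Definition cocycle_d3 m f f1 f2 f3 : nat -> R -> R :=
  forced_seq L m (fun k x => p (m + k%:Z) x ^+ 3)
    (fun k => jet3 (p (m + k%:Z)) (p1 (m + k%:Z)) (p2 (m + k%:Z)) (p3 (m + k%:Z))
      (cocycle L m k f) (D1 m f f1 k) (cocycle_d2 m f f1 f2 k)) f3.

Variables (f f1 f2 f3 : int -> R -> R).
Hypotheses (pf : forall m, periodic (f m) 1) (h1 : forall m, has_deriv (f m) (f1 m))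
  (h2 : forall m, has_deriv (f1 m) (f2 m)) (h3 : forall m, has_deriv (f2 m) (f3 m)).
Local Notation u m := (fun k => cocycle L m k (f m)).
Local Notation u1 m := (D1 m (f m) (f1 m)).
Local Notation u2 m := (cocycle_d2 m (f m) (f1 m) (f2 m)).
Local Notation u3 m := (cocycle_d3 m (f m) (f1 m) (f2 m) (f3 m)).

Let pf1 m := periodic_deriv (h1 m) (pf m).
Let pf2 m := periodic_deriv (h2 m) (pf1 m).
Let pf3 m := periodic_deriv (h3 m) (pf2 m).
Let pu m k : periodic (u m k) 1. Proof. exact: cocycle_periodic. Qed.
Let pu1 m k : periodic (u1 m k) 1. Proof. exact: cocycle_d1_periodic. Qed.
Let pu2 m k : periodic (u2 m k) 1. Proof. exact: forced_seq_periodic. Qed.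
Let pu3 m k : periodic (u3 m k) 1. Proof. exact: forced_seq_periodic. Qed.

Lemma cocycle_deriv2 m k : has_deriv (u1 m k) (u2 m k).
Proof.
elim: k => [|k ih] /=; first exact: h2.
exact: (transfer_deriv2 (F _) (pu m k) (cocycle_deriv E m k (h1 m) (pf m)) ih).
Qed.

Lemma cocycle_deriv3 m k : has_deriv (u2 m k) (u3 m k).
Proof.
elim: k => [|k ih] /=; first exact: h3.
exact: (transfer_deriv3 (F _) (pu m k) (cocycle_deriv E m k (h1 m) (pf m))
  (cocycle_deriv2 m k) ih).
Qed.

Variable A : R.
Hypotheses (f0 : forall m, cint (f m) = 0) (f1A : forall m x, `|f1 m x| <= A)
  (f2A : forall m x, `|f2 m x| <= A) (f3A : forall m x, `|f3 m x| <= A).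

(** The derivatives of order 2 and 3 are treated in turn: each is forced by the
    lower ones, which already decay, and damped by a power of p. *)
Lemma C3_decay : exists2 C, 0 <= C & forall m k x,
  [/\ `|u m k x| <= C * rho ^+ k, `|u1 m k x| <= C * rho ^+ k,
      `|u2 m k x| <= C * rho ^+ k & `|u3 m k x| <= C * rho ^+ k].
Proof.
have lam1 := exp_gt1 (E 0); have K0 := exp_K_ge0 (E 0).
have A0 : 0 <= A := le_trans (normr_ge0 _) (f1A 0 0).
have /andP[/ltW r0 _] := decay_rate_itv lam1 K0.
have P1 : 1 <= P := jet_bound_ge1 (F 0).
have P0 : 0 <= P := le_trans ler01 P1.
have [C C0 hC] := C1_decay lam1 K0.
have sr := invlam_lt_rate lam1 K0; have /andP[s0 sr'] := sr.
set M := C * A; have M0 : 0 <= M by exact: mulr_ge0.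
have hu m k x := hC d T T1 T2 E (f m) (f1 m) A (pf m) (f0 m) (h1 m) (f1A m) m k x.
have pX m n x : `|p m x ^+ n.+1| <= lam^-1.
  rewrite normrX exprS -[leRHS]mulr1.
  have pn : `|p m x| <= lam^-1 by rewrite ger0_norm ?(ltW (p_gt0 (E m) x))// (p_le (E m)).
  apply: ler_pM; rewrite ?exprn_ge0// exprn_ile1//.
  by apply: le_trans pn _; rewrite ltW// (lamV_lt1 (E 0)).
have ppX m n : periodic (fun x => p m x ^+ n) 1.
  by move=> x; rewrite (p_periodic (E m)).
have pos a k : 0 <= a -> 0 <= a * rho ^+ k.
  by move=> a0; rewrite mulr_ge0// exprn_ge0.
set G2 := 5 * P ^+ 2 * M.
have G20 : 0 <= G2 by rewrite mulr_ge0// mulr_ge0// exprn_ge0.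
set M2 := (A + G2 * expR (cone_param lam K) / (rho - lam^-1)) * expR (cone_param lam K).
have M20 : 0 <= M2.
  rewrite mulr_ge0 ?expR_ge0// addr_ge0// divr_ge0 ?subr_ge0 ?(ltW sr')//.
  by rewrite mulr_ge0// expR_ge0.
have hu2 m k x : `|u2 m k x| <= M2 * rho ^+ k.
  apply: (@forced_decay _ d lam K T T1 T2 E m lam^-1 rho A G2 (u2 m)
    (fun k => jet2 (p (m + k%:Z)) (p1 (m + k%:Z)) (p2 (m + k%:Z)) (u m k) (u1 m k))
    (fun k x => p (m + k%:Z) x ^+ 2)) => //.
  - exact: f2A.
  - by move=> j; exact: (jet2_periodic (F _) (pu m j) (pu1 m j)).
  - move=> j y; rewrite /G2 -mulrA; have [a b] := hu m j y.
    exact: (jet2_le (F _) a b).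
set M3 := M + M2; have M30 : 0 <= M3 by exact: addr_ge0.
set G3 := 23 * P ^+ 3 * M3.
have G30 : 0 <= G3 by rewrite mulr_ge0// mulr_ge0// exprn_ge0.
set M4 := (A + G3 * expR (cone_param lam K) / (rho - lam^-1)) * expR (cone_param lam K).
have M40 : 0 <= M4.
  rewrite mulr_ge0 ?expR_ge0// addr_ge0// divr_ge0 ?subr_ge0 ?(ltW sr')//.
  by rewrite mulr_ge0// expR_ge0.
have hu3 m k x : `|u3 m k x| <= M4 * rho ^+ k.
  apply: (@forced_decay _ d lam K T T1 T2 E m lam^-1 rho A G3 (u3 m)
    (fun k => jet3 (p (m + k%:Z)) (p1 (m + k%:Z)) (p2 (m + k%:Z)) (p3 (m + k%:Z))
      (u m k) (u1 m k) (u2 m k))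
    (fun k x => p (m + k%:Z) x ^+ 3)) => //.
  - exact: f3A.
  - by move=> j; exact: (jet3_periodic (F _) (pu m j) (pu1 m j) (pu2 m j)).
  - move=> j y; rewrite /G3 -mulrA; have [a b] := hu m j y.
    have up z N : z <= N * rho ^+ j -> N <= M3 -> z <= M3 * rho ^+ j.
      by move=> zN NM; apply: le_trans zN _; rewrite ler_wpM2r// exprn_ge0.
    by apply: (jet3_le (F _)); [apply: up a _|apply: up b _|apply: up (hu2 _ _ _) _];
      rewrite /M3 ?lerDl ?lerDr.
exists (M3 + M4); first exact: addr_ge0.
move=> m k x; have [a b] := hu m k x.
have up z N : z <= N * rho ^+ k -> N <= M3 + M4 -> z <= (M3 + M4) * rho ^+ k.
  by move=> zN NM; apply: le_trans zN _; rewrite ler_wpM2r// exprn_ge0.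
have MM : M <= M3 + M4 by rewrite /M3 -addrA lerDl addr_ge0.
split; [exact: up a MM|exact: up b MM|apply: up (hu2 m k x) _|apply: up (hu3 m k x) _].
  by rewrite /M3 addrAC lerDr addr_ge0.
by rewrite lerDr.
Qed.

End ThirdOrderDecay.

(** Term by term differentiation. The constant is chosen before the maps, so that
    it serves all the perturbed families at once; the last clause controls the
    remainder of the series in C^1. *)
Lemma response_sum_C1 (lam K : R) : 1 < lam -> 0 <= K -> exists2 C, 0 <= C &
  forall d T T1 T2, (forall n, expanding d lam K (T n) (T1 n) (T2 n)) ->
  forall (s s1 : int -> R -> R) (A : R), (forall n, periodic (s n) 1) ->
  (forall n, cint (s n) = 0) -> (forall n, has_deriv (s n) (s1 n)) ->
  (forall n, continuous (s1 n)) -> (forall n x, `|s1 n x| <= A) ->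
  let L := fun n => transfer (T n) in
  (forall n k x, `|response_term L s n k x| <= C * A * decay_rate lam K ^+ k) /\
  exists sg1, [/\ forall n, has_deriv (response_sum L s n) (sg1 n),
    forall n, continuous (sg1 n), forall n x, `|response_sum L s n x| <= C * A,
    forall n x, `|sg1 n x| <= C * A &
    forall N n, exists2 t1, has_deriv (fun x => response_sum L s n x -
        \sum_(k < N) response_term L s n k x) t1 & continuous t1 /\ forall x,
      `|response_sum L s n x - \sum_(k < N) response_term L s n k x|
        <= C * A * decay_rate lam K ^+ N /\
      `|t1 x| <= C * A * decay_rate lam K ^+ N].
Proof.
move=> lam1 K0; have [C C0 hC] := C1_decay lam1 K0.
have rho01 := decay_rate_itvW lam1 K0; have /andP[r0 r1] := rho01.
move: hC r0 r1 rho01; set rho := decay_rate lam K => hC r0 r1 rho01.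
have r1' : 0 < 1 - rho by rewrite subr_gt0.
have CC : C <= C / (1 - rho).
  by rewrite ler_peMr// invf_ge1// lerBlDr lerDl.
exists (C / (1 - rho)); first by rewrite divr_ge0// ltW.
move=> d T T1 T2 E s s1 A ps s0 hs cs1 s1A L.
have A0 : 0 <= A := le_trans (normr_ge0 _) (s1A 0 0).
have hu n k x := hC d T T1 T2 E (s n) (s1 n) A (ps n) (s0 n) (hs n) (s1A n) (n + 1 - 1) k x.
pose f1 n k := cocycle_d1 T T1 T2 (n - k%:Z) (s (n - k%:Z - 1)) (s1 (n - k%:Z - 1)) k.
have tG n k x : `|response_term L s n k x| <= C * A * rho ^+ k.
  by have [] := hC d T T1 T2 E _ _ A (ps _) (s0 _) (hs _) (s1A (n - k%:Z - 1)) (n - k%:Z) k x.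
have f1G n k x : `|f1 n k x| <= C * A * rho ^+ k.
  by have [] := hC d T T1 T2 E _ _ A (ps _) (s0 _) (hs _) (s1A (n - k%:Z - 1)) (n - k%:Z) k x.
have hd n k : has_deriv (response_term L s n k) (f1 n k).
  by apply: (cocycle_deriv E).
have cf1 n k : continuous (f1 n k).
  by apply: (cocycle_d1_continuous E).
have e : C / (1 - rho) * A = C * A / (1 - rho) by rewrite mulrAC.
split=> [n k x|].
  apply: le_trans (tG n k x) _; rewrite ler_wpM2r ?exprn_ge0//.
  by rewrite ler_wpM2r.
exists (fun n => gsum (f1 n)); split.
- by move=> n; exact: (gsum_deriv rho01 (hd n) (tG n) (f1G n)).
- by move=> n; exact: (gsum_continuous rho01 (f1G n) (cf1 n)).
- by move=> n x; rewrite e; exact: (gsum_le rho01 (fun k => tG n k x)).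
- by move=> n x; rewrite e; exact: (gsum_le rho01 (fun k => f1G n k x)).
move=> N n; exists (fun x => gsum (f1 n) x - \sum_(k < N) f1 n k x).
  apply: has_derivB; first exact: (gsum_deriv rho01 (hd n) (tG n) (f1G n)).
  exact: (has_deriv_sum (fun k : 'I_N => hd n k)).
split.
  apply: contB; first exact: (gsum_continuous rho01 (f1G n) (cf1 n)).
  exact: (cont_sum (fun k : 'I_N => cf1 n k)).
by move=> x; rewrite e; split; apply: (gsum_tail rho01).
Qed.

Lemma response_sum_C3 d (lam K : R) T T1 T2 T3 T4 :
  (forall n, expanding4 d lam K (T n) (T1 n) (T2 n) (T3 n) (T4 n)) ->
  forall (s s1 s2 s3 : int -> R -> R) (A : R), (forall n, periodic (s n) 1) ->
  (forall n, cint (s n) = 0) -> (forall n, has_deriv (s n) (s1 n)) ->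
  (forall n, has_deriv (s1 n) (s2 n)) -> (forall n, has_deriv (s2 n) (s3 n)) ->
  (forall n x, `|s1 n x| <= A) -> (forall n x, `|s2 n x| <= A) ->
  (forall n x, `|s3 n x| <= A) ->
  exists C sg1 sg2 sg3, let sg := response_sum (fun n => transfer (T n)) s in
  [/\ forall n, has_deriv (sg n) (sg1 n), forall n, has_deriv (sg1 n) (sg2 n),
    forall n, has_deriv (sg2 n) (sg3 n) & forall n x,
    [/\ `|sg n x| <= C, `|sg1 n x| <= C, `|sg2 n x| <= C & `|sg3 n x| <= C]].
Proof.
move=> F s s1 s2 s3 A ps s0 hs1 hs2 hs3 s1A s2A s3A.
have E n := exp4_exp (F n); have lam1 := exp_gt1 (E 0); have K0 := exp_K_ge0 (E 0).
have rho01 := decay_rate_itvW lam1 K0.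
pose sh (g : int -> R -> R) := fun m => g (m - 1).
have [C C0 hC] := C3_decay F (f := sh s) (f1 := sh s1) (f2 := sh s2) (f3 := sh s3)
  (fun m => ps _) (fun m => hs1 _) (fun m => hs2 _) (fun m => hs3 _) (A := A)
  (fun m => s0 _) (fun m => s1A _) (fun m => s2A _) (fun m => s3A _).
pose f1 n k := cocycle_d1 T T1 T2 (n - k%:Z) (sh s (n - k%:Z)) (sh s1 (n - k%:Z)) k.
pose f2 n k := cocycle_d2 T T1 T2 T3 (n - k%:Z) (sh s (n - k%:Z)) (sh s1 (n - k%:Z))
  (sh s2 (n - k%:Z)) k.
pose f3 n k := cocycle_d3 T T1 T2 T3 T4 (n - k%:Z) (sh s (n - k%:Z)) (sh s1 (n - k%:Z))
  (sh s2 (n - k%:Z)) (sh s3 (n - k%:Z)) k.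
have hd1 n k : has_deriv (response_term (fun n => transfer (T n)) s n k) (f1 n k).
  exact: (cocycle_deriv E _ _ (hs1 _) (ps _)).
have hd2 n k : has_deriv (f1 n k) (f2 n k).
  exact: (cocycle_deriv2 F (f := sh s) (f1 := sh s1) (f2 := sh s2)
    (fun m => ps _) (fun m => hs1 _) (fun m => hs2 _)).
have hd3 n k : has_deriv (f2 n k) (f3 n k).
  exact: (cocycle_deriv3 F (f := sh s) (f1 := sh s1) (f2 := sh s2) (f3 := sh s3)
    (fun m => ps _) (fun m => hs1 _) (fun m => hs2 _) (fun m => hs3 _)).
have g0 n k x : `|response_term (fun n => transfer (T n)) s n k x| <= C * decay_rate lam K ^+ k.
  by have [] := hC (n - k%:Z) k x.
have g1 n k x : `|f1 n k x| <= C * decay_rate lam K ^+ k by have [] := hC (n - k%:Z) k x.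
have g2 n k x : `|f2 n k x| <= C * decay_rate lam K ^+ k by have [] := hC (n - k%:Z) k x.
have g3 n k x : `|f3 n k x| <= C * decay_rate lam K ^+ k by have [] := hC (n - k%:Z) k x.
exists (C / (1 - decay_rate lam K)), (fun n => gsum (f1 n)), (fun n => gsum (f2 n)),
  (fun n => gsum (f3 n)).
split => n.
- exact: (gsum_deriv rho01 (hd1 n) (g0 n) (g1 n)).
- exact: (gsum_deriv rho01 (hd2 n) (g1 n) (g2 n)).
- exact: (gsum_deriv rho01 (hd3 n) (g2 n) (g3 n)).
- by move=> x; split; apply: (gsum_le rho01).
Qed.

End SmoothResponse.

(** * Primitives of bounded functions *)

Section Primitive.
Context {R : realType}.
Notation mu := (@lebesgue_measure R).
Variables (s : R -> R) (K : R).
Hypotheses (ms : measurable_fun setT s) (sK : forall x, `|s x| <= K).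

Let Is (a b : R) : mu.-integrable `[a, b] (EFin \o s).
Proof.
apply: measurable_bounded_integrable => //.
- have := @lebesgue_measure_itv R `[a, b].
  by move=> /= h; rewrite [X in (X < _)%E]h; case: ifP; rewrite ?ltry// -EFinB ltry.
- exact: measurable_funTS.
- exists K; split; first exact: num_real.
  by move=> M KM x _; exact: le_trans (sK x) (ltW KM).
Qed.

Let split (a b c : R) : a <= b -> b <= c ->
  \int[mu]_(x in `[a, c]) s x =
  \int[mu]_(x in `[a, b]) s x + \int[mu]_(x in `[b, c]) s x.
Proof.
move=> ab bc; have h := @Rintegral_itvB R s (BLeft a) (BRight c) b (Is a c).
have /eqP := h ab bc; rewrite subr_eq addrC => /eqP ->.
congr (_ + _); rewrite Rintegral_itv_obnd_cbnd//.
by apply: integrableS (Is b c) => //; apply: subset_itvr; rewrite bnd_simp.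
Qed.

Let norm_int (a b : R) : a <= b -> `|\int[mu]_(x in `[a, b]) s x| <= K * (b - a).
Proof.
move=> ab; apply: le_trans (le_normr_Rintegral _ (Is a b)) _ => //.
have mab : fine (mu `[a, b]%classic) = b - a.
  have /= -> := @lebesgue_measure_itv R `[a, b].
  rewrite lte_fin; case: ltP => [//|ba].
  by have -> : a = b by [apply/eqP; rewrite eq_le ab ba]; rewrite subrr.
have Ic : mu.-integrable `[a, b] (EFin \o (fun=> K)).
  apply: continuous_compact_integrable; first exact: segment_compact.
  by apply: continuous_subspaceT; exact: cont_cst.
have h : \int[mu]_(x in `[a, b]) `|s x| <= \int[mu]_(x in `[a, b]) K.
  by apply: le_Rintegral => //; exact: (integrable_norm (Is a b)).
by apply: le_trans h _; rewrite Rintegral_cst// [X in K * X]mab.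
Qed.

(** A primitive on the whole line; the base point moves to the left of x so
    that one formula covers both signs. *)
Definition prim (x : R) : R :=
  \int[mu]_(t in `[- `|x|, x]) s t - \int[mu]_(t in `[- `|x|, 0]) s t.

Lemma primE (a x : R) : a <= x -> a <= 0 ->
  prim x = \int[mu]_(t in `[a, x]) s t - \int[mu]_(t in `[a, 0]) s t.
Proof.
move=> ax a0; set m := Num.min a (- `|x|).
have ma : m <= a by rewrite ge_min lexx.
have mx : m <= - `|x| by rewrite ge_min lexx orbT.
have xx : - `|x| <= x by rewrite lerNl -normrN ler_norm.
have x0 : - `|x| <= 0 by rewrite oppr_le0.
have h1 := split ma ax; have h2 := split ma a0.
have h3 := split mx xx; have h4 := split mx x0.
by rewrite /prim; lra.
Qed.

Lemma primB x y : x <= y -> prim y - prim x = \int[mu]_(t in `[x, y]) s t.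
Proof.
move=> xy; set m := Num.min x 0.
have mx : m <= x by rewrite ge_min lexx.
have m0 : m <= 0 by rewrite ge_min lexx orbT.
rewrite (primE (le_trans mx xy) m0) (primE mx m0) (split mx xy); lra.
Qed.

Lemma prim_lip x y : `|prim x - prim y| <= K * `|x - y|.
Proof.
wlog xy : x y / x <= y => [h|].
  by have [/h//|/ltW/h] := leP x y; rewrite distrC (distrC y).
by rewrite distrC (distrC x) primB// (ger0_norm (_ : 0 <= y - x)) ?subr_ge0// norm_int.
Qed.

Let near_primE (a x : R) : a < x -> a <= 0 ->
  \forall y \near x, \int[mu]_(t in `[a, y]) s t - \int[mu]_(t in `[a, 0]) s t = prim y.
Proof.
move=> ax a0; have : \forall y \near x, a < y by exact: lt_nbhsr.
by apply: filterS => y ay; rewrite -primE// ltW.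
Qed.

Let prim_derive (a x l : R) : a < x -> a <= 0 ->
  derivable (fun y => \int[mu]_(t in `[a, y]) s t) x 1 /\
    derive1 (fun y => \int[mu]_(t in `[a, y]) s t) x = l ->
  is_derive x (1 : R) prim l.
Proof.
move=> ax a0 [dF F'].
set F := fun y => \int[mu]_(t in `[a, y]) s t in dF F'.
have hF : is_derive x (1 : R) F l by rewrite -F' derive1E; exact/derivableP.
have h0 : is_derive x (1 : R) (fun _ : R => \int[mu]_(t in `[a, 0]) s t) 0.
  exact: is_derive_cst.
have hB := is_deriveB hF h0; rewrite subr0 in hB.
apply: near_eq_is_derive hB.
exact: near_primE.
Qed.

Lemma prim_deriv : continuous s -> has_deriv prim s.
Proof.
move=> cs x; set a := Num.min x 0 - 1.
have mx : Num.min x 0 <= x by rewrite ge_min lexx.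
have m0 : Num.min x 0 <= 0 by rewrite ge_min lexx orbT.
have ax : a < x by rewrite /a; lra.
have a0 : a <= 0 by rewrite /a; lra.
apply: (prim_derive ax a0).
have xx : x < x + 1 by rewrite ltrDl.
have := @continuous_FTC1_closed R s a x (x + 1) xx (Is a (x + 1)) ax (cs x).
by [].
Qed.

Lemma prim_deriv_ae : {ae mu, forall x : R, -1 < x -> is_derive x (1 : R) prim (s x)}.
Proof.
have loc : locally_integrable [set: R] s.
  split; [exact: ms|exact: openT|move=> A _ cA].
  have IA : mu.-integrable A (EFin \o s).
    apply: measurable_bounded_integrable.
    - exact: compact_measurable.
    - exact: compact_finite_measure.
    - exact: measurable_funTS.
    - exists K; split; first exact: num_real.
      by move=> M KM x _; exact: le_trans (sK x) (ltW KM).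
  by case/integrableP : IA.
have := @FTC1 R s (BLeft (-1)) (fun y => Is (-1) y) loc.
apply: aeS => x h x1.
apply: (prim_derive x1 (lerN10 R)); apply: h.
by rewrite lte_fin.
Qed.

End Primitive.

(** * Duality between integrable and smooth functions *)

Section Duality.
Context {R : realType}.
Notation mu := (@lebesgue_measure R).
Implicit Types f g s w : R -> R.

Lemma Rintegral_shift f (t a b : R) : measurable_fun setT f ->
  \int[mu]_(x in `[a + t, b + t]) f x = \int[mu]_(x in `[a, b]) f (x + t).
Proof.
move=> mf; have mF : measurable_fun setT (EFin \o f) by exact/measurable_EFinP.
rewrite /Rintegral; congr fine; rewrite integralE [RHS]integralE.
have e : [set x | `[a + t, b + t]%classic (x + t)] = `[a, b]%classic.
  by apply/seteqP; split => x /=; rewrite !in_itv/= !lerD2r.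
congr (_ - _)%E.
- rewrite (ge0_integral_shift t (measurable_itv _)); last 2 first.
  + exact/measurable_funTS/measurable_funepos.
  + by move=> x _; exact: funepos_ge0.
  by rewrite e; apply: eq_integral => x _; rewrite ?funeposE ?funenegE.
- rewrite (ge0_integral_shift t (measurable_itv _)); last 2 first.
  + exact/measurable_funTS/measurable_funeneg.
  + by move=> x _; exact: funeneg_ge0.
  by rewrite e; apply: eq_integral => x _; rewrite ?funeposE ?funenegE.
Qed.

(** Averages over intervals of length 1 / (n + 1); each averaging gains one order
    of differentiability. *)
Definition average s (n : nat) : R -> R := fun x =>
  n.+1%:R * (prim s (x + n.+1%:R^-1) - prim s x).

Section Average.
Variables (s : R -> R) (K : R).
Hypotheses (ms : measurable_fun setT s) (sK : forall x, `|s x| <= K)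
  (ps : periodic s 1).

Lemma average_le n x : `|average s n x| <= K.
Proof.
rewrite /average normrM ger0_norm// mulrC -ler_pdivlMr ?ltr0n//.
apply: le_trans (prim_lip ms sK _ _) _.
by rewrite addrAC subrr add0r ger0_norm ?invr_ge0.
Qed.

Lemma average_continuous n : continuous (average s n).
Proof.
have cp : continuous (prim s) := lip_continuous (prim_lip ms sK).
apply: contZ; apply: contB => //; apply: cont_comp => //.
by apply: contD; [move=> x; exact: cvg_id | exact: cont_cst].
Qed.

Lemma average_periodic n : periodic (average s n) 1.
Proof.
move=> x; rewrite /average; congr (_ * _).
have le (y : R) : y <= y + n.+1%:R^-1 by rewrite lerDl invr_ge0.
rewrite !(primB ms sK)// addrAC Rintegral_shift//.
by apply: eq_Rintegral => y _; exact: ps.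
Qed.

Lemma average_deriv n : continuous s ->
  has_deriv (average s n) (fun x => n.+1%:R * (s (x + n.+1%:R^-1) - s x)).
Proof.
move=> cs; have hp := prim_deriv ms sK cs.
apply: has_deriv_eq (has_derivZ n.+1%:R
  (has_derivB (has_deriv_comp hp (has_deriv_shift n.+1%:R^-1)) hp)) _ => x.
by rewrite mulr1.
Qed.

Lemma average_cvg x : is_derive x (1 : R) (prim s) (s x) ->
  average s ^~ x @ \oo --> s x.
Proof.
move=> /is_derive1_caratheodory [q [qE cq <-]].
have -> : average s ^~ x = (fun n => q (x + n.+1%:R^-1)).
  apply/funext => n; rewrite /average qE addrAC subrr add0r mulrCA mulfV ?mulr1//.
have h : (fun n => x + n.+1%:R^-1) @ \oo --> x.
  rewrite -[X in _ --> X]addr0; apply: cvgD; first exact: cvg_cst.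
  exact: cvg_harmonic.
exact: (continuous_cvg _ cq h).
Qed.

End Average.

Lemma cint_cvg w (u : nat -> R -> R) (s : R -> R) : inL1 w ->
  (forall n, measurable_fun setT (u n)) -> measurable_fun setT s ->
  (forall n x, `|u n x| <= 1) ->
  {ae mu, forall x : R, `[0, 1]%classic x -> u ^~ x @ \oo --> s x} ->
  (fun n => cint (fun x => w x * u n x)) @ \oo --> cint (fun x => w x * s x).
Proof.
move=> Iw mun msz u1 us; have mw := inL1_measurable Iw.
have [_ In] := inL1_norm Iw.
have mwu n : measurable_fun setT (fun x => w x * u n x) by exact: measurable_funM.
have mws : measurable_fun setT (fun x => w x * s x) by exact: measurable_funM.
have mEu n : measurable_fun setT (fun x => (w x * u n x)%:E) by exact/measurable_EFinP.
have mEs : measurable_fun setT (fun x => (w x * s x)%:E) by exact/measurable_EFinP.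
have [] := @dominated_convergence _ _ R mu `[0, 1]%classic (measurable_itv _)
  (fun n x => (w x * u n x)%:E) (fun x => (w x * s x)%:E) (EFin \o (fun x => `|w x|)).
- by move=> n; exact: (measurable_funTS (mEu n)).
- exact: (measurable_funTS mEs).
- apply: aeS us => x h xI; apply: cvg_EFin; first by apply: nearW => n.
  by apply: cvgM; [exact: cvg_cst|exact: h].
- exact: In.
- apply: aeW => x n _; rewrite /= lee_fin normrM ler_piMr//.
move=> Is _ cv; rewrite /cint /Rintegral.
apply: fine_cvg; rewrite fineK//.
by apply: integrable_fin_num.
Qed.

(** The norm of L^1 is a supremum over C^1 test functions: the sign of w
    becomes C^1 after two averagings, and the averages converge almost
    everywhere by Lebesgue differentiation. *)
Lemma l1_duality w (K : R) : inL1 w ->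
  (forall phi phi1 : R -> R, has_deriv phi phi1 -> continuous phi1 ->
    periodic phi 1 -> (forall x, `|phi x| <= 1) ->
    cint (fun x => w x * phi x) <= K) ->
  l1 w <= K.
Proof.
move=> Iw h1; have mw := inL1_measurable Iw.
have h2 s : continuous s -> periodic s 1 -> (forall x, `|s x| <= 1) ->
    cint (fun x => w x * s x) <= K.
  move=> cs ps s1; have ms := continuous_measurable_fun cs.
  have cv : (fun n => cint (fun x => w x * average s n x)) @ \oo -->
      cint (fun x => w x * s x).
    apply: cint_cvg => //.
    - by move=> n; apply: continuous_measurable_fun; exact: (average_continuous ms s1).
    - by move=> n x; exact: (average_le ms s1).
    - by apply: aeW => x _; apply: average_cvg; exact: (prim_deriv ms s1 cs).
  apply: (cvgr_to_le cv); apply: nearW => n.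
  apply: h1 (average_deriv ms s1 n cs) _ (average_periodic ms s1 ps n)
    (average_le ms s1 n).
  apply: contZ; apply: contB => //; apply: cont_comp => //.
  by apply: contD; [move=> x; exact: cvg_id | exact: cont_cst].
pose s x : R := if 0 <= w x then 1 else -1.
have s1 x : `|s x| <= 1 by rewrite /s; case: ifP; rewrite ?normrN normr1.
have ms : measurable_fun setT s.
  apply: measurable_fun_ifT => //.
  exact: (measurable_fun_ler (measurable_cst _) mw).
have ps : periodic s 1 by move=> x; rewrite /s; case: Iw => -> _.
have -> : l1 w = cint (fun x => w x * s x).
  congr cint; apply/funext => x; rewrite /s; case: ifPn => w0.
    by rewrite mulr1 ger0_norm.
  by rewrite mulrN1 ltr0_norm// ltNge.
have cv : (fun n => cint (fun x => w x * average s n x)) @ \oo -->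
    cint (fun x => w x * s x).
  apply: cint_cvg => //.
  - by move=> n; apply: continuous_measurable_fun; exact: (average_continuous ms s1).
  - by move=> n x; exact: (average_le ms s1).
  - apply: aeS (prim_deriv_ae ms s1) => x h xI; apply: average_cvg; apply: h.
    by move: xI; rewrite /= in_itv/= => /andP[x0 _]; lra.
apply: (cvgr_to_le cv); apply: nearW => n.
apply: h2; first exact: (average_continuous ms s1).
  exact: (average_periodic ms s1 ps).
exact: (average_le ms s1).
Qed.

Lemma periodic_primitive s : continuous s -> periodic s 1 -> cint s = 0 ->
  exists P, [/\ has_deriv P s, periodic P 1 & cint P = 0].
Proof.
move=> cs ps s0; have [K _ sK] := periodic_bounded cs ps.
have ms := continuous_measurable_fun cs.
have hp := prim_deriv ms sK cs.
have pp : periodic (prim s) 1.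
  move=> x; apply/eqP; rewrite -subr_eq0 (periodic_increment hp ps).
  by rewrite (primB ms sK ler01) [X in X == 0]s0.
have Ip := inL1_continuous (has_deriv_continuous hp) pp.
exists (fun x => prim s x - cint (prim s)); split.
- apply: has_deriv_eq (has_derivB hp (has_deriv_cst _)) _ => x.
  by rewrite subr0.
- by move=> x; rewrite pp.
- by rewrite cintB ?cint_cst ?subrr//; exact: inL1_cst.
Qed.

Lemma cint_deriv f f1 : has_deriv f f1 -> continuous f1 -> periodic f 1 ->
  cint f1 = 0.
Proof.
move=> hf cf1 pf; rewrite /cint /Rintegral (@continuous_FTC2 R f1 f) //.
- by rewrite -EFinB/= -[1]add0r pf subrr.
- exact: continuous_subspaceT.
- have cf := has_deriv_continuous hf; split.
  + by move=> x _; case: (hf x).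
  + exact/cvg_at_right_filter/cf.
  + exact/cvg_at_left_filter/cf.
- by move=> x _; rewrite (has_derivE hf).
Qed.

Lemma cint_by_parts f f1 g g1 : has_deriv f f1 -> continuous f1 -> periodic f 1 ->
  has_deriv g g1 -> continuous g1 -> periodic g 1 ->
  cint (fun x => f x * g1 x) = - cint (fun x => f1 x * g x).
Proof.
move=> hf cf1 pf hg cg1 pg.
have cf := has_deriv_continuous hf; have cg := has_deriv_continuous hg.
have pf1 := periodic_deriv hf pf; have pg1 := periodic_deriv hg pg.
have pfg : periodic (fun x => f x * g x) 1 by move=> x; rewrite pf pg.
have := cint_deriv (has_derivM hf hg) (contD (contM cf1 cg) (contM cf cg1)) pfg.
rewrite cintD; first by move=> /eqP; rewrite addrC addr_eq0 => /eqP.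
- by apply: inL1_continuous; [exact: contM|move=> x; rewrite pf1 pg].
- by apply: inL1_continuous; [exact: contM|move=> x; rewrite pf pg1].
Qed.

End Duality.

(** * Weak derivatives *)

Section WeakDerivatives.
Context {R : realType}.
Notation mu := (@lebesgue_measure R).
Implicit Types f g : R -> R.

Lemma weakP f g : is_weak_deriv f g <-> inL1 g /\
  forall phi phi1 : R -> R, has_deriv phi phi1 -> continuous phi1 -> periodic phi 1 ->
    cint (fun x => f x * phi1 x) = - cint (fun x => g x * phi x).
Proof.
split=> [[Ig h]|[Ig h]]; split => // phi.
  move=> phi1 hphi cphi1 pphi; rewrite -h//; last by apply/Ck1P; exists phi1.
  by rewrite (has_derivE hphi).
by move=> /Ck1P[phi1 hphi cphi1] pphi; rewrite (has_derivE hphi); exact: h.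
Qed.

Lemma weak_C1 f f1 : has_deriv f f1 -> continuous f1 -> periodic f 1 ->
  is_weak_deriv f f1.
Proof.
move=> hf cf1 pf; apply/weakP; split.
  exact: inL1_continuous cf1 (periodic_deriv hf pf).
by move=> phi phi1 hphi cphi1 pphi; exact: cint_by_parts.
Qed.

(** Test functions determine an integrable function, by duality. *)
Lemma weak_uniq f g g' : is_weak_deriv f g -> is_weak_deriv f g' ->
  l1 (fun x => g x - g' x) = 0.
Proof.
move=> /weakP[Ig hg] /weakP[Ig' hg']; apply/eqP; rewrite eq_le l1_ge0 andbT.
apply: l1_duality; first exact: inL1B.
move=> phi phi1 hphi cphi1 pphi _; have cphi := has_deriv_continuous hphi.
under [X in cint X]eq_fun do rewrite mulrBl.
rewrite cintB; [|exact: inL1Mc|exact: inL1Mc].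
have := hg _ _ hphi cphi1 pphi; rewrite (hg' _ _ hphi cphi1 pphi) => /oppr_inj ->.
by rewrite subrr.
Qed.

Lemma l1_eq f g : inL1 f -> inL1 g -> l1 (fun x => f x - g x) = 0 -> l1 f = l1 g.
Proof.
move=> If Ig fg; apply/eqP; rewrite eq_le; apply/andP; split.
  have := l1D (inL1B If Ig) Ig; under [X in l1 X <= _]eq_fun do rewrite subrK.
  by rewrite fg add0r.
have := l1B If (inL1B If Ig).
under [X in l1 X <= _]eq_fun do rewrite opprB addrC subrK.
by rewrite fg addr0.
Qed.

Lemma inL1M_ae f f' (phi : R -> R) : inL1 f -> inL1 f' -> continuous phi ->
  periodic phi 1 -> (\forall x \ae mu, f x = f' x) ->
  cint (fun x => f x * phi x) = cint (fun x => f' x * phi x).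
Proof.
move=> If If' cphi pphi ff'; apply: cint_ae_eq; try exact: inL1Mc.
by apply: aeS ff' => x ->.
Qed.

Lemma weak_ae f f' g g' : inL1 f -> inL1 f' -> inL1 g' ->
  (\forall x \ae mu, f x = f' x) -> (\forall x \ae mu, g x = g' x) ->
  is_weak_deriv f g -> is_weak_deriv f' g'.
Proof.
move=> If If' Ig' ff' gg' /weakP[Ig h]; apply/weakP; split => //.
move=> phi phi1 hphi cphi1 pphi; have cphi := has_deriv_continuous hphi.
rewrite -(inL1M_ae If If' cphi1 (periodic_deriv hphi pphi) ff').
by rewrite (h _ _ hphi)// (inL1M_ae Ig Ig' cphi pphi gg').
Qed.

Lemma weakB f f' g g' : inL1 f -> inL1 f' -> is_weak_deriv f g ->
  is_weak_deriv f' g' -> is_weak_deriv (fun x => f x - f' x) (fun x => g x - g' x).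
Proof.
move=> If If' /weakP[Ig h] /weakP[Ig' h']; apply/weakP; split; first exact: inL1B.
move=> phi phi1 hphi cphi1 pphi; have cphi := has_deriv_continuous hphi.
have pphi1 := periodic_deriv hphi pphi.
under [X in cint X]eq_fun do rewrite mulrBl.
under [X in - cint X]eq_fun do rewrite mulrBl.
rewrite !cintB; try exact: inL1Mc.
by rewrite (h _ _ hphi)// (h' _ _ hphi)// !opprB opprK addrC.
Qed.

Lemma weak_derivP f : inW11 f -> is_weak_deriv f (weak_deriv f).
Proof. by move=> [_ [g hg]]; exact: (xgetPex _ (ex_intro _ g hg)). Qed.

Lemma W11normE f g : inL1 f -> is_weak_deriv f g -> W11norm f = (l1 f + l1 g)%:E.
Proof.
move=> If hg; have Wf : inW11 f by split => //; exists g.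
have hw := weak_derivP Wf; have [Iw _] := hw; have [Ig _] := hg.
rewrite /W11norm asboolT// !L1normE// -EFinD; congr (_ + _)%:E.
exact: l1_eq (weak_uniq hw hg).
Qed.

Lemma W11norm_lty f : (W11norm f < +oo)%E -> inW11 f.
Proof. by rewrite /W11norm; case: asboolP. Qed.

(** The norm does not see null sets, so a C^1 representative bounds it. *)
Lemma W11norm_le F f f1 (a b : R) : inL1 F -> has_deriv f f1 -> continuous f1 ->
  periodic f 1 -> (\forall x \ae mu, f x = F x) -> (forall x, `|f x| <= a) ->
  (forall x, `|f1 x| <= b) -> (W11norm F <= (a + b)%:E)%E.
Proof.
move=> IF hf cf1 pf fF fa f1b; have hw := weak_C1 hf cf1 pf.
have If := inL1_continuous (has_deriv_continuous hf) pf; have [If1 _] := hw.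
have hF := weak_ae If IF If1 fF (aeT (fun=> erefl)) hw.
rewrite (W11normE IF hF) lee_fin; apply: lerD; last exact: l1_le.
rewrite -(l1_eq If IF (ae_eq_l1 If IF fF)); exact: l1_le.
Qed.

End WeakDerivatives.

Section WeakTransfer.
Context {R : realType}.
Notation mu := (@lebesgue_measure R).
Implicit Types f g v : R -> R.

Section OneMap.
Variables (d : nat) (lam K : R) (T T1 T2 : R -> R).
Hypothesis E : expanding d lam K T T1 T2.
Local Notation p := (invd T1).
Local Notation p1 := (invd1 T1 T2).
Local Notation L := (transfer T).

(** By duality: if phi is a test function, so is p (phi o T). *)
Lemma transfer_weak f g : inL1 f -> is_weak_deriv f g ->
  is_weak_deriv (L f) (L (fun x => g x * p x + f x * p1 x)).
Proof.
move=> If /weakP[Ig h]; apply/weakP.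
have Igp := inL1Mc Ig (p_continuous E) (p_periodic E).
have Ifp := inL1Mc If (p1_continuous E) (p1_periodic E).
have Is := inL1D Igp Ifp.
split; first exact: (transfer_inL1 E).
move=> phi phi1 hphi cphi1 pphi; have cphi := has_deriv_continuous hphi.
have pphi1 := periodic_deriv hphi pphi.
have cT := has_deriv_continuous (exp_d1 E).
rewrite !(cint_transferM E)//.
have Tz x : T (x + 1) = T x + d%:Z%:~R by rewrite (exp_lift E).
have pphiT : periodic (fun x => phi (T x)) 1 by move=> x; rewrite Tz periodicz.
have pphi1T : periodic (fun x => phi1 (T x)) 1 by move=> x; rewrite Tz periodicz.
have cphiT := cont_comp cphi cT; have cphi1T := cont_comp cphi1 cT.
have ht : has_deriv (fun x => p x * phi (T x)) (fun x => p1 x * phi (T x) + phi1 (T x)).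
  apply: has_deriv_eq (has_derivM (p_deriv E) (has_deriv_comp hphi (exp_d1 E))) _ => x.
  by rewrite /invd mulrCA mulVf ?mulr1// gt_eqF// (exp_T1_gt0 E).
have ct : continuous (fun x => p1 x * phi (T x) + phi1 (T x)).
  by apply: contD => //; apply: contM => //; exact: (p1_continuous E).
have pt : periodic (fun x => p x * phi (T x)) 1.
  by move=> x; rewrite (p_periodic E) pphiT.
have := h _ _ ht ct pt.
have -> : (fun x => f x * (p1 x * phi (T x) + phi1 (T x))) =
    (fun x => f x * p1 x * phi (T x) + f x * phi1 (T x)).
  by apply/funext => x; ring.
have -> : (fun x => g x * (p x * phi (T x))) = (fun x => g x * p x * phi (T x)).
  by apply/funext => x; ring.
have -> : (fun x => (g x * p x + f x * p1 x) * phi (T x)) =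
    (fun x => g x * p x * phi (T x) + f x * p1 x * phi (T x)).
  by apply/funext => x; ring.
rewrite !cintD; try exact: inL1Mc.
by lra.
Qed.

(** A Lasota-Yorke inequality in which the derivative is damped by 1 / lam. *)
Lemma l1_transfer_weak f g : inL1 f -> inL1 g ->
  l1 (L (fun x => g x * p x + f x * p1 x)) <= lam^-1 * l1 g + K * l1 f.
Proof.
move=> If Ig.
have Igp := inL1Mc Ig (p_continuous E) (p_periodic E).
have Ifp := inL1Mc If (p1_continuous E) (p1_periodic E).
apply: le_trans (l1_transfer E (inL1D Igp Ifp)) _.
apply: le_trans (l1D Igp Ifp) _.
rewrite /l1 -!cintZ; try exact: inL1_norm.
have le (u q : R -> R) (a : R) : inL1 u -> inL1 (fun x => u x * q x) ->
    (forall x, `|q x| <= a) ->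
    cint (fun x => `|u x * q x|) <= cint (fun x => a * `|u x|).
  move=> Iu Iuq qa; apply: le_cint => [||x]; first exact: inL1_norm.
    by apply: inL1Z; exact: inL1_norm.
  by rewrite normrM mulrC ler_wpM2r.
apply: lerD; apply: le => // x; last exact: (p1_le E).
by rewrite ger0_norm ?(ltW (p_gt0 E x))// (p_le E).
Qed.

Lemma W11norm_transfer f : inW11 f ->
  (W11norm (L f) <= (1 + K)%:E * W11norm f)%E.
Proof.
move=> [If [g hg]]; have [Ig _] := hg.
rewrite (W11normE If hg) (W11normE (transfer_inL1 E If) (transfer_weak If hg)).
rewrite -EFinM lee_fin; have h1 := l1_transfer E If.
have h2 := l1_transfer_weak If Ig; have K0 := exp_K_ge0 E.
have h3 : lam^-1 * l1 g <= 1 * l1 g.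
  by rewrite ler_wpM2r ?l1_ge0// ltW// (lamV_lt1 E).
have h4 : 0 <= K * l1 g by rewrite mulr_ge0 ?l1_ge0.
by rewrite mulrDl mulrDr mul1r; lra.
Qed.

End OneMap.

(** A function of mean zero with bounded slope is controlled in the sup norm by
    its L^2 norm: the cube of P grows at most like 6 times the integral of its
    square, and P is nonpositive somewhere. *)
Lemma cube_le_square (P q : R -> R) : has_deriv P q -> continuous q ->
  periodic P 1 -> cint P = 0 -> (forall x, `|q x| <= 2) ->
  forall x, P x ^+ 3 <= 6 * cint (fun y => P y ^+ 2).
Proof.
move=> hP cq pP P0 q2 x; have cP := has_deriv_continuous hP.
have cs : continuous (fun y => P y ^+ 2) by exact: contM.
have ps : periodic (fun y => P y ^+ 2) 1 by move=> y; rewrite pP.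
have [M _ sM] := periodic_bounded cs ps.
have ms := continuous_measurable_fun cs.
set Q := prim (fun y => P y ^+ 2); have hQ : has_deriv Q _ := prim_deriv ms sM cs.
have [y Py] : exists y, P y <= 0.
  apply: contrapT => /forallNP h.
  have P_gt0 y : 0 < P y by rewrite ltNge; exact/negP.
  have [c hc] : exists c, forall x, P c <= P x.
    have [c _ hc] := @EVT_min R P 0 1 ler01 (continuous_subspaceT cP).
    exists c; apply: (@periodic_ind _ (fun y => P c <= y)) => // z /andP[z0 z1].
    by apply: hc; rewrite in_itv/= z0 ltW.
  have := P_gt0 c; rewrite ltNge -P0 -[X in X <= _]cint_cst.
  by rewrite le_cint//; [exact: inL1_cst|exact: inL1_continuous].
pose z := y + (Num.floor (x - y))%:~R.
have Pz : P z <= 0 by rewrite /z periodicz.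
have /andP[zx xz] : 0 <= x - z < 1 by rewrite /z opprD addrA frac_itv.
rewrite subr_ge0 in zx.
have hG : has_deriv (fun t => 6 * Q t - P t * (P t * P t))
    (fun t => 6 * P t ^+ 2 - (q t * (P t * P t) + P t * (q t * P t + P t * q t))).
  exact: has_derivB (has_derivZ 6 hQ) (has_derivM hP (has_derivM hP hP)).
have [t _ Gt] := mvt z x hG.
have G0 : 0 <= 6 * P t ^+ 2 - (q t * (P t * P t) + P t * (q t * P t + P t * q t)).
  have -> : 6 * P t ^+ 2 - (q t * (P t * P t) + P t * (q t * P t + P t * q t)) =
    3 * (2 - q t) * P t ^+ 2 by ring.
  by rewrite mulr_ge0 ?sqr_ge0// mulr_ge0// subr_ge0 (le_trans (ler_norm _) (q2 t)).
have h1 : P x ^+ 3 <= P z ^+ 3 + 6 * (Q x - Q z).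
  have := mulr_ge0 G0 (_ : 0 <= x - z); rewrite subr_ge0 -Gt => /(_ zx).
  have -> : P x ^+ 3 = P x * (P x * P x) by ring.
  have -> : P z ^+ 3 = P z * (P z * P z) by ring.
  by lra.
apply: le_trans h1 _.
have h2 : P z ^+ 3 <= 0 by rewrite exprS mulr_le0_ge0// sqr_ge0.
have h3 : Q x <= Q (z + 1).
  rewrite -subr_ge0; have [u _ ->] := mvt x (z + 1) hQ.
  by rewrite mulr_ge0 ?sqr_ge0// subr_ge0; move: xz; lra.
have h4 : Q (z + 1) - Q z = cint (fun y => P y ^+ 2).
  by rewrite (periodic_increment hQ ps) /Q (primB ms sM ler01).
by move: h2 h3 h4; lra.
Qed.

End WeakTransfer.

(** * Loss of memory in Sobolev norm *)

Section W11Decay.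
Context {R : realType}.
Notation mu := (@lebesgue_measure R).
Implicit Types f g v : R -> R.

Fixpoint flow (T : int -> R -> R) (m : int) (k : nat) (x : R) : R :=
  if k is k'.+1 then T (m + k'%:Z) (flow T m k' x) else x.

Section Family.
Variables (d : nat) (lam K : R) (T T1 T2 : int -> R -> R).
Hypothesis E : forall n, expanding d lam K (T n) (T1 n) (T2 n).
Local Notation L := (fun n => transfer (T n)).

Lemma flow_continuous m k : continuous (flow T m k).
Proof.
elim: k => [|k ih]; first by move=> x; exact: cvg_id.
exact: cont_comp (has_deriv_continuous (exp_d1 (E _))) ih.
Qed.

Lemma periodic_comp_lift n (phi : R -> R) : periodic phi 1 ->
  periodic (fun x => phi (T n x)) 1.
Proof.
move=> pphi x; rewrite (exp_lift (E n)).
by have := periodicz pphi (T n x) d%:Z => ->.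
Qed.

Lemma periodic_comp_flow m k (phi : R -> R) : periodic phi 1 ->
  periodic (fun x => phi (flow T m k x)) 1.
Proof.
elim: k phi => [//|k ih] phi pphi.
exact: (ih (fun x => phi (T (m + k%:Z) x)) (periodic_comp_lift _ pphi)).
Qed.

Lemma cint_cocycleM m k v (phi : R -> R) : inL1 v -> continuous phi -> periodic phi 1 ->
  cint (fun x => cocycle L m k v x * phi x) = cint (fun x => v x * phi (flow T m k x)).
Proof.
move=> Iv; elim: k phi => [//|k ih] phi cphi pphi /=.
rewrite (cint_transferM (E _) (cocycle_inL1 E _ _ Iv))//.
apply: (ih (fun x => phi (T (m + k%:Z) x))).
  exact: cont_comp cphi (has_deriv_continuous (exp_d1 (E _))).
exact: periodic_comp_lift.
Qed.

End Family.

(** The transported observable equidistributes: its fluctuation is the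
    derivative of a uniformly small function P. If P' is the fluctuation and
    F' = P, then the integral of P^2 is minus that of the fluctuation times F,
    which the decay of the Lipschitz function F makes small. *)
Lemma flow_equidistribution (lam K : R) : 1 < lam -> 0 <= K ->
  exists2 C, 0 <= C & forall d T T1 T2,
  (forall n, expanding d lam K (T n) (T1 n) (T2 n)) ->
  forall m k (phi : R -> R), continuous phi -> periodic phi 1 ->
  (forall x, `|phi x| <= 1) ->
  exists P, [/\ has_deriv P (fun x => phi (flow T m k x) -
      cint (fun y => phi (flow T m k y))), periodic P 1 &
    forall x, `|P x| <= C * decay_rate lam K ^+ k].
Proof.
move=> lam1 K0; set c := cone_param lam K; set th := cone_rate lam K.
have c0 : 0 < c by exact: cone_param_gt0.
have /andP[th0 th1] : 0 < th < 1 by exact: cone_rate_itv.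
have /andP[sth0 sthr] := sqrt_cone_rate_le lam1 K0.
set C0 := expR c * (1 + c^-1).
have C00 : 0 <= C0.
  by apply: mulr_ge0; rewrite ?expR_ge0// addr_ge0// invr_ge0 ltW.
exists (Num.sqrt (6 * C0)) => [|d T T1 T2 E m k phi cphi pphi phi1]; first exact: sqrtr_ge0.
set psi := fun x => phi (flow T m k x).
have cpsi : continuous psi := cont_comp cphi (@flow_continuous _ _ _ _ _ _ E m _).
have ppsi : periodic psi 1 by exact: (periodic_comp_flow E).
have Ipsi := inL1_continuous cpsi ppsi.
have psi1 x : `|psi x| <= 1 by exact: phi1.
set a := cint psi.
have a1 : `|a| <= 1 by exact: le_trans (le_cint_l1 Ipsi) (l1_le Ipsi psi1).
set q := fun x => psi x - a.
have cq : continuous q by apply: contB => //; exact: cont_cst.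
have pq : periodic q 1 by move=> x; rewrite /q ppsi.
have q0 : cint q = 0 by rewrite cintB ?cint_cst ?subrr//; exact: inL1_cst.
have q2 x : `|q x| <= 2.
  by apply: le_trans (ler_normB _ _) _; have := psi1 x; move: a1; lra.
have [P [hP pP P0]] := periodic_primitive cq pq q0.
have cP := has_deriv_continuous hP.
have [F [hF pF F0]] := periodic_primitive cP pP P0.
exists P; split => // x.
have [y hy] := periodic_max cP pP.
set M := `|P y| in hy.
have IF := inL1_continuous (has_deriv_continuous hF) pF.
have h1 : cint (fun x => P x ^+ 2) <= C0 * M * th ^+ k.
  have -> : cint (fun x => P x ^+ 2) = - cint (fun x => q x * F x).
    rewrite -(cint_by_parts hP cq pP hF cP pF).
    by congr cint; apply/funext => z; rewrite expr2.
  have -> : cint (fun x => q x * F x) = cint (fun x => F x * psi x).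
    rewrite -[RHS]subr0 -(mulr0 a) -F0 -cintZ// -cintB; last 2 first.
    - exact: inL1Mc.
    - exact: inL1Z.
    by congr cint; apply/funext => z; rewrite /q; ring.
  rewrite -(cint_cocycleM E m k IF cphi pphi).
  set u := cocycle _ _ _ _; have Iu : inL1 u by exact: (cocycle_inL1 E).
  apply: le_trans (ler_norm _) _; rewrite normrN.
  apply: le_trans (cintM_le Iu (continuous_measurable_fun cphi) pphi phi1) _.
  rewrite mul1r; apply: l1_le => // z.
  exact: (lip_decay E k m IF F0 (deriv_lip hF hy) z).
have h3 : M ^+ 3 <= 6 * cint (fun x => P x ^+ 2).
  rewrite /M; have [Py|Py] := ger0P (P y); first exact: (cube_le_square hP cq).
  have hN := has_derivN hP; have cN := contN cq.
  have pN : periodic (fun x => - P x) 1 by move=> z; rewrite pP.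
  have N0 : cint (fun x => - P x) = 0 by rewrite cintN ?P0 ?oppr0//; exact: inL1_continuous.
  have N2 z : `|- q z| <= 2 by rewrite normrN.
  have := cube_le_square hN cN pN N0 N2 y.
  by under [X in _ <= 6 * cint X]eq_fun do rewrite sqrrN.
have M0 : 0 <= M by exact: normr_ge0.
apply: le_trans (hy x) _; rewrite -/M.
have h2 : M ^+ 2 <= 6 * C0 * th ^+ k.
  have [->|Mn0] := eqVneq M 0.
    by rewrite expr0n/= mulr_ge0 ?exprn_ge0 ?(ltW th0)// mulr_ge0.
  have Mp : 0 < M by rewrite lt_neqAle eq_sym Mn0.
  rewrite -(ler_pM2l Mp) -exprS; apply: le_trans h3 _.
  have -> : M * (6 * C0 * th ^+ k) = 6 * (C0 * M * th ^+ k) by ring.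
  by rewrite ler_wpM2l.
rewrite -[leLHS](ger0_norm M0) -sqrtr_sqr.
apply: (@le_trans _ _ (Num.sqrt (6 * C0 * th ^+ k))).
  by rewrite ler_wsqrtr.
have C60 : 0 <= 6 * C0 by exact: mulr_ge0.
rewrite (sqrtrM _ C60); apply: ler_wpM2l; first exact: sqrtr_ge0.
have -> : Num.sqrt (th ^+ k) = Num.sqrt th ^+ k.
  have thE : th = Num.sqrt th ^+ 2 by rewrite sqr_sqrtr// ltW.
  by rewrite {1}thE exprAC sqrtr_sqr ger0_norm// exprn_ge0.
by apply: lerXn2r; rewrite ?nnegrE// (le_trans sth0).
Qed.

(** For the L^1 norm, the transport is moved to the test function, whose
    fluctuation is the derivative of a small function, and v is integrated by
    parts. The derivative then decays by the Lasota-Yorke inequality. *)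
Lemma W11_decay (lam K : R) : 1 < lam -> 0 <= K -> exists2 C, 0 <= C &
  forall d T T1 T2, (forall n, expanding d lam K (T n) (T1 n) (T2 n)) ->
  forall m k v, inW110 v ->
  inW110 (cocycle (fun n => transfer (T n)) m k v) /\
  (W11norm (cocycle (fun n => transfer (T n)) m k v)
    <= (C * decay_rate lam K ^+ k)%:E * W11norm v)%E.
Proof.
move=> lam1 K0; have [C C0 hC] := flow_equidistribution lam1 K0.
have /andP[r0 r1] := decay_rate_itv lam1 K0.
have /andP[s0 sr] := invlam_lt_rate lam1 K0.
move: hC r0 r1 sr; set rho := decay_rate lam K => hC r0 r1 sr.
have rs : 0 < rho - lam^-1 by rewrite subr_gt0.
set D := 1 + K * C / (rho - lam^-1).
have D1 : 0 <= K * C / (rho - lam^-1) by rewrite divr_ge0 ?(ltW rs)// mulr_ge0.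
have D0 : 0 <= D by rewrite addr_ge0.
exists (C + D) => [|d T T1 T2 E m k v [[Iv [g hg]] v0]]; first exact: addr_ge0.
have [Ig _] := hg.
set L := fun n => transfer (T n).
have Ivk j : inL1 (cocycle L m j v) by exact: (cocycle_inL1 E).
have h0 j : l1 (cocycle L m j v) <= C * rho ^+ j * l1 g.
  apply: l1_duality => // phi phi1 hphi cphi1 pphi phiB.
  have cphi := has_deriv_continuous hphi.
  rewrite (cint_cocycleM E)//.
  have [P [hP pP PC]] := hC d T T1 T2 E m j phi cphi pphi phiB.
  set psi := fun x => phi (flow T m j x).
  have cpsi : continuous psi := cont_comp cphi (@flow_continuous _ _ _ _ _ _ E m _).
  have ppsi : periodic psi 1 by exact: (periodic_comp_flow E).
  have cq : continuous (fun x => psi x - cint psi).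
    by apply: contB => //; exact: cont_cst.
  have /weakP[_ hw] := hg.
  have -> : cint (fun x => v x * phi (flow T m j x)) =
      cint (fun x => v x * (psi x - cint psi)).
    under [X in _ = cint X]eq_fun do rewrite mulrBr.
    rewrite cintB; [|exact: inL1Mc|]; last first.
      by apply: inL1Mc => //; exact: cont_cst.
    under [X in _ = _ - cint X]eq_fun do rewrite mulrC.
    by rewrite cintZ// v0 mulr0 subr0.
  rewrite (hw _ _ hP cq pP); apply: le_trans (ler_norm _) _; rewrite normrN.
  apply: cintM_le => //.
  exact: continuous_measurable_fun (has_deriv_continuous hP).
have h1 j : exists gj, is_weak_deriv (cocycle L m j v) gj /\
    l1 gj <= D * rho ^+ j * l1 g.
  suff h : exists gj, is_weak_deriv (cocycle L m j v) gj /\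
      l1 gj <= (D * rho ^+ j) * l1 g by [].
  elim: j => [|j [gj [hgj gjD]]].
    by exists g; split => //=; rewrite expr0 mulr1 /D ler_peMl ?l1_ge0// lerDl.
  have [Igj _] := hgj.
  eexists; split; first exact: (transfer_weak (E _) (Ivk j) hgj).
  apply: le_trans (l1_transfer_weak (E _) (Ivk j) Igj) _.
  apply: (@le_trans _ _ (lam^-1 * (D * rho ^+ j * l1 g) + K * (C * rho ^+ j * l1 g))).
    by apply: lerD; rewrite ler_wpM2l.
  have -> : lam^-1 * (D * rho ^+ j * l1 g) + K * (C * rho ^+ j * l1 g) =
    (lam^-1 * D + K * C) * (rho ^+ j * l1 g) by ring.
  have -> : D * rho ^+ j.+1 * l1 g = rho * D * (rho ^+ j * l1 g).
    by rewrite exprS; ring.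
  rewrite ler_wpM2r ?mulr_ge0 ?l1_ge0 ?exprn_ge0 ?(ltW r0)//.
  have : (rho - lam^-1) * D = (rho - lam^-1) + K * C.
    by rewrite /D mulrDr mulr1 mulrCA mulfV ?mulr1// gt_eqF.
  by move: rs; lra.
have [gk [hgk gkD]] := h1 k.
split; first by split; [split => //; exists gk|rewrite (cint_cocycle E)].
rewrite (W11normE Iv hg) (W11normE (Ivk k) hgk) -EFinM lee_fin.
rewrite mulrDr; have := h0 k; have rk := exprn_ge0 k (ltW r0).
have : 0 <= (C + D) * rho ^+ k * l1 v by rewrite !mulr_ge0 ?l1_ge0// addr_ge0.
by move: gkD; rewrite [(C + D) * _]mulrDl [X in _ <= _ + X]mulrDl; lra.
Qed.

(** Perturbing T by h changes the transfer operator by little, from W^{1,1}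
    to L^1: against a test function psi with primitive q the change is, up to the
    defect of h1 from 1, the integral of u times the derivative of q o h - q,
    where q o h - q is as small as the displacement of h. *)
Lemma transfer_comp_near d (lam K lam' K' d0 d1 : R) T T1 T2 h h1 H1 H2 v g :
  expanding d lam K T T1 T2 -> expanding d lam' K' (h \o T) H1 H2 ->
  has_deriv h h1 -> continuous h1 -> (forall x, h (x + 1) = h x + 1) ->
  (forall x, `|h x - x| <= d0) -> (forall x, `|h1 x - 1| <= d1) ->
  inL1 v -> is_weak_deriv (transfer T v) g ->
  l1 (fun x => transfer (h \o T) v x - transfer T v x) <=
    d0 * l1 g + d1 * l1 (transfer T v).
Proof.
move=> E E' hh ch1 h_lift hd0 hd1 Iv hg; set u := transfer T v.
have Iu : inL1 u by exact: (transfer_inL1 E).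
have Iu' := transfer_inL1 E' Iv.
have [Ig _] := hg; have /weakP[_ hw] := hg.
apply: l1_duality; first exact: inL1B.
move=> psi psi1 hpsi cpsi1 ppsi psiB; have cpsi := has_deriv_continuous hpsi.
have ch := has_deriv_continuous hh.
have ppsih : periodic (fun x => psi (h x)) 1 by move=> x; rewrite h_lift ppsi.
have cpsih := cont_comp cpsi ch.
have mpsi := continuous_measurable_fun cpsi.
have hq := prim_deriv mpsi psiB cpsi.
set q := prim psi in hq.
have qc x : q (x + 1) = q x + (q 1 - q 0).
  by rewrite -(periodic_increment hq ppsi x) [RHS]addrC subrK.
have hTh := has_derivB (has_deriv_comp hq hh) hq.
have pTh : periodic (fun x => q (h x) - q x) 1.
  by move=> x; rewrite h_lift !qc; move: (q 1 - q 0) (q (h x)) (q x) => a b c; ring.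
have cTh : continuous (fun x => psi (h x) * h1 x - psi x) by exact: contB (contM cpsih ch1) cpsi.
have ph1 : periodic h1 1 := lift_deriv_periodic (d := 1) h_lift hh.
under [X in cint X]eq_fun do rewrite mulrBl.
rewrite cintB; [|exact: inL1Mc|exact: inL1Mc].
rewrite (cint_transferM E')//.
have <- : cint (fun x => u x * psi (h x)) = cint (fun x => v x * psi ((h \o T) x)).
  exact: (cint_transferM E Iv cpsih ppsih).
have pTh1 : periodic (fun x => psi (h x) * h1 x - psi x) 1.
  by move=> x; rewrite ppsih ph1 ppsi.
have c1h : continuous (fun x => psi (h x) * (1 - h1 x)).
  by apply: contM => //; apply: contB => //; exact: cont_cst.
have p1h : periodic (fun x => psi (h x) * (1 - h1 x)) 1.
  by move=> x; rewrite ppsih ph1.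
have -> : cint (fun x => u x * psi (h x)) - cint (fun x => u x * psi x) =
    cint (fun x => u x * (psi (h x) * h1 x - psi x)) +
    cint (fun x => u x * (psi (h x) * (1 - h1 x))).
  rewrite -cintB; [|exact: inL1Mc|exact: inL1Mc].
  rewrite -cintD; [|exact: inL1Mc|exact: inL1Mc].
  by congr cint; apply/funext => x; ring.
rewrite (hw _ _ hTh cTh pTh); apply: lerD.
  apply: le_trans (ler_norm _) _; rewrite normrN; apply: cintM_le => //.
    by apply: continuous_measurable_fun; exact: has_deriv_continuous hTh.
  move=> x; apply: le_trans (prim_lip mpsi psiB _ _) _.
  by rewrite mul1r.
apply: le_trans (ler_norm _) _; apply: cintM_le => //.
  exact: continuous_measurable_fun.
move=> x; rewrite normrM -[d1]mul1r; apply: ler_pM => //.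
by rewrite distrC.
Qed.

End W11Decay.

(** * Equivariant densities *)

Section EquivariantDensity.
Context {R : realType}.
Implicit Types f g : R -> R.

Section Family.
Variables (d : nat) (lam K : R) (T T1 T2 : int -> R -> R).
Hypothesis E : forall n, expanding d lam K (T n) (T1 n) (T2 n).
Local Notation L := (fun n => transfer (T n)).
Local Notation c := (cone_param lam K).

Definition unit_source (n : int) : R -> R := fun x => transfer (T n) (fun=> 1) x - 1.

(** The limit of the transfers of the constant 1 from the distant past, written as
    a telescoping sum, to which the results on sums over the past apply. *)
Definition equivariant_density (n : int) : R -> R :=
  fun x => 1 + response_sum L unit_source n x.

Lemma transfer_sup n f (A : R) : periodic f 1 -> (forall x, `|f x| <= A) ->
  forall x, `|L n f x| <= A * expR c.
Proof. by move=> pf fA x; have := cocycle_sup E n 1 pf fA x; rewrite /= addr0. Qed.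

Let p1 : periodic (fun _ : R => 1 : R) 1. Proof. by []. Qed.

Lemma unit_source_periodic n : periodic (unit_source n) 1.
Proof. by move=> x; rewrite /unit_source transfer_periodic. Qed.

Lemma unit_source_cint n : cint (unit_source n) = 0.
Proof.
have I1 := inL1_cst (1 : R).
rewrite cintB ?(cint_transfer (E n))// ?cint_cst ?subrr//.
exact: (transfer_inL1 (E n)).
Qed.

Lemma unit_source_deriv n :
  has_deriv (unit_source n) (L n (invd1 (T1 n) (T2 n))).
Proof.
have := has_derivB (transfer_deriv (E n) (has_deriv_cst 1) p1) (has_deriv_cst 1).
move=> /has_deriv_eq; apply => x; rewrite subr0.
by congr (transfer _ _ x); apply/funext => y; rewrite mulr0 add0r mulr1.
Qed.

Lemma unit_source_deriv_le n x : `|L n (invd1 (T1 n) (T2 n)) x| <= K * expR c.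
Proof. by apply: transfer_sup; [exact: (p1_periodic (E n))|exact: (p1_le (E n))]. Qed.

Lemma unit_source_deriv_continuous n : continuous (L n (invd1 (T1 n) (T2 n))).
Proof.
apply: (transfer_continuous (E n)); [exact: (p1_continuous (E n))|].
exact: (p1_periodic (E n)).
Qed.

Lemma unit_source_sum N n x :
  \sum_(k < N) response_term L unit_source n k x = cocycle L (n - N%:Z) N (fun=> 1) x - 1.
Proof.
elim: N => [|N ih]; first by rewrite big_ord0 subrr.
rewrite big_ord_recr/= ih /response_term.
have e : n - N.+1%:Z + 1 = n - N%:Z by rewrite -addn1 PoszD; ring.
rewrite -[transfer _ _ x]/(cocycle L (n - N.+1%:Z) N.+1 (fun=> 1) x) cocycle_first e.
have -> : n - N%:Z - 1 = n - N.+1%:Z by rewrite -addn1 PoszD; ring.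
rewrite /unit_source (cocycleB E)//; last exact: transfer_periodic.
by ring.
Qed.

End Family.

(** Positivity passes to the limit from the transfers of 1. As in
    response_sum_C1 the bound is chosen before the maps. *)
Lemma equivariant_density_spec (lam K : R) : 1 < lam -> 0 <= K ->
  exists2 C, 0 <= C & forall d T T1 T2,
  (forall n, expanding d lam K (T n) (T1 n) (T2 n)) ->
  let mu := equivariant_density T in
  [/\ forall n, periodic (mu n) 1, forall n x, 0 <= mu n x, forall n, cint (mu n) = 1,
    forall n x, mu (n + 1) x = transfer (T n) (mu n) x &
    exists mu1, forall n, [/\ has_deriv (mu n) (mu1 n), continuous (mu1 n) &
      forall x, `|mu n x| <= C /\ `|mu1 n x| <= C]].
Proof.
move=> lam1 K0; have [C C0 hC] := response_sum_C1 lam1 K0.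
set A := K * expR (cone_param lam K).
have A0 : 0 <= A by rewrite mulr_ge0// expR_ge0.
have r01 := decay_rate_itvW lam1 K0.
exists (1 + C * A) => [|d T T1 T2 E mu]; first by rewrite addr_ge0// mulr_ge0.
have ps := unit_source_periodic T.
have s0 := unit_source_cint E.
have hs := unit_source_deriv E.
have cs1 := fun n => @unit_source_deriv_continuous d lam K T T1 T2 E n.
have s1A := unit_source_deriv_le E.
have [tG [sg1 [hsg csg sgC sg1C tails]]] := hC d T T1 T2 E _ _ A ps s0 hs cs1 s1A.
set L := fun n => transfer (T n) in tG hsg sgC tails.
have pI n : periodic (response_sum L (unit_source T) n) 1.
  exact: response_sum_periodic.
have cs n : continuous (unit_source T n) := has_deriv_continuous (hs n).
have csig n := has_deriv_continuous (hsg n).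
have Isg n := inL1_continuous (csig n) (pI n).
split.
- by move=> n x; rewrite /mu /equivariant_density pI.
- move=> n x; rewrite leNgt; apply/negP => mu0.
  have e0 : 0 < - mu n x by rewrite oppr_gt0.
  have [N hN] := geometric_small (C * A) r01 e0.
  have [t1 _ [_ ht]] := tails N n; have [{}ht _] := ht x.
  move: ht; rewrite (unit_source_sum E) => ht.
  have w0 : 0 <= cocycle L (n - N%:Z) N (fun=> 1) x.
    by have [] := cocycle1_cone E (n - N%:Z) N.
  move: ht; rewrite ler_norml => /andP[ht _].
  by move: hN ht w0; rewrite /mu /equivariant_density -/L; lra.
- move=> n; rewrite /mu /equivariant_density cintD//; last exact: inL1_cst.
  by rewrite cint_cst (response_sum_cint E r01 ps tG n cs s0) addr0.
- move=> n x; rewrite /mu /equivariant_density (response_sumS E r01 ps tG).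
  rewrite -/L [in RHS](_ : (fun x => _) = (fun x => (fun=> 1) x + response_sum L (unit_source T) n x))//.
  rewrite (transferD (E n))// /unit_source /L; ring.
- exists sg1 => n; split => //.
    apply: has_deriv_eq (has_derivD (has_deriv_cst 1) (hsg n)) _ => x.
    by rewrite add0r.
  move=> x; split.
    apply: le_trans (ler_normD _ _) _; rewrite normr1 lerD2l; exact: sgC.
  by apply: le_trans (sg1C n x) _; rewrite lerDr.
Qed.

Lemma jet_constants (P : R) : 1 <= P ->
  P <= 23 * P ^+ 3 /\ 5 * P ^+ 2 * 1 <= 23 * P ^+ 3.
Proof.
move=> P1; have P0 : 0 <= P := le_trans ler01 P1.
have PP : P <= P ^+ 3 by rewrite exprS ler_peMr// exprn_ege1.
have PP2 : P ^+ 2 <= P ^+ 3 by rewrite (exprS _ 2) ler_peMl// exprn_ge0.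
by move: PP PP2 (exprn_ge0 3 P0); lra.
Qed.

(** The derivatives of the source are those of a transfer of 1; one derivative of
    the map is spent on the weight, so C^4 maps have C^3 densities. *)
Lemma equivariant_density_C3 d (lam K : R) T T1 T2 T3 T4 :
  (forall n, expanding4 d lam K (T n) (T1 n) (T2 n) (T3 n) (T4 n)) ->
  let mu := equivariant_density T in
  exists C mu1 mu2 mu3,
  [/\ forall n, has_deriv (mu n) (mu1 n), forall n, has_deriv (mu1 n) (mu2 n),
    forall n, has_deriv (mu2 n) (mu3 n) & forall n x,
    [/\ `|mu n x| <= C, `|mu1 n x| <= C, `|mu2 n x| <= C & `|mu3 n x| <= C]].
Proof.
move=> F mu; have E n := exp4_exp (F n).
have p1 : periodic (fun _ : R => 1 : R) 1 by [].
have p0 : periodic (fun _ : R => 0 : R) 1 by [].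
have h0 := has_deriv_cst (1 : R); have h00 := has_deriv_cst (0 : R).
pose s := unit_source T.
pose j2 n := jet2 (invd (T1 n)) (invd1 (T1 n) (T2 n)) (invd2 (T1 n) (T2 n) (T3 n))
  (fun=> 1) (fun=> 0).
pose j3 n := jet3 (invd (T1 n)) (invd1 (T1 n) (T2 n)) (invd2 (T1 n) (T2 n) (T3 n))
  (invd3 (T1 n) (T2 n) (T3 n) (T4 n)) (fun=> 1) (fun=> 0) (fun=> 0).
pose s1 n := transfer (T n) (invd1 (T1 n) (T2 n)).
pose s2 n := transfer (T n) (j2 n).
pose s3 n := transfer (T n) (j3 n).
have hs1 n : has_deriv (s n) (s1 n) by exact: (unit_source_deriv E).
have s1E n : s1 n = transfer (T n) (fun x => invd (T1 n) x * 0 + invd1 (T1 n) (T2 n) x * 1).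
  by congr transfer; apply/funext => x; rewrite mulr0 add0r mulr1.
have s2E n : s2 n = transfer (T n) (fun x => invd (T1 n) x ^+ 2 * 0 + j2 n x).
  by congr transfer; apply/funext => x; rewrite mulr0 add0r.
have s3E n : s3 n = transfer (T n) (fun x => invd (T1 n) x ^+ 3 * 0 + j3 n x).
  by congr transfer; apply/funext => x; rewrite mulr0 add0r.
have hs2 n : has_deriv (s1 n) (s2 n).
  by rewrite s1E s2E; exact: (transfer_deriv2 (F n) p1 h0 h00).
have hs3 n : has_deriv (s2 n) (s3 n).
  by rewrite s2E s3E; exact: (transfer_deriv3 (F n) p1 h0 h00 h00).
set P := jet_bound K; have P1 : 1 <= P := jet_bound_ge1 (F 0).
have [PA P2A] := jet_constants P1.
set A := 23 * P ^+ 3 * expR (cone_param lam K).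
have ee := expR_ge0 (cone_param lam K).
have le1 : forall x : R, `|(fun=> 1) x : R| <= 1 by move=> x; rewrite normr1.
have le0 : forall x : R, `|(fun=> 0) x : R| <= 1 by move=> x; rewrite normr0.
have s1A n x : `|s1 n x| <= A.
  have h := transfer_sup E n (p1_periodic (E n)) (p1_le_jet (F n)) x.
  apply: le_trans h _.
  by rewrite ler_wpM2r.
have s2A n x : `|s2 n x| <= A.
  have b y : `|j2 n y| <= 5 * P ^+ 2 * 1 by exact: (jet2_le (F n) (le1 y) (le0 y)).
  have pj : periodic (j2 n) 1 by exact: (jet2_periodic (F n) p1 p0).
  have h := transfer_sup E n pj b x; apply: le_trans h _.
  by rewrite ler_wpM2r.
have s3A n x : `|s3 n x| <= A.
  have b y : `|j3 n y| <= 23 * P ^+ 3 * 1 by exact: (jet3_le (F n) (le1 y) (le0 y) (le0 y)).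
  have pj : periodic (j3 n) 1 by exact: (jet3_periodic (F n) p1 p0 p0).
  by have h := transfer_sup E n pj b x; apply: le_trans h _; rewrite mulr1.
have [C [sg1 [sg2 [sg3 [g1 g2 g3 gC]]]]] := response_sum_C3 F
  (unit_source_periodic T) (unit_source_cint E) hs1 hs2 hs3 s1A s2A s3A.
exists (1 + C), sg1, sg2, sg3; split => //.
  move=> n; apply: has_deriv_eq (has_derivD (has_deriv_cst 1) (g1 n)) _ => x.
  by rewrite add0r.
move=> n x; have [c0 c1 c2 c3] := gC n x.
have up z : z <= C -> z <= 1 + C by move=> h; apply: le_trans h _; rewrite lerDr.
split; [|exact: up..].
by apply: le_trans (ler_normD _ _) _; rewrite normr1 lerD2l.
Qed.

End EquivariantDensity.

(** * Uniform expansion near the reference map *)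

Section Hypotheses.
Context {R : realType}.
Implicit Types f g : R -> R.

Lemma Cnorm_ge k f j x : (j <= k)%N -> ((`|derive1n j f x|)%:E <= Cnorm k f)%E.
Proof.
move=> jk; rewrite /Cnorm.
apply: le_trans (le_bigmax _ _ (Ordinal (jk : (j < k.+1)%N))) => /=.
by apply: ereal_sup_ubound; exists x.
Qed.

Lemma has_deriv_linear (c : R) : has_deriv (fun x => c * x) (fun=> c).
Proof.
by apply: has_deriv_eq (has_derivZ c (@has_deriv_id R)) _ => x; rewrite mulr1.
Qed.

Lemma cvge0 (T : Type) (F : set_system T) (FF : Filter F) (X : T -> \bar R) :
  (forall x, 0 <= X x)%E ->
  (forall eta : R, 0 < eta -> \forall x \near F, (X x <= eta%:E)%E) ->
  X x @[x --> F] --> 0%E.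
Proof.
move=> X0 h A /= [e /= e0 eA].
have e2 : 0 < e / 2 by rewrite divr_gt0.
apply: filterS (h _ e2) => x Xx /=; have := X0 x.
case: (X x) Xx => [r|//|//]; rewrite !lee_fin => rle r0; apply: eA.
by rewrite /= sub0r normrN ger0_norm// (le_lt_trans rle)// ltr_pdivrMr// ltr_pMr// ltr1n.
Qed.

Lemma at_rightE (P : set R) :
  (\forall e \near 0^'+, P e) <-> exists2 a, 0 < a & forall e, 0 < e < a -> P e.
Proof.
split=> [[a /= a0 h]|[a a0 h]].
  exists a => // e /andP[e0 ea]; apply: h => //=.
  by rewrite sub0r normrN gtr0_norm.
exists a => //= e /=; rewrite sub0r normrN => ea e0; apply: h.
by move: ea; rewrite gtr0_norm// e0.
Qed.

(** By the mean value theorem T1 takes the positive value d; since it stays away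
    from 0 it cannot change sign. *)
Lemma deriv_ge d (lam : R) T T1 : 0 < lam -> (0 < d)%N -> is_lift d T ->
  has_deriv T T1 -> continuous T1 -> (forall x, lam <= `|T1 x|) ->
  forall x, lam <= T1 x.
Proof.
move=> lam0 d0 hT hT1 cT1 h x; have [z _] := mvt 0 1 hT1.
rewrite -[X in T X - _]add0r hT addrAC subrr add0r subr0 mulr1 => dz.
have z0 : 0 < T1 z by rewrite -dz ltr0n.
have [//|xlam] := leP lam (T1 x).
have x0 : T1 x <= 0.
  rewrite leNgt; apply/negP => x0; have := h x.
  by rewrite gtr0_norm// leNgt xlam.
have ivt a b : a <= b -> Num.min (T1 a) (T1 b) <= 0 <= Num.max (T1 a) (T1 b) -> False.
  move=> ab mM; have [|c _ c0] := @IVT R T1 a b 0 ab _ mM.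
    exact: continuous_subspaceT.
  by have := h c; rewrite c0 normr0 leNgt lam0.
exfalso; have [xz|zx] := leP x z.
  by apply: (ivt x z xz); rewrite ge_min x0 le_max (ltW z0) orbT.
by apply: (ivt z x (ltW zx)); rewrite ge_min x0 orbT le_max (ltW z0).
Qed.

(** Closeness to Ts in C^2 keeps the derivative above that of Ts minus delta in
    absolute value. *)
Lemma near_expanding4 d (Ts : R -> R) (delta K : R) T : (0 < d)%N -> Ck 4 Ts ->
  0 < delta < min_expansion Ts - 1 -> near_maps d Ts delta T -> Ck 4 T ->
  (Cnorm 4 (fun x => T x - d%:R * x)%R <= K%:E)%E ->
  expanding4 d (min_expansion Ts - delta) K T (derive1n 1 T) (derive1n 2 T)
    (derive1n 3 T) (derive1n 4 T) /\ forall x, `|derive1n 1 T x| <= d%:R + K.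
Proof.
move=> d0 Ts4 /andP[de0 de1] [lT _ _ nT] T4 TK.
have h0 := Ck_deriv T4 (isT : 0 < 4)%N.
have h1 := Ck_deriv T4 (isT : 1 < 4)%N.
have h2 := Ck_deriv T4 (isT : 2 < 4)%N.
have h3 := Ck_deriv T4 (isT : 3 < 4)%N.
have g1 : derive1 (fun x => T x - d%:R * x) = (fun x => derive1n 1 T x - d%:R).
  exact: (has_derivE (has_derivB h0 (has_deriv_linear _))).
have g2 : derive1 (fun x => derive1n 1 T x - d%:R) = derive1n 2 T.
  by rewrite (has_derivE (has_derivB h1 (has_deriv_cst _))); apply/funext => x; rewrite subr0.
have bd j x : (j.+1 < 4)%N -> `|derive1n j.+2 T x| <= K.
  move=> j3; rewrite -lee_fin; apply: le_trans TK.
  have := @Cnorm_ge 4 (fun x => T x - d%:R * x) j.+2 x j3.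
  by rewrite !derive1Sn g1 g2 -[derive1n 2 T]/(derive1 (derive1 T)).
have lam1 : 1 < min_expansion Ts - delta by move: de1; lra.
split; last first.
  move=> x; have := @Cnorm_ge 4 (fun x => T x - d%:R * x) 1 x isT.
  move=> /le_trans/(_ TK); rewrite derive1n1 g1 lee_fin => h.
  rewrite -[derive1n 1 T x](subrK d%:R) addrC.
  apply: le_trans (ler_normD _ _) _.
  by rewrite [`|d%:R|]ger0_norm// lerD2l.
split => //; [|by move=> x; exact: (bd 1%N)|by move=> x; exact: (bd 2%N)].
split => //; [exact: has_deriv_continuous h2| |by move=> x; exact: (bd 0%N)].
apply: (deriv_ge _ d0 lT h0) => [||x].
- exact: lt_trans ltr01 lam1.
- exact: has_deriv_continuous h1.
have dif : `|derive1 T x - derive1 Ts x| < delta.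
  rewrite -lte_fin; apply: le_lt_trans nT.
  have := @Cnorm_ge 2 (fun x => T x - Ts x) 1 x isT.
  by rewrite derive1n1 (has_derivE (has_derivB h0 (Ck_deriv Ts4 (isT : 0 < 4)%N))).
have mn : min_expansion Ts <= `|derive1 Ts x|.
  by apply: ge_inf; [exists 0 => _ [y _ <-]|exists x].
have := ler_normB (derive1 T x) (derive1 T x - derive1 Ts x); rewrite subKr.
by move: dif mn; lra.
Qed.

Lemma is_lift_nat (h : R -> R) : is_lift 1 h -> forall n x, h (x + n%:R) = h x + n%:R.
Proof.
move=> lh; elim=> [|n ih] x; first by rewrite !addr0.
by rewrite -natr1 addrA lh ih -addrA.
Qed.

(** The bound on a leaves half of the excess lam - 1 of the expansion. *)
Lemma expanding_comp d (lam K KT a : R) T T1 T2 h h1 h2 :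
  expanding d lam K T T1 T2 -> (forall x, `|T1 x| <= KT) -> is_lift 1 h ->
  has_deriv h h1 -> has_deriv h1 h2 -> continuous h2 ->
  (forall x, `|h1 x - 1| <= a) -> (forall x, `|h2 x| <= a) -> a <= 1 ->
  a <= (lam - 1) / (2 * lam) ->
  expanding d ((lam + 1) / 2) (KT ^+ 2 + 2 * K) (h \o T) (fun x => h1 (T x) * T1 x)
    (fun x => h2 (T x) * T1 x ^+ 2 + h1 (T x) * T2 x).
Proof.
move=> E TK lh hh hh1 ch2 h1a h2a a1 alam; have lam1 := exp_gt1 E.
have cT := has_deriv_continuous (exp_d1 E).
have cT1 := has_deriv_continuous (exp_d2 E).
have K0 := exp_K_ge0 E.
have a0 : 0 <= a := le_trans (normr_ge0 _) (h2a 0).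
split.
- by move: lam1; lra.
- by move=> x /=; rewrite (exp_lift E) is_lift_nat.
- exact: has_deriv_comp hh (exp_d1 E).
- have := has_derivM (has_deriv_comp hh1 (exp_d1 E)) (exp_d2 E).
  by move=> /has_deriv_eq; apply => x; rewrite expr2 mulrA.
- apply: contD; apply: contM.
  + exact: cont_comp.
  + exact: contM.
  + by apply: cont_comp => //; exact: has_deriv_continuous hh1.
  + exact: (exp_cont E).
- move=> x; have := h1a (T x); rewrite ler_norml => /andP[h1l _].
  have l2 : 0 < 2 * lam by move: lam1; lra.
  move: alam; rewrite ler_pdivlMr// => alam; have := exp_lam E x => lT.
  have p1 : 0 <= (h1 (T x) - (1 - a)) * T1 x.
    by rewrite mulr_ge0 ?(ltW (exp_T1_gt0 E x))// subr_ge0; move: h1l; lra.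
  have p2 : 0 <= (1 - a) * (T1 x - lam) by rewrite mulr_ge0 ?subr_ge0.
  by move: p1 p2 alam; lra.
- move=> x; apply: le_trans (ler_normD _ _) _; rewrite !normrM; apply: lerD.
    rewrite -[leRHS]mul1r; apply: ler_pM => //; first exact: le_trans (h2a _) a1.
    by rewrite expr2; apply: ler_pM.
  apply: ler_pM => //; last exact: (exp_K E).
  have := h1a (T x); rewrite ler_distl => /andP[u v].
  by rewrite ler_norml; apply/andP; split; move: u v a1; lra.
Qed.

End Hypotheses.

(** * Composition with a diffeomorphism near the identity *)

Section Expansion.
Context {R : realType}.

(** Pointwise comparison of a density f and of its image by a map h, at
    corresponding points: H1, H2 are the derivatives of h, dl its displacement,
    F and F1 the values of f and f' at the image point. *)
Section Pointwise.
Variables (e eta k A H1 Y Y1 f f1 dl F : R).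
Hypotheses (e0 : 0 <= e) (k1 : 1 <= k) (ek : e * k <= 1 / 2)
  (H1k : `|H1 - 1| <= e * k) (H1Y : `|H1 - 1 - e * Y1| <= eta * e)
  (dlY : `|dl - e * Y| <= eta * e) (fA : `|f| <= A) (f1A : `|f1| <= A).

Let H1_ge : 1 / 2 <= H1.
Proof. by move: H1k; rewrite ler_distl => /andP[u _]; move: u ek; lra. Qed.

Let H1_neq0 : H1 != 0.
Proof. by rewrite gt_eqF// (lt_le_trans _ H1_ge). Qed.

Let A0 : 0 <= A := le_trans (normr_ge0 _) fA.

Lemma inv_le2 : `|H1^-1| <= 2.
Proof.
have H10 : 0 < H1 by apply: lt_le_trans H1_ge.
rewrite ger0_norm ?invr_ge0 ?(ltW H10)// -[leRHS]invrK lef_pV2 ?posrE ?invr_gt0//.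
by move: H1_ge; lra.
Qed.

Lemma inv_sub1 : `|H1^-1 - 1| <= 2 * (e * k).
Proof.
have -> : H1^-1 - 1 = - (H1^-1 * (H1 - 1)) by field.
by rewrite normrN; apply: norm_mul => //; exact: inv_le2.
Qed.

Lemma inv_expansion : `|H1^-1 - 1 + e * Y1| <= 2 * (e * k) ^+ 2 + eta * e.
Proof.
have -> : H1^-1 - 1 + e * Y1 = H1^-1 * ((H1 - 1) * (H1 - 1)) - (H1 - 1 - e * Y1).
  by field.
apply: norm_sub => //; rewrite expr2; apply: norm_mul; first exact: inv_le2.
exact: norm_mul.
Qed.

Lemma density_near : `|F - f| <= A * (e * k) -> `|f / H1 - F| <= 3 * A * k * e.
Proof.
move=> hF; have -> : f / H1 - F = f * (H1^-1 - 1) - (F - f) by field.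
have := norm_sub (norm_mul fA inv_sub1) hF.
by move=> h; apply: le_trans h _; lra.
Qed.

Hypothesis dlk : `|F - f - f1 * dl| <= A * (e * k) ^+ 2.

Lemma density_expansion :
  `|f / H1 - F + e * (Y1 * f + Y * f1)| <= e * (A * (3 * k ^+ 2 * e + 2 * eta)).
Proof.
have -> : f / H1 - F + e * (Y1 * f + Y * f1) =
    f * (H1^-1 - 1 + e * Y1) - (F - f - f1 * dl) - f1 * (dl - e * Y) by field.
have := norm_sub (norm_sub (norm_mul fA inv_expansion) dlk) (norm_mul f1A dlY).
by move=> h; apply: le_trans h _; rewrite le_eqVlt; apply/orP; left; apply/eqP; ring.
Qed.

Variables (H2 Y2 f2 F1 : R).
Hypotheses (H2k : `|H2| <= e * k) (H2Y : `|H2 - e * Y2| <= eta * e)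
  (f2A : `|f2| <= A) (F1A : `|F1 - f1 - f2 * dl| <= A * (e * k) ^+ 2).

Lemma density_expansion1 :
  `|f1 / H1 ^+ 2 - f * H2 / H1 ^+ 3 - F1 + e * (Y2 * f + 2 * Y1 * f1 + Y * f2)| <=
  e * (A * (23 * k ^+ 2 * e + 4 * eta)).
Proof.
set q := H1^-1.
have q1 : `|q - 1| <= 2 * (e * k) := inv_sub1.
have q2 : `|q| <= 2 := inv_le2.
have two : `|2 : R| <= 2 by rewrite ger0_norm.
have one : `|1 : R| <= 1 by rewrite normr1.
have a : `|2 * (q - 1 + e * Y1) + (q - 1) * (q - 1)| <=
    2 * (2 * (e * k) ^+ 2 + eta * e) + 2 * (e * k) * (2 * (e * k)).
  by apply: norm_add; apply: norm_mul => //; exact: inv_expansion.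
have b : `|(H2 - e * Y2) + H2 * ((q - 1) * (q * q + q + 1))| <=
    eta * e + e * k * (2 * (e * k) * (2 * 2 + 2 + 1)).
  apply: norm_add => //; apply: norm_mul => //; apply: norm_mul => //.
  by apply: norm_add => //; apply: norm_add => //; exact: norm_mul.
have -> : f1 / H1 ^+ 2 - f * H2 / H1 ^+ 3 - F1 + e * (Y2 * f + 2 * Y1 * f1 + Y * f2) =
    f1 * (2 * (q - 1 + e * Y1) + (q - 1) * (q - 1))
    - f * ((H2 - e * Y2) + H2 * ((q - 1) * (q * q + q + 1)))
    - (F1 - f1 - f2 * dl) - f2 * (dl - e * Y).
  by rewrite /q; field.
have := norm_sub (norm_sub (norm_sub (norm_mul f1A a) (norm_mul fA b)) F1A)
  (norm_mul f2A dlY).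
by move=> h; apply: le_trans h _; rewrite le_eqVlt; apply/orP; left; apply/eqP; ring.
Qed.

End Pointwise.

Section Transfer.
Variables (d : nat) (lam K lam' K' : R) (T T1 T2 h h1 H1 H2 : R -> R).
Hypotheses (E : expanding d lam K T T1 T2) (E' : expanding d lam' K' (h \o T) H1 H2)
  (hh : has_deriv h h1) (lh : is_lift 1 h) (h1_gt0 : forall x, 0 < h1 x).

(** The preimages of h y under h \o T are those of y under T, and the weights
    differ by the factor h1 y. *)
Lemma transfer_comp f y : periodic f 1 ->
  transfer (h \o T) f (h y) = transfer T f y / h1 y.
Proof.
move=> pf; rewrite (transferE E)// (transferE E')// big_distrl/=.
have ph1 := lift_deriv_periodic lh hh.
apply: eq_bigr => j _.
have -> : branch (h \o T) (h y + j%:R) = branch T (y + j%:R).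
  by apply: (exp_inj E'); rewrite (branchK E') /= (branchK E) (is_lift_nat lh).
set s := branch T _; have sT : T s = y + j%:R by rewrite (branchK E).
have H1E : H1 s = h1 y * T1 s.
  rewrite -(has_deriv_uniq (has_deriv_comp hh (exp_d1 E)) (exp_d1 E')) sT.
  by congr (_ * _); exact: (periodicz ph1 y j%:Z).
by rewrite /invd H1E -mulrA invfM [(T1 s)^-1 * _]mulrC.
Qed.

End Transfer.

(** The expansion h = id + e Y + O(eta e) in C^2. The cruder bounds by e k are
    recorded too, since they hold with the same k for all small e. *)
Record near_id (e eta k : R) (Y Y1 Y2 h h1 h2 : R -> R) : Prop := NearId {
  ni_lift : is_lift 1 h;
  ni_surj : forall z, exists y, h y = z;
  ni_h1 : has_deriv h h1;
  ni_h2 : has_deriv h1 h2;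
  ni_cont : continuous h2;
  ni_d0 : forall x, `|h x - x| <= e * k;
  ni_d1 : forall x, `|h1 x - 1| <= e * k;
  ni_d2 : forall x, `|h2 x| <= e * k;
  ni_Y0 : forall x, `|h x - x - e * Y x| <= eta * e;
  ni_Y1 : forall x, `|h1 x - 1 - e * Y1 x| <= eta * e;
  ni_Y2 : forall x, `|h2 x - e * Y2 x| <= eta * e }.

Section NearIdentity.
Variables (e eta k : R) (Y Y1 Y2 h h1 h2 : R -> R).
Hypotheses (N : near_id e eta k Y Y1 Y2 h h1 h2) (e0 : 0 <= e) (k1 : 1 <= k)
  (ek : e * k <= 1 / 2).
Variables (d : nat) (lam K lam' K' : R) (T T1 T2 H1 H2 : R -> R).
Hypotheses (E : expanding d lam K T T1 T2) (E' : expanding d lam' K' (h \o T) H1 H2).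
Variables (f : R -> R).
Hypothesis pf : periodic f 1.
Local Notation phi := (transfer T f).
Local Notation G := (transfer (h \o T) f).

Lemma ni_ge x : 1 / 2 <= h1 x.
Proof. by have := ni_d1 N x; rewrite ler_distl => /andP[u _]; move: u ek; lra. Qed.

Lemma ni_neq0 x : h1 x != 0.
Proof. by rewrite gt_eqF// (lt_le_trans _ (ni_ge x)). Qed.

Let comp y : G (h y) = phi y / h1 y.
Proof. exact: (transfer_comp E E' (ni_h1 N) (ni_lift N)). Qed.

Lemma transfer_near (phi1 : R -> R) (A : R) : has_deriv phi phi1 ->
  (forall x, `|phi x| <= A) -> (forall x, `|phi1 x| <= A) ->
  forall z, `|G z - phi z| <= 3 * A * k * e.
Proof.
move=> hphi fA f1A z; have [y <-] := ni_surj N z; rewrite comp.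
have A0 : 0 <= A := le_trans (normr_ge0 _) (fA 0).
apply: (density_near ek (ni_d1 N y) (fA y)).
apply: le_trans (deriv_lip hphi f1A _ _) _.
by apply: ler_wpM2l => //; exact: (ni_d0 N).
Qed.

Variables (phi1 phi2 phi3 Y3 G1 : R -> R) (A : R).
Hypotheses (hphi : has_deriv phi phi1) (hphi1 : has_deriv phi1 phi2)
  (hphi2 : has_deriv phi2 phi3) (hG : has_deriv G G1) (fA : forall x,
    [/\ `|phi x| <= A, `|phi1 x| <= A, `|phi2 x| <= A & `|phi3 x| <= A])
  (hY : has_deriv Y Y1) (hY1 : has_deriv Y1 Y2) (hY2 : has_deriv Y2 Y3)
  (Yk : forall x, [/\ `|Y x| <= k, `|Y1 x| <= k, `|Y2 x| <= k & `|Y3 x| <= k]).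

Let A0 : 0 <= A.
Proof. by have [a _ _ _] := fA 0; apply: le_trans (normr_ge0 _) a. Qed.

Let G1E y : G1 (h y) = phi1 y / h1 y ^+ 2 - phi y * h2 y / h1 y ^+ 3.
Proof.
have a := has_deriv_comp hG (ni_h1 N).
have b := has_derivM hphi (has_derivV ni_neq0 (ni_h2 N)).
have := has_deriv_uniq (has_deriv_ext a comp) b y.
have n0 := ni_neq0 y => G1h; apply: (mulIf n0); rewrite G1h.
by field.
Qed.

Let Z1 x : R := Y1 x * phi x + Y x * phi1 x.
Let Z2 x : R := Y2 x * phi x + 2 * Y1 x * phi1 x + Y x * phi2 x.
Let Z3 x : R := Y3 x * phi x + 3 * Y2 x * phi1 x + 3 * Y1 x * phi2 x + Y x * phi3 x.

Let hZ1 : has_deriv Z1 Z2.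
Proof.
have := has_derivD (has_derivM hY1 hphi) (has_derivM hY hphi1).
by move=> /has_deriv_eq; apply => x; rewrite /Z2; ring.
Qed.

Let hZ2 : has_deriv Z2 Z3.
Proof.
have := has_derivD (has_derivD (has_derivM hY2 hphi)
  (has_derivZ 2 (has_derivM hY1 hphi1))) (has_derivM hY hphi2).
move=> a; apply: has_deriv_ext (has_deriv_eq (g' := Z3) a _) _ => x; rewrite /Z2 /Z3; ring.
Qed.

Let k0 : 0 <= k := le_trans ler01 k1.

Let Z2_le x : `|Z2 x| <= 4 * (A * k).
Proof.
have [a b c _] := fA x; have [u v w _] := Yk x.
have two : `|2 : R| <= 2 by rewrite ger0_norm.
have le := norm_add (norm_add (norm_mul w a) (norm_mul (norm_mul two v) b)) (norm_mul u c).
by apply: le_trans le _; lra.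
Qed.

Let Z3_le x : `|Z3 x| <= 8 * (A * k).
Proof.
have [a b c b'] := fA x; have [u v w w'] := Yk x.
have three : `|3 : R| <= 3 by rewrite ger0_norm.
have le := norm_add (norm_add (norm_add (norm_mul w' a)
  (norm_mul (norm_mul three w) b)) (norm_mul (norm_mul three v) c)) (norm_mul u b').
by apply: le_trans le _; lra.
Qed.

(** At corresponding points y and h y the pointwise expansions give the first-order
    term at y; moving it to h y costs one more derivative and a factor e. *)
Lemma transfer_expansion z : 0 < e -> 0 <= eta ->
  `|e^-1 * (G z - phi z) + (Y1 z * phi z + Y z * phi1 z)|
    <= 31 * (A * k ^+ 2) * (eta + e) /\
  `|e^-1 * (G1 z - phi1 z) + (Y2 z * phi z + 2 * Y1 z * phi1 z + Y z * phi2 z)|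
    <= 31 * (A * k ^+ 2) * (eta + e).
Proof.
move=> e_gt0 eta0; have [y <-] := ni_surj N z; set z' := h y.
have [a b c a'] := fA y; have [u v w w'] := Yk y.
have d2 : `|h y - y| ^+ 2 <= (e * k) ^+ 2.
  by rewrite !expr2; apply: ler_pM => //; exact: (ni_d0 N).
have f2A x : `|phi2 x| <= A by have [] := fA x.
have f3A x : `|phi3 x| <= A by have [] := fA x.
have t0 : `|phi z' - phi y - phi1 y * (h y - y)| <= A * (e * k) ^+ 2.
  apply: le_trans (taylor1 hphi hphi1 f2A y z') _.
  exact: ler_wpM2l.
have t1 : `|phi1 z' - phi1 y - phi2 y * (h y - y)| <= A * (e * k) ^+ 2.
  apply: le_trans (taylor1 hphi1 hphi2 f3A y z') _.
  exact: ler_wpM2l.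
have X0 := density_expansion ek (ni_d1 N y) (ni_Y1 N y) (ni_Y0 N y) a b t0.
have X1 := density_expansion1 ek (ni_d1 N y) (ni_Y1 N y) (ni_Y0 N y) a b
  (ni_d2 N y) (ni_Y2 N y) c t1.
rewrite -comp -/z' -/(Z1 y) in X0; rewrite -G1E -/z' -/(Z2 y) in X1.
rewrite -/(Z1 z') -/(Z2 z').
have ei : `|e^-1| <= e^-1 by rewrite ger0_norm// invr_ge0.
have k2 : 1 <= k ^+ 2 by rewrite exprn_ege1.
have Ak := mulr_ge0 A0 (exprn_ge0 2 k0).
have Ae : A * eta <= A * k ^+ 2 * eta.
  by rewrite ler_wpM2r// ler_peMr.
have Aee := mulr_ge0 Ak eta0; have Ake := mulr_ge0 Ak e0.
have dz0 : `|Z1 z' - Z1 y| <= 4 * (A * k) * (e * k).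
  apply: le_trans (deriv_lip hZ1 Z2_le _ _) _.
  by apply: ler_wpM2l; [rewrite !mulr_ge0|exact: (ni_d0 N)].
have dz1 : `|Z2 z' - Z2 y| <= 8 * (A * k) * (e * k).
  apply: le_trans (deriv_lip hZ2 Z3_le _ _) _.
  by apply: ler_wpM2l; [rewrite !mulr_ge0|exact: (ni_d0 N)].
have en0 : e != 0 by rewrite gt_eqF.
split.
  have -> : e^-1 * (G z' - phi z') + Z1 z' =
      e^-1 * (G z' - phi z' + e * Z1 y) + (Z1 z' - Z1 y) by field.
  have := norm_add (norm_mul ei X0) dz0; rewrite mulrA mulVf// mul1r => le.
  by apply: le_trans le _; move: Ae Aee Ake; lra.
have -> : e^-1 * (G1 z' - phi1 z') + Z2 z' =
    e^-1 * (G1 z' - phi1 z' + e * Z2 y) + (Z2 z' - Z2 y) by field.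
have := norm_add (norm_mul ei X1) dz1; rewrite mulrA mulVf// mul1r => le.
by apply: le_trans le _; move: Ae Aee Ake; lra.
Qed.

End NearIdentity.

End Expansion.

(** * Norms of functions and of sequences *)

Section Norms.
Context {R : realType}.
Notation mu := (@lebesgue_measure R).
Implicit Types f g : R -> R.

Lemma L1norm_ge0 f : (0 <= L1norm f)%E.
Proof. by apply: integral_ge0 => x _; rewrite lee_fin. Qed.

Lemma W11norm_ge0 f : (0 <= W11norm f)%E.
Proof.
by rewrite /W11norm; case: asboolP => // _; rewrite adde_ge0// L1norm_ge0.
Qed.

Lemma linf_le (N : (R -> R) -> \bar R) v a : (forall n, N (v n) <= a)%E -> (linf N v <= a)%E.
Proof. by move=> h; apply: ub_ereal_sup => _ [n _ <-]. Qed.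

Lemma le_linf (N : (R -> R) -> \bar R) v n : (N (v n) <= linf N v)%E.
Proof. by apply: ereal_sup_ubound; exists n. Qed.

Lemma linf_ge0 (N : (R -> R) -> \bar R) v : (forall f, 0 <= N f)%E -> (0 <= linf N v)%E.
Proof. by move=> N0; apply: le_trans (N0 (v 0)) _; exact: le_linf. Qed.


Lemma linf_fin (N : (R -> R) -> \bar R) (v : int -> R -> R) :
  (forall f, 0 <= N f)%E -> (linf N v < +oo)%E ->
  exists2 K : R, 0 <= K & forall n, (N (v n) <= K%:E)%E.
Proof.
move=> N0 h; exists (fine (linf N v)); first by apply: fine_ge0; exact: linf_ge0.
by move=> n; rewrite fineK ?ge0_fin_numE ?linf_ge0//; exact: le_linf.
Qed.

Lemma L1norm_le_W11norm f : (L1norm f <= W11norm f)%E.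
Proof.
rewrite /W11norm; case: asboolP => _; last exact: leey.
by rewrite leeDl// L1norm_ge0.
Qed.

Lemma W11normB f g : inW11 f -> inW11 g -> inW11 (fun x => f x - g x) /\
  (W11norm (fun x => (f x - g x)%R) <= W11norm f + W11norm g)%E.
Proof.
move=> Wf Wg; have [If _] := Wf; have [Ig _] := Wg.
have hf := weak_derivP Wf; have hg := weak_derivP Wg.
have hB := weakB If Ig hf hg; have IB := inL1B If Ig.
split; first by split => //; exists (fun x => weak_deriv f x - weak_deriv g x).
rewrite (W11normE IB hB) (W11normE If hf) (W11normE Ig hg) -EFinD lee_fin.
have [If1 _] := hf; have [Ig1 _] := hg.
by rewrite [leRHS]addrACA; exact: lerD (l1B If Ig) (l1B If1 Ig1).
Qed.

Lemma C1_inW11 F f f1 : inL1 F -> has_deriv f f1 -> continuous f1 ->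
  periodic f 1 -> (\forall x \ae mu, f x = F x) -> inW11 F.
Proof.
move=> IF hf cf1 pf fF; split => //; exists f1.
have If := inL1_continuous (has_deriv_continuous hf) pf.
have hw := weak_C1 hf cf1 pf; have [If1 _] := hw.
exact: weak_ae If IF If1 fF (aeT (fun=> erefl)) hw.
Qed.

Lemma geometric_nneseries (u : nat -> \bar R) (B rho : R) (N : nat) :
  0 <= rho < 1 -> 0 <= B -> (forall k, 0 <= u k)%E ->
  (forall k, u k <= (B * rho ^+ k)%:E)%E ->
  (\sum_(N <= k <oo) u k <= (B / (1 - rho) * rho ^+ N)%:E)%E.
Proof.
move=> /andP[r0 r1] B0 u0 uB; have rr : 0 < 1 - rho by rewrite subr_gt0.
apply: lime_le; first by apply: is_cvg_nneseries => k _ _; exact: u0.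
have part m : (\sum_(N <= k < N + m) u k <=
    (B / (1 - rho) * (rho ^+ N - rho ^+ (N + m)))%:E)%E.
  elim: m => [|m ih]; first by rewrite addn0 big_geq// subrr mulr0.
  rewrite addnS big_nat_recr ?leq_addr//=.
  apply: le_trans (leeD ih (uB _)) _; rewrite -EFinD lee_fin exprS.
  by rewrite le_eqVlt; apply/orP; left; apply/eqP; field; rewrite gt_eqF.
exists N => // n /= Nn; rewrite -(subnKC Nn); apply: le_trans (part _) _.
rewrite lee_fin ler_wpM2l ?divr_ge0 ?(ltW rr)// gerBl exprn_ge0//.
Qed.

Lemma cvge_geometric (X : nat -> \bar R) (B rho : R) : 0 <= rho < 1 -> 0 <= B ->
  (forall N, 0 <= X N)%E -> (forall N, X N <= (B * rho ^+ N)%:E)%E ->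
  X N @[N --> \oo] --> 0%E.
Proof.
move=> rho01 B0 X0 XB; apply: cvge0 => // eta eta0.
have [N0 hN0] := geometric_small B rho01 eta0; have /andP[r0 r1] := rho01.
exists N0 => // N /= N0N; apply: le_trans (XB N) _; rewrite lee_fin.
apply: le_trans (ltW hN0); apply: ler_wpM2l => //.
by apply: ler_wiXn2l => //; exact: ltW.
Qed.

End Norms.

Section Family.
Context {R : realType}.
Notation mu := (@lebesgue_measure R).
Variables (d : nat) (lam K : R) (T T1 T2 : int -> R -> R).
Hypothesis E : forall n, expanding d lam K (T n) (T1 n) (T2 n).
Local Notation L := (fun n => transfer (T n)).
Implicit Types f v : R -> R.

Lemma transfer_L1norm n f : inL1 f -> (L1norm (L n f) <= L1norm f)%E.
Proof.
move=> If; rewrite (L1normE If) (L1normE (transfer_inL1 (E n) If)) lee_fin.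
exact: (l1_transfer (E n)).
Qed.

Lemma transfer_ae_ge0 n f : inL1 f -> (\forall x \ae mu, 0 <= f x) ->
  \forall x \ae mu, 0 <= L n f x.
Proof.
move=> If f0; have In := inL1_norm If; have [pn _] := In.
have fn : \forall x \ae mu, f x = `|f x|.
  by apply: aeS f0 => x /ger0_norm ->.
apply: aeS (transfer_ae (E n) If In fn) => x ->.
exact: (transfer_ge0 (E n)).
Qed.

Lemma iter_shift_op k (v : int -> R -> R) : linf_L10 v ->
  linf_L10 (iter k (shift_op L) v) /\
  (linf L1norm (iter k (shift_op L) v) <= linf L1norm v)%E.
Proof.
move=> hv; elim: k => [//|k [[h1 h2] h3]] /=.
set w := iter k _ v in h1 h2 h3 *.
have le : (linf L1norm (shift_op L w) <= linf L1norm w)%E.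
  apply: linf_le => n; apply: le_trans (le_linf _ _ (n - 1)).
  by apply: transfer_L1norm; have [] := h1 (n - 1).
split; last exact: le_trans le h3.
split; last exact: le_lt_trans le h2.
move=> n; have [Iw w0] := h1 (n - 1); split; first exact: (transfer_inL1 (E _)).
by rewrite -w0; exact: (cint_transfer (E _)).
Qed.

End Family.

(** * Linear response *)

Section SmallForcing.
Context {R : realType}.

(** Unfolding the recursion N times. *)
Lemma forced_orbit d (lam K : R) T T1 T2 (v s : int -> R -> R) :
  (forall n, expanding d lam K (T n) (T1 n) (T2 n)) ->
  (forall n, periodic (v n) 1) -> (forall n, periodic (s n) 1) ->
  (forall n x, v (n + 1) x = transfer (T n) (v n) x + s n x) ->
  let L := fun n => transfer (T n) in
  forall N n x, v n x - \sum_(k < N) response_term L s n k x =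
    cocycle L (n - N%:Z) N (v (n - N%:Z)) x.
Proof.
move=> E pv ps vS L; elim=> [|N ih] n x; first by rewrite big_ord0 !subr0.
have e : n - N.+1%:Z + 1 = n - N%:Z by rewrite -addn1 PoszD; ring.
have e' : n - N%:Z - 1 = n - N.+1%:Z by rewrite -addn1 PoszD; ring.
rewrite cocycle_first e big_ord_recr/= opprD addrA ih /response_term e'.
have -> : v (n - N%:Z) = (fun y => L (n - N.+1%:Z) (v (n - N.+1%:Z)) y + s (n - N.+1%:Z) y).
  by apply/funext => y; rewrite -vS e.
rewrite (cocycleD E)//; last exact: transfer_periodic.
by rewrite addrK.
Qed.

(** The orbit is the sum over the past of the forcing. The N most recent terms are
    small with the forcing in sup norm, the others by decay, for which a bound on
    the forcing in C^1 is enough. *)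
Lemma small_forcing (lam K : R) : 1 < lam -> 0 <= K -> exists2 C, 0 <= C &
  forall d T T1 T2, (forall n, expanding d lam K (T n) (T1 n) (T2 n)) ->
  forall (v v1 s s1 : int -> R -> R) (A D a : R),
  (forall n, periodic (v n) 1) -> (forall n, cint (v n) = 0) ->
  (forall n, has_deriv (v n) (v1 n)) -> (forall n x, `|v1 n x| <= D) ->
  (forall n x, v (n + 1) x = transfer (T n) (v n) x + s n x) ->
  (forall n, has_deriv (s n) (s1 n)) -> (forall n, continuous (s1 n)) ->
  (forall n x, `|s1 n x| <= A) -> (forall n x, `|s n x| <= a) ->
  forall N n x,
    `|v n x| <= N%:R * (a * expR (cone_param lam K)) + C * A * decay_rate lam K ^+ N.
Proof.
move=> lam1 K0; have [C C0 hC] := response_sum_C1 lam1 K0.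
have [C' C'0 hC'] := C1_decay lam1 K0; have rho01 := decay_rate_itvW lam1 K0.
exists C => // d T T1 T2 E v v1 s s1 A D a pv v0 hv vD vS hs cs1 sA sa N n x.
set L := fun n => transfer (T n).
have ps m : periodic (s m) 1.
  have sE y : s m y = v (m + 1) y - L m (v m) y by rewrite vS addrC addKr.
  by move=> y; rewrite !sE pv /L transfer_periodic.
have Iv m := inL1_continuous (has_deriv_continuous (hv m)) (pv m).
have s0 m : cint (s m) = 0.
  have -> : s m = (fun y => v (m + 1) y - L m (v m) y).
    by apply/funext => y; rewrite vS addrC addKr.
  rewrite cintB//; last exact: (transfer_inL1 (E m)).
  by rewrite (cint_transfer (E m))// !v0 subrr.
have [tA [sg1 [_ _ _ _ tails]]] := hC d T T1 T2 E s s1 A ps s0 hs cs1 sA.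
have vE : v n x = response_sum L s n x.
  apply: (gsum_uniq rho01 (tA n ^~ x) (C := C' * D)) => m.
  rewrite (forced_orbit E pv ps vS).
  by have [] := hC' d T T1 T2 E _ _ D (pv (n - m%:Z)) (v0 _) (hv _) (vD _) (n - m%:Z) m x.
have [t1 _ [_ /(_ x)[ht _]]] := tails N n.
rewrite vE -[response_sum L s n x](subrK (\sum_(k < N) response_term L s n k x)) addrC.
apply: le_trans (ler_normD _ _) _; apply: lerD => //.
apply: le_trans (ler_norm_sum _ _ _) _.
rewrite mulr_natl -[X in _ *+ X]card_ord -sumr_const; apply: ler_sum => i _.
by apply: (cocycle_sup E) => //; exact: sa.
Qed.

End SmallForcing.

Section Response.
Context {R : realType}.
Notation leb := (@lebesgue_measure R).
Variables (d : nat) (lam K lam' K' k e1 A : R) (T T1 T2 : int -> R -> R)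
  (h h1 h2 : R -> R -> R) (H1 H2 : R -> int -> R -> R) (Y Y1 Y2 Y3 : R -> R).
Hypotheses (k1 : 1 <= k) (e1_gt0 : 0 < e1) (e1k : e1 * k <= 1 / 2)
  (E : forall n, expanding d lam K (T n) (T1 n) (T2 n))
  (E' : forall e n, 0 <= e < e1 ->
    expanding d lam' K' (h e \o T n) (H1 e n) (H2 e n))
  (near : forall eta, 0 < eta -> exists2 a, 0 < a &
    forall e, 0 <= e < a -> near_id e eta k Y Y1 Y2 (h e) (h1 e) (h2 e))
  (pY : periodic Y 1) (hY : has_deriv Y Y1) (hY1 : has_deriv Y1 Y2)
  (hY2 : has_deriv Y2 Y3)
  (Yk : forall x, [/\ `|Y x| <= k, `|Y1 x| <= k, `|Y2 x| <= k & `|Y3 x| <= k]).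
Local Notation L := (fun n => transfer (T n)).
Local Notation Le e := (fun n => transfer (h e \o T n)).
Local Notation mu := (equivariant_density T).
Local Notation mue e := (equivariant_density (fun n => h e \o T n)).
Variables (m1 m2 m3 : int -> R -> R).
Hypotheses (hm1 : forall n, has_deriv (mu n) (m1 n))
  (hm2 : forall n, has_deriv (m1 n) (m2 n))
  (hm3 : forall n, has_deriv (m2 n) (m3 n))
  (mA : forall n x, [/\ `|mu n x| <= A, `|m1 n x| <= A, `|m2 n x| <= A & `|m3 n x| <= A]).

Let g := source Y L mu.

(** The C^1 representative of the source, and its derivative. *)
Definition classical_source (n : int) : R -> R := fun x =>
  - (Y1 x * mu (n + 1) x + Y x * m1 (n + 1) x).
Definition classical_source1 (n : int) : R -> R := fun x =>
  - (Y2 x * mu (n + 1) x + 2 * Y1 x * m1 (n + 1) x + Y x * m2 (n + 1) x).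
Local Notation gc := classical_source.
Local Notation gc1 := classical_source1.

Let lam1 := exp_gt1 (E 0).
Let K0 := exp_K_ge0 (E 0).

Let e1_itv : 0 <= (0 : R) < e1. Proof. by rewrite lexx. Qed.
Let lam1' := exp_gt1 (E' 0 e1_itv).
Let K0' := exp_K_ge0 (E' 0 e1_itv).

Let A0 : 0 <= A.
Proof. by have [a _ _ _] := mA 0 0; apply: le_trans (normr_ge0 _) a. Qed.
Let k0 : 0 <= k := le_trans ler01 k1.

Let pmu n : periodic (mu n) 1.
Proof. by have [C _ hC] := equivariant_density_spec lam1 K0; have [] := hC _ _ _ _ E. Qed.

Let muS n : L n (mu n) = mu (n + 1).
Proof.
have [C _ hC] := equivariant_density_spec lam1 K0; have [_ _ _ muS _] := hC _ _ _ _ E.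
by apply/funext => x; rewrite muS.
Qed.

Let gc_deriv n : has_deriv (gc n) (gc1 n).
Proof.
have := has_derivN (has_derivD (has_derivM hY1 (hm1 (n + 1)))
  (has_derivM hY (hm2 (n + 1)))).
by move=> /has_deriv_eq; apply => x; rewrite /classical_source1; ring.
Qed.

Let gc_periodic n : periodic (gc n) 1.
Proof.
move=> x; rewrite /classical_source pmu (periodic_deriv (hm1 _) (pmu _)).
by rewrite pY (periodic_deriv hY pY).
Qed.

Let gc1_continuous n : continuous (gc1 n).
Proof.
have cY1 := has_deriv_continuous hY1; have cY2 := has_deriv_continuous hY2.
have cY := has_deriv_continuous hY.
have c0 := has_deriv_continuous (hm1 (n + 1)).
have c1 := has_deriv_continuous (hm2 (n + 1)).
have c2 := has_deriv_continuous (hm3 (n + 1)).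
apply: contN; apply: contD; [apply: contD|]; apply: contM => //.
exact: contZ.
Qed.

Let gc_le n x : `|gc n x| <= 4 * (A * k) /\ `|gc1 n x| <= 4 * (A * k).
Proof.
have [a b c _] := mA (n + 1) x; have [u v w _] := Yk x.
have two : `|2 : R| <= 2 by rewrite ger0_norm.
have Ak := mulr_ge0 A0 k0; rewrite !normrN; split.
  have le := norm_add (norm_mul v a) (norm_mul u b).
  by apply: le_trans le _; lra.
have le := norm_add (norm_add (norm_mul w a) (norm_mul (norm_mul two v) b)) (norm_mul u c).
by apply: le_trans le _; lra.
Qed.

Let gc_continuous n : continuous (gc n) := has_deriv_continuous (@gc_deriv n).

Let gc_cint n : cint (gc n) = 0.
Proof.
have hZ := has_derivM hY (hm1 (n + 1)).
have cZ : continuous (fun x => Y1 x * mu (n + 1) x + Y x * m1 (n + 1) x).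
  have := contN (@gc_continuous n); rewrite /classical_source.
  by under eq_fun do rewrite opprK.
have pZ : periodic (fun x => Y x * mu (n + 1) x) 1 by move=> x; rewrite pY pmu.
have IZ := inL1_continuous cZ (periodic_deriv hZ pZ).
by rewrite /classical_source cintN// (cint_deriv hZ cZ pZ) oppr0.
Qed.

Let flux n : R -> R := fun y => Y y * L n (mu n) y.

Let flux_deriv n : has_deriv (flux n) (fun x => - gc n x).
Proof.
rewrite /flux muS; apply: has_deriv_eq (has_derivM hY (hm1 (n + 1))) _ => x.
by rewrite /classical_source opprK.
Qed.

Let flux_weak n : is_weak_deriv (flux n) (weak_deriv (flux n)) /\
  \forall x \ae leb, gc n x = g n x.
Proof.
have pf : periodic (flux n) 1 by move=> x; rewrite /flux pY transfer_periodic.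
have cZ : continuous (fun x => - gc n x) by apply: contN.
have hw := weak_C1 (@flux_deriv n) cZ pf.
have If := inL1_continuous (has_deriv_continuous (@flux_deriv n)) pf.
have hW : is_weak_deriv (flux n) (weak_deriv (flux n)).
  by apply: weak_derivP; split => //; exists (fun x => - gc n x).
split => //; have [Iw _] := hw; have [IW _] := hW.
apply: aeS (l1_eq0 (inL1B Iw IW) (weak_uniq hw hW)) => x /eqP.
by rewrite subr_eq0 /g /source => /eqP <-; rewrite opprK.
Qed.

Lemma source_inL1 n : inL1 (g n).
Proof. by have [[Iw _] _] := flux_weak n; exact: inL1N. Qed.

Lemma source_ae n : \forall x \ae leb, gc n x = g n x.
Proof. by have [] := flux_weak n. Qed.

Lemma W11norm_source n : (W11norm (g n) <= (8 * (A * k))%:E)%E.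
Proof.
have -> : 8 * (A * k) = 4 * (A * k) + 4 * (A * k) by ring.
apply: (W11norm_le (source_inL1 n) (@gc_deriv n) (@gc1_continuous n)
  (@gc_periodic n) (source_ae n)) => x; first exact: (gc_le n x).1.
exact: (gc_le n x).2.
Qed.

Lemma source_inW110 n : inW110 (g n).
Proof.
split; first exact: (C1_inW11 (source_inL1 n) (@gc_deriv n) (@gc1_continuous n)
  (@gc_periodic n) (source_ae n)).
rewrite -[RHS](gc_cint n); symmetry; apply: cint_ae_eq (source_ae n).
  exact: inL1_continuous (@gc_continuous n) (@gc_periodic n).
exact: source_inL1.
Qed.

(* The defect of the first-order expansion. *)
Let df e n x := e^-1 * (Le e n (mu n) x - L n (mu n) x) - gc n x.

Let G1 e n := transfer (h e \o T n) (fun x => invd (H1 e n) x * m1 n x +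
  invd1 (H1 e n) (H2 e n) x * mu n x).

Let df1 e n x := e^-1 * (G1 e n x - m1 (n + 1) x) - gc1 n x.

Let G1_deriv e n : 0 <= e < e1 -> has_deriv (Le e n (mu n)) (G1 e n).
Proof. by move=> ee; exact: (transfer_deriv (E' n ee) (hm1 n) (@pmu n)). Qed.

Let G1_continuous e n : 0 <= e < e1 -> continuous (G1 e n).
Proof.
move=> ee; have EE := E' n ee; apply: (transfer_continuous EE).
  apply: contD; apply: contM.
  - exact: (p_continuous EE).
  - exact: has_deriv_continuous (hm2 n).
  - exact: (p1_continuous EE).
  - exact: has_deriv_continuous (hm1 n).
move=> x; rewrite (p_periodic EE) (p1_periodic EE) pmu.
by rewrite (periodic_deriv (hm1 n) (@pmu n)).
Qed.

Let df_deriv e n : 0 <= e < e1 -> has_deriv (df e n) (df1 e n).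
Proof.
move=> ee; apply: has_derivB (@gc_deriv n); apply: has_derivZ.
by rewrite muS; exact: has_derivB (G1_deriv n ee) (hm1 _).
Qed.

Let df1_continuous e n : 0 <= e < e1 -> continuous (df1 e n).
Proof.
move=> ee; apply: contB (@gc1_continuous n); apply: contZ.
by apply: contB; [exact: G1_continuous|exact: has_deriv_continuous (hm2 _)].
Qed.

Let df_periodic e n : periodic (df e n) 1.
Proof. by move=> x; rewrite /df !transfer_periodic gc_periodic. Qed.

Let ek_le e : 0 <= e < e1 -> e * k <= 1 / 2.
Proof.
move=> /andP[e0 ee]; apply: le_trans e1k; rewrite ler_wpM2r//; exact: ltW.
Qed.

Let df_le e eta n x : 0 < e < e1 -> 0 <= eta ->
  near_id e eta k Y Y1 Y2 (h e) (h1 e) (h2 e) ->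
  `|df e n x| <= 31 * (A * k ^+ 2) * (eta + e) /\
  `|df1 e n x| <= 31 * (A * k ^+ 2) * (eta + e).
Proof.
move=> /andP[e0 ee] eta0 Ne; have ee' : 0 <= e < e1 by rewrite ltW.
have hphi : has_deriv (L n (mu n)) (m1 (n + 1)) by rewrite muS.
have fA y : [/\ `|L n (mu n) y| <= A, `|m1 (n + 1) y| <= A, `|m2 (n + 1) y| <= A &
    `|m3 (n + 1) y| <= A] by rewrite muS.
have [a b] := transfer_expansion Ne (ltW e0) k1 (ek_le ee') (E n) (E' n ee') (@pmu n)
  hphi (hm2 _) (hm3 _) (G1_deriv n ee') fA hY hY1 hY2 Yk x e0 eta0.
move: a b; rewrite /df /df1 /classical_source /classical_source1 !opprK muS.
by [].
Qed.

Lemma source_expansion :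
  linf W11norm (fun n x => e^-1 * (Le e n (mu n) x - L n (mu n) x) - g n x)
    @[e --> 0^'+] --> 0%E.
Proof.
apply: cvge0 => [e|eta0 eta00]; first by apply: linf_ge0; exact: W11norm_ge0.
set D := 31 * (A * k ^+ 2).
have D0 : 0 <= D by rewrite !mulr_ge0 ?exprn_ge0.
pose eta := eta0 / (4 * (D + 1)).
have eta_gt0 : 0 < eta by rewrite divr_gt0// mulr_gt0// ltr_wpDl.
have [a a0 ha] := near eta_gt0.
apply/at_rightE; exists (Num.min (Num.min a e1) eta).
  by rewrite !lt_min a0 e1_gt0.
move=> e /andP[e0]; rewrite !lt_min => /andP[/andP[ea ee] eeta].
have Ne : near_id e eta k Y Y1 Y2 (h e) (h1 e) (h2 e) by apply: ha; rewrite ltW.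
have ee' : 0 <= e < e1 by rewrite ltW.
have e0e : 0 < e < e1 by rewrite e0.
have Db : D * (eta + e) + D * (eta + e) <= eta0.
  have h3 : D * e <= D * eta by rewrite ler_wpM2l// ltW.
  have h4 : 4 * (D * eta) <= eta0.
    rewrite mulrA /eta mulrA ler_pdivrMr ?mulr_gt0 ?ltr_wpDl//.
    by move: (ltW eta00); nra.
  by move: h3 h4; lra.
apply: linf_le => n; apply: (@le_trans _ _ (D * (eta + e) + D * (eta + e))%:E); last by rewrite lee_fin.
have IF : inL1 (fun x => e^-1 * (Le e n (mu n) x - L n (mu n) x) - g n x).
  have Imu := inL1_continuous (has_deriv_continuous (hm1 n)) (@pmu n).
  apply: inL1B (source_inL1 n); apply: inL1Z; apply: inL1B.
    exact: (transfer_inL1 (E' n ee')).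
  exact: (transfer_inL1 (E n)).
apply: (W11norm_le IF (df_deriv n ee') (@df1_continuous e n ee') (@df_periodic e n)).
- by apply: aeS (source_ae n) => x <-.
- by move=> x; have [] := df_le n x e0e (ltW eta_gt0) Ne.
- by move=> x; have [] := df_le n x e0e (ltW eta_gt0) Ne.
Qed.

(** By duality the difference costs one derivative of the transfer of v, which is
    bounded by the norm of v. *)
Lemma operator_cvg :
  ereal_sup [set L1norm (fun x => Le e n v x - L n v x)
              | n in [set: int] & v in [set v | W11norm v = 1%E]]
    @[e --> 0^'+] --> 0%E.
Proof.
apply: cvge0 => [e|eta0 eta00].
  have c1 : W11norm (fun=> 1 : R) = 1%E.
    have h1' := has_deriv_cst (1 : R).
    rewrite (W11normE (inL1_cst 1) (weak_C1 h1' (@cont_cst _ 0) _))//.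
    rewrite /l1; under eq_fun do rewrite normr1.
    under [X in _ + cint X]eq_fun do rewrite normr0.
    by rewrite !cint_cst addr0.
  apply: le_trans (L1norm_ge0 _) _; apply: ereal_sup_ubound.
  by exists 0 => //; exists (fun=> 1).
pose D := k * (1 + K).
have D0 : 0 <= D by rewrite mulr_ge0// addr_ge0.
have [a a0 ha] := near ltr01.
apply/at_rightE; exists (Num.min (Num.min a e1) (eta0 / (D + 1))).
  by rewrite !lt_min a0 e1_gt0 divr_gt0// ltr_wpDl.
move=> e /andP[e0]; rewrite !lt_min => /andP[/andP[ea ee] eeta].
have Ne : near_id e 1 k Y Y1 Y2 (h e) (h1 e) (h2 e) by apply: ha; rewrite ltW.
have ee' : 0 <= e < e1 by rewrite ltW.
apply: ub_ereal_sup => _ [n _ [v /= v1 <-]].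
have Wv : inW11 v by apply: W11norm_lty; rewrite v1 ltry.
have [Iv [w hw]] := Wv; have hL := transfer_weak (E n) Iv hw.
have IL := transfer_inL1 (E n) Iv; have IL' := transfer_inL1 (E' n ee') Iv.
have := W11norm_transfer (E n) Wv; rewrite v1 mule1 (W11normE IL hL) lee_fin => LK.
rewrite (L1normE (inL1B IL' IL)) lee_fin.
have := transfer_comp_near (E n) (E' n ee') (ni_h1 Ne) (has_deriv_continuous (ni_h2 Ne))
  (ni_lift Ne) (ni_d0 Ne) (ni_d1 Ne) Iv hL.
move=> /le_trans; apply; rewrite -mulrDr [X in _ * X]addrC.
apply: (@le_trans _ _ (e * k * (1 + K))).
  by rewrite ler_wpM2l// mulr_ge0// ltW.
move: eeta; rewrite ltr_pdivlMr ?ltr_wpDl// => eeta.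
by move: (ltW e0) eeta; rewrite -mulrA -/D; lra.
Qed.

Local Notation eta := (response_sum L gc).
Local Notation rho := (decay_rate lam K).

Let rho01 : 0 <= rho < 1 := decay_rate_itvW lam1 K0.

Let peta n : periodic (eta n) 1.
Proof. by apply: response_sum_periodic => m; exact: gc_periodic. Qed.

Let response_facts : exists2 B, 0 <= B & exists et1,
  [/\ forall n j x, `|response_term L gc n j x| <= B * rho ^+ j,
    forall n, has_deriv (eta n) (et1 n), forall n, continuous (et1 n),
    forall n x, `|eta n x| <= B /\ `|et1 n x| <= B &
    forall N n, exists2 t1, has_deriv (fun x => eta n x -
        \sum_(j < N) response_term L gc n j x) t1 & continuous t1 /\ forall x,
      `|eta n x - \sum_(j < N) response_term L gc n j x| <= B * rho ^+ N /\
      `|t1 x| <= B * rho ^+ N].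
Proof.
have [C C0 hC] := response_sum_C1 lam1 K0.
have gc1A n x : `|gc1 n x| <= 4 * (A * k) by exact: (gc_le n x).2.
have [tG [et1 [a b c c' t]]] := hC d T T1 T2 E _ _ _ gc_periodic gc_cint gc_deriv
  gc1_continuous gc1A.
by exists (C * (4 * (A * k))); [rewrite !mulr_ge0|exists et1; split].
Qed.

Let etaS n x : eta (n + 1) x = L n (eta n) x + gc n x.
Proof.
have [B B0 [et1 [tB _ _ _ _]]] := response_facts.
exact: (response_sumS E rho01 gc_periodic tB).
Qed.

Let ceta n : continuous (eta n).
Proof.
by have [B B0 [et1 [_ het _ _ _]]] := response_facts; exact: has_deriv_continuous (het n).
Qed.

Let eta_cint n : cint (eta n) = 0.
Proof.
have [B B0 [et1 [tB _ _ _ _]]] := response_facts.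
exact: (response_sum_cint E rho01 gc_periodic tB n gc_continuous gc_cint).
Qed.

Let eta_inL1 n : inL1 (eta n) := inL1_continuous (@ceta n) (@peta n).

Lemma response_linf : linf_W110 eta.
Proof.
have [B B0 [et1 [_ he ce eB _]]] := response_facts; split.
  move=> n; split=> //.
  exact: (C1_inW11 (@eta_inL1 n) (he n) (ce n) (@peta n) (aeT (fun=> erefl))).
apply: (@le_lt_trans _ _ (B + B)%:E); last exact: ltry.
apply: linf_le => n.
apply: (W11norm_le (@eta_inL1 n) (he n) (ce n) (@peta n) (aeT (fun=> erefl))) => x.
  exact: (eB n x).1.
exact: (eB n x).2.
Qed.

Lemma response_solves : response_eq L g eta.
Proof.
move=> n; apply: aeS (source_ae (n - 1)) => x <-.
by rewrite -{1}[n](subrK 1) etaS addrC addKr.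
Qed.

(** The difference of two solutions is transported exactly, so it equals its own
    transport from the arbitrarily distant past, which decays. *)
Lemma response_unique (eta' : int -> R -> R) : linf_W110 eta' ->
  response_eq L g eta' -> forall n, \forall x \ae leb, eta' n x = eta n x.
Proof.
move=> [W' b'] e' n; have [W b] := response_linf.
have [M hM] : exists M : R, forall m, (W11norm (fun x => (eta' m x - eta m x)%R) <= M%:E)%E.
  have [M1 _ b1] := linf_fin (@W11norm_ge0 R) b'.
  have [M2 _ b2] := linf_fin (@W11norm_ge0 R) b.
  exists (M1 + M2) => m; have [_ le] := W11normB (W' m).1 (W m).1.
  by apply: le_trans le _; rewrite EFinD; exact: leeD.
have I' m : inL1 (eta' m) by case: (W' m).1.
pose D m x := eta' m x - eta m x.
have ID m : inL1 (D m) by exact: inL1B.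
have DS m : \forall x \ae leb, L m (D m) x = D (m + 1) x.
  have := e' (m + 1); have := response_solves (m + 1); rewrite addrK.
  apply: aeS2 => x e1' e2'.
  rewrite /D (transferB (E m)); [|by case: (I' m)|exact: peta].
  by move: e1' e2'; lra.
have DN N : \forall x \ae leb, cocycle L (n - N%:Z) N (D (n - N%:Z)) x = D n x.
  elim: N => [|N ih]; first by rewrite subr0; exact: aeT.
  rewrite cocycle_first.
  have e : n - N.+1%:Z + 1 = n - N%:Z by rewrite -addn1 PoszD; ring.
  rewrite e; have := cocycle_ae E (n - N%:Z) N (transfer_inL1 (E _) (ID _)) (ID _) (DS (n - N.+1%:Z)).
  by rewrite e; apply: aeS2 ih => x -> ->.
have [C C0 hC] := W11_decay lam1 K0.
have D0 : l1 (D n) = 0.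
  apply: (geometric_eq0 (C := C * M) rho01) => N; rewrite ger0_norm ?l1_ge0//.
  set m := n - N%:Z.
  have WD : inW110 (D m).
    split; first exact: (W11normB (W' m).1 (W m).1).1.
    by rewrite cintB// (W' m).2 eta_cint subrr.
  have [[[Ic _] _] le] := hC d T T1 T2 E m N (D m) WD.
  rewrite -(l1_eq Ic (ID n) (ae_eq_l1 Ic (ID n) (DN N))) -lee_fin -L1normE//.
  apply: le_trans (L1norm_le_W11norm _) _; apply: le_trans le _.
  have r0 : 0 <= C * rho ^+ N by case/andP: rho01 => r0 _; rewrite mulr_ge0// exprn_ge0.
  rewrite mulrAC EFinM; apply: lee_wpmul2l (hM m); rewrite lee_fin//.
by apply: aeS (l1_eq0 (ID n) D0) => x /eqP; rewrite subr_eq0 => /eqP.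
Qed.

Lemma response_term_decay : exists2 B, 0 <= B & forall n j,
  (W11norm (response_term L g n j) <= (B * rho ^+ j)%:E)%E.
Proof.
have [C C0 hC] := W11_decay lam1 K0.
have Ak := mulr_ge0 A0 k0.
exists (C * (8 * (A * k))) => [|n j]; first by rewrite !mulr_ge0.
have [_ le] := hC d T T1 T2 E (n - j%:Z) j _ (source_inW110 (n - j%:Z - 1)).
apply: le_trans le _; rewrite mulrAC [leRHS]EFinM.
apply: lee_wpmul2l; last exact: W11norm_source.
by rewrite lee_fin; case/andP: rho01 => r0 _; rewrite mulr_ge0// exprn_ge0.
Qed.

Lemma response_series_tail :
  ereal_sup (range (fun n : int => (\sum_(N <= j <oo) W11norm (response_term L g n j))%E))
    @[N --> \oo] --> 0%E.
Proof.
have [B B0 hB] := response_term_decay.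
have r1 : 0 <= 1 - rho by case/andP: rho01 => _ r1; rewrite subr_ge0 ltW.
apply: (cvge_geometric (B := B / (1 - rho)) rho01); first exact: divr_ge0.
  move=> N; apply: (@le_trans _ _ (\sum_(N <= j <oo) W11norm (response_term L g 0 j))%E).
    by apply: nneseries_ge0 => j _ _; exact: W11norm_ge0.
  by apply: ereal_sup_ubound; exists 0.
move=> N; apply: ub_ereal_sup => _ [n _ <-].
by apply: geometric_nneseries => // j; exact: W11norm_ge0.
Qed.

Lemma response_partial_sums :
  linf W11norm (fun n x => eta n x - \sum_(j < N) response_term L g n j x)
    @[N --> \oo] --> 0%E.
Proof.
have [B B0 [et1 [_ _ _ _ tails]]] := response_facts.
apply: (cvge_geometric (B := B + B) rho01) => [|N|N]; first exact: addr_ge0.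
  by apply: linf_ge0; exact: W11norm_ge0.
apply: linf_le => n; have [t1 ht [ct tB]] := tails N n.
have It j : inL1 (response_term L g n j).
  by apply: (cocycle_inL1 E); exact: source_inL1.
have pt j : periodic (response_term L gc n j) 1 by exact: response_term_periodic.
rewrite mulrDl; apply: (W11norm_le _ ht ct) => [|x||x|x].
- by apply: inL1B => //; exact: inL1_sum.
- by rewrite peta; congr (_ - _); apply: eq_bigr => j _; rewrite pt.
- have : \forall x \ae leb, \sum_(j < N) response_term L gc n j x =
      \sum_(j < N) response_term L g n j x.
    elim: (N) => [|m ih]; first by apply: aeT => x; rewrite !big_ord0.
    have It' := inL1_continuous (@gc_continuous (n - m%:Z - 1)) (@gc_periodic _).
    have := cocycle_ae E (n - m%:Z) m It' (source_inL1 _) (source_ae _).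
    by apply: aeS2 ih => x e1' e2'; rewrite !big_ord_recr/= e1' /response_term e2'.
  by apply: aeS => x ->.
- exact: (tB x).1.
- exact: (tB x).2.
Qed.

(* The difference between the difference quotient and the response obeys the
   perturbed recursion with this forcing. *)
Let forcing e n x := (Le e n (eta n) x - L n (eta n) x) + df e n x.

(** The forcing consists of the perturbation of the operator applied to the
    response, small in sup norm but in C^1 only bounded, and of the defect of the
    first-order expansion. *)
Lemma response_cvg :
  linf L1norm (fun n x => (mue e n x - mu n x) / e - eta n x) @[e --> 0^'+] --> 0%E.
Proof.
apply: cvge0 => [e|eps eps0]; first by apply: linf_ge0; exact: L1norm_ge0.
have [B B0 [et1 [_ het cet etB _]]] := response_facts.
have [C C0 hC] := small_forcing lam1' K0'.
have [Cs Cs0 hCs] := equivariant_density_spec lam1' K0'.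
set c := expR (cone_param lam' K').
have c0 : 0 < c by exact: expR_gt0.
have Ak := mulr_ge0 A0 k0; have Ak2 := mulr_ge0 A0 (exprn_ge0 2 k0).
set B' := B + 4 * (A * k).
have B'0 : 0 <= B' by rewrite addr_ge0// mulr_ge0.
pose Q := 3 * B' * k + 62 * (A * k ^+ 2).
have Q0 : 0 <= Q by rewrite addr_ge0 ?mulr_ge0.
pose Rb := (B + K' * B) * c + B' + 62 * (A * k ^+ 2).
have rho01' := decay_rate_itvW lam1' K0'.
have eps2 : 0 < eps / 2 by rewrite divr_gt0.
have [N hN] := geometric_small (C * Rb) rho01' eps2.
pose M := N%:R * (Q * c).
have M0 : 0 <= M by rewrite !mulr_ge0// ltW.
pose et := Num.min 1 (eps / (2 * (M + 1))).
have et0 : 0 < et.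
  by rewrite lt_min ltr01 divr_gt0// mulr_gt0// ltr_wpDl.
have et_le1 : et <= 1 by rewrite ge_min lexx.
have etM : et * M <= eps / 2.
  have : et <= eps / (2 * (M + 1)) by rewrite ge_min lexx orbT.
  rewrite ler_pdivlMr ?mulr_gt0 ?ltr_wpDl//.
  by move: (ltW et0); lra.
clearbody et; have [a a0 ha] := near et0.
apply/at_rightE; exists (Num.min (Num.min a e1) et).
  by rewrite !lt_min a0 e1_gt0 et0.
move=> e /andP[e0]; rewrite !lt_min => /andP[/andP[ea ee] eet].
have Ne : near_id e et k Y Y1 Y2 (h e) (h1 e) (h2 e) by apply: ha; rewrite ltW.
have ee' : 0 <= e < e1 by rewrite ltW.
have e0e : 0 < e < e1 by rewrite e0.
have EE n := E' n ee'.
have [pmue _ cmue mueS [mu1e mue1]] := hCs _ _ _ _ EE.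
have en0 : e != 0 by rewrite gt_eqF.
pose v n x := e^-1 * (mue e n x - mu n x) - eta n x.
pose v1 n x := e^-1 * (mu1e n x - m1 n x) - et1 n x.
have hv n : has_deriv (v n) (v1 n).
  apply: has_derivB (het n); apply: has_derivZ; apply: has_derivB (hm1 n).
  by have [] := mue1 n.
have cmu n : cint (mu n) = 1.
  by have [? _ hCC] := equivariant_density_spec lam1 K0; have [] := hCC _ _ _ _ E.
have Imu n := inL1_continuous (has_deriv_continuous (hm1 n)) (@pmu n).
have Imue n : inL1 (mue e n).
  by have [hd _ _] := mue1 n; exact: inL1_continuous (has_deriv_continuous hd) (pmue n).
have v0 n : cint (v n) = 0.
  have IB := inL1B (Imue n) (Imu n).
  rewrite /v (cintB (inL1Z e^-1 IB) (@eta_inL1 n)) (cintZ _ IB).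
  by rewrite (cintB (Imue n) (Imu n)) cmue cmu eta_cint subrr mulr0 subr0.
have pv n : periodic (v n) 1 by move=> x; rewrite /v pmue pmu peta.
have vD n x : `|v1 n x| <= e^-1 * (Cs + A) + B.
  apply: norm_sub; last exact: (etB n x).2.
  apply: norm_mul; first by rewrite ger0_norm// invr_ge0 ltW.
  apply: norm_sub; first by have [_ _ le] := mue1 n; exact: (le x).2.
  by have [] := mA n x.
have regroup (a1 a2 a3 a4 a5 a6 : R) : e^-1 * (a1 - a5) - (a4 + a6) =
    e^-1 * (a1 - a2) - a3 + ((a3 - a4) + (e^-1 * (a2 - a5) - a6)) by ring.
have vS n x : v (n + 1) x = transfer (h e \o T n) (v n) x + forcing e n x.
  have pd : periodic (fun y => mue e n y - mu n y) 1 by move=> y; rewrite pmue pmu.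
  have pz : periodic (fun y => e^-1 * (mue e n y - mu n y)) 1.
    by move=> y; rewrite pmue pmu.
  rewrite /v (transferB (EE n) pz (@peta n)) (transferZ (EE n) _ pd).
  rewrite (transferB (EE n) (pmue n) (@pmu n)) mueS etaS /forcing /df muS.
  exact: regroup.
pose phi1 n x := et1 (n + 1) x - gc1 n x.
have phiE n : L n (eta n) = (fun x => eta (n + 1) x - gc n x).
  by apply/funext => x; rewrite etaS addrK.
have hphi n : has_deriv (L n (eta n)) (phi1 n) by rewrite phiE; exact: has_derivB.
have phiB n x : `|L n (eta n) x| <= B' /\ `|phi1 n x| <= B'.
  by rewrite phiE; split; apply: norm_sub; [exact: (etB _ x).1|exact: (gc_le n x).1|
    exact: (etB _ x).2|exact: (gc_le n x).2].
pose q n y := invd (H1 e n) y * et1 n y + invd1 (H1 e n) (H2 e n) y * eta n y.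
have pet1 n := periodic_deriv (het n) (@peta n).
have pq n : periodic (q n) 1.
  by move=> y; rewrite /q (p_periodic (EE n)) (p1_periodic (EE n)) pet1 peta.
have cq n : continuous (q n).
  apply: contD; apply: contM => //.
  - exact: (p_continuous (EE n)).
  - exact: (p1_continuous (EE n)).
have qB n y : `|q n y| <= B + K' * B.
  rewrite -[X in X + _]mul1r; apply: norm_add; apply: norm_mul.
  - by rewrite ger0_norm ?(p_le1 (EE n))// ltW// (p_gt0 (EE n)).
  - exact: (etB n y).2.
  - exact: (p1_le (EE n)).
  - exact: (etB n y).1.
pose s1 n x := (transfer (h e \o T n) (q n) x - phi1 n x) + df1 e n x.
have hs n : has_deriv (forcing e n) (s1 n).
  apply: has_derivD (df_deriv n ee'); apply: has_derivB (hphi n).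
  exact: (transfer_deriv (EE n) (het n) (@peta n)).
have cs1 n : continuous (s1 n).
  apply: contD; last exact: (@df1_continuous e n ee').
  apply: contB; first exact: (transfer_continuous (EE n) (cq n) (pq n)).
  exact: contB.
have e_le1 : e <= et := ltW eet.
have dfb : 31 * (A * k ^+ 2) * (et + e) <= 62 * (A * k ^+ 2) * et.
  by have := ler_wpM2l Ak2 e_le1; lra.
have dfb1 : 31 * (A * k ^+ 2) * (et + e) <= 62 * (A * k ^+ 2).
  by apply: le_trans dfb _; rewrite ler_piMr// mulr_ge0.
have s1A n x : `|s1 n x| <= Rb.
  apply: norm_add; last exact: le_trans (df_le n x e0e (ltW et0) Ne).2 dfb1.
  apply: norm_sub; last exact: (phiB n x).2.
  exact: (transfer_sup EE n (pq n) (qB n)).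
have sa n x : `|forcing e n x| <= Q * et.
  rewrite /Q mulrDl; apply: norm_add.
    apply: le_trans (transfer_near Ne (ek_le ee') (E n) (EE n) (@peta n) (hphi n)
      (fun y => (phiB n y).1) (fun y => (phiB n y).2) x) _.
    by apply: ler_wpM2l => //; rewrite !mulr_ge0.
  exact: le_trans (df_le n x e0e (ltW et0) Ne).1 dfb.
have main := hC d _ _ _ EE v v1 _ s1 Rb _ _ pv v0 hv vD vS hs cs1 s1A sa N.
apply: linf_le => n.
have -> : (fun x => (mue e n x - mu n x) / e - eta n x) = v n.
  by apply/funext => x; rewrite /v mulrC.
have Iv := inL1_continuous (has_deriv_continuous (hv n)) (pv n).
rewrite L1normE// lee_fin; apply: l1_le => // x; apply: le_trans (main n x) _.
have -> : N%:R * (Q * et * expR (cone_param lam' K')) = et * M by rewrite /M /c; ring.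
by move: hN etM; lra.
Qed.

End Response.

(** * From the hypotheses to uniform constants *)

Section UniformConstants.
Context {R : realType}.

(** At e = 0 the diffeomorphism is the identity and all the bounds are 0. *)
Lemma diffeo_near_id (e0 k : R) (h : R -> R -> R) (Y : R -> R) : 0 < e0 ->
  (forall e, 0 <= e < e0 -> circle_diffeo 3 (h e)) -> (forall x, h 0 x = x) ->
  Ck 3 Y -> 1 <= k -> (forall j x, (j <= 2)%N -> `|derive1n j Y x| <= k - 1) ->
  ((`|e|^-1)%:E * Cnorm 3 (fun x => (h e x - x - e * Y x)%R))%E @[e --> 0^'+] --> 0%E ->
  forall eta, 0 < eta -> exists2 a, 0 < a & forall e, 0 <= e < a ->
    near_id e eta k Y (derive1n 1 Y) (derive1n 2 Y)
      (h e) (derive1n 1 (h e)) (derive1n 2 (h e)).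
Proof.
move=> e00 hd hid Y3 k1 Yk hc eta eta0; pose et := Num.min eta 1.
have et0 : 0 < et by rewrite lt_min eta0 ltr01.
have et_eta : et <= eta by rewrite ge_min lexx.
have et1 : et <= 1 by rewrite ge_min lexx orbT.
have nb : nbhs (0%E : \bar R) (fun u => (u < et%:E)%E) by apply: open_ereal_lt'; rewrite lte_fin.
have /at_rightE[a a0 ha] := hc _ nb.
exists (Num.min a e0); first by rewrite lt_min a0.
have hY := Ck_deriv Y3 (isT : 0 < 3)%N; have hY1 := Ck_deriv Y3 (isT : 1 < 3)%N.
move=> e; rewrite lt_min => /andP[e_ge0 /andP[ea ee]].
have ee' : 0 <= e < e0 by rewrite e_ge0.
have [lh hC [gi [_ hg _]]] := hd e ee'.
have hh := Ck_deriv hC (isT : 0 < 3)%N; have hh1 := Ck_deriv hC (isT : 1 < 3)%N.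
have hh2 := Ck_deriv hC (isT : 2 < 3)%N.
pose w x := h e x - x - e * Y x.
have hw : has_deriv w (fun x => derive1n 1 (h e) x - 1 - e * derive1n 1 Y x).
  exact: has_derivB (has_derivB hh (@has_deriv_id R)) (has_derivZ e hY).
have hw1 : has_deriv (fun x => derive1n 1 (h e) x - 1 - e * derive1n 1 Y x)
    (fun x => derive1n 2 (h e) x - e * derive1n 2 Y x).
  have := has_derivB (has_derivB hh1 (has_deriv_cst 1)) (has_derivZ e hY1).
  by move=> /has_deriv_eq; apply => x; rewrite subr0.
have wb j x : (j <= 2)%N -> `|derive1n j w x| <= et * e.
  move=> j2; have [e00'|] := eqVneq e 0; last first.
    rewrite neq_lt ltNge e_ge0/= => e_gt0.
    have := ha e; rewrite e_gt0 => /(_ ea) /=.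
    rewrite (gtr0_norm e_gt0) => /ltW le.
    have ei : 0 <= e^-1 by rewrite invr_ge0.
    have : ((e^-1)%:E * (`|derive1n j w x|)%:E <= et%:E)%E.
      apply: le_trans le; apply: lee_wpmul2l; first by rewrite lee_fin.
      by apply: Cnorm_ge; exact: leq_trans j2 _.
    by rewrite -EFinM lee_fin mulrC ler_pdivrMr.
  have w0 : w = fun=> 0.
    by apply/funext => y; rewrite /w e00' hid mul0r subrr subr0.
  have dcst (c : R) : derive1 (fun _ : R => c) = fun=> 0 by exact: (has_derivE (has_deriv_cst c)).
  have -> : derive1n j w x = 0.
    rewrite w0; suff -> : derive1n j (fun _ : R => 0 : R) = fun=> 0 by [].
    by elim: j {j2} => [//|j ih]; rewrite derive1nS ih dcst.
  by rewrite normr0 e00' mulr0.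
have w0 x : `|h e x - x - e * Y x| <= et * e := wb 0%N x isT.
have w1 x : `|derive1n 1 (h e) x - 1 - e * derive1n 1 Y x| <= et * e.
  by have := wb 1%N x isT; rewrite derive1n1 (has_derivE hw).
have w2 x : `|derive1n 2 (h e) x - e * derive1n 2 Y x| <= et * e.
  by have := wb 2 x isT; rewrite -[derive1n 2 w]/(derive1 (derive1 w)) (has_derivE hw) (has_derivE hw1).
have up (a' b : R) : `|a' - e * b| <= et * e -> `|b| <= k - 1 -> `|a'| <= e * k.
  move=> u v; rewrite -[a'](subrK (e * b)).
  have he : `|e| <= e by rewrite ger0_norm.
  have le := norm_add u (norm_mul he v); apply: le_trans le _.
  by have := ler_wpM2r e_ge0 et1; lra.
have w_eta b : b <= et * e -> b <= eta * e.
  by move=> /le_trans; apply; rewrite ler_wpM2r.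
split => //.
- by move=> z; exists (gi z); exact: hg.
- exact: has_deriv_continuous hh2.
- by move=> x; apply: (up _ (Y x)) => //; exact: (Yk 0%N).
- by move=> x; apply: (up _ (derive1n 1 Y x)) => //; exact: (Yk 1%N).
- by move=> x; apply: (up _ (derive1n 2 Y x)) => //; exact: (Yk 2%N).
- by move=> x; apply: w_eta.
- by move=> x; apply: w_eta.
- by move=> x; apply: w_eta.
Qed.

Lemma Cnorm_ge0 k (f : R -> R) : (0 <= Cnorm k f)%E.
Proof. by apply: le_trans (Cnorm_ge (j := 0) f 0 isT); rewrite lee_fin. Qed.

End UniformConstants.

Theorem theorem17 (R : realType) (d : nat) (hd : (2 <= d)%N)
  (Ts : R -> R) (hTs_lift : is_lift d Ts) (hTs_C4 : Ck 4 Ts)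
  (hTs_mix : mixing Ts) (hTs_exp : uniformly_expanding Ts)
  (l1 B : R) (hLY : LY_constants Ts l1 B)
  (M : nat) (hM : mixing_time Ts l1 B M)
  (delta : R) (hdelta : admissible d Ts l1 B M delta)
  (T : int -> R -> R)
  (hT_near : forall n, near_maps d Ts delta (T n))
  (hT_C4 : forall n, Ck 4 (T n))
  (hT_bound : (linf (Cnorm 4) (fun n x => (T n x - d%:R * x)%R) < +oo)%E)
  (e0 : R) (he0 : 0 < e0)
  (h : R -> R -> R)
  (hh_family : Ck_family 3 e0 h)
  (hh_diffeo : forall e : R, 0 <= e < e0 -> circle_diffeo 3 (h e))
  (hh_id : forall x, h 0 x = x)
  (Y : R -> R) (hY_per : periodic Y 1) (hY_C3 : Ck 3 Y)
  (hh_exp : ((`|e|^-1)%:E * Cnorm 3 (fun x => (h e x - x - e * Y x)%R))%E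
              @[e --> 0^'+] --> 0%E) :
  exists e1 : R, 0 < e1 <= e0 /\
  (* (a) *)
  ((exists K : R, forall (e : R) (n : int), 0 <= e < e1 ->
      [/\ forall f, inW11 f ->
            (W11norm (pert_op h T e n f) <= K%:E * W11norm f)%E,
          forall f, inL1 f ->
            inL1 (pert_op h T e n f) /\
            (L1norm (pert_op h T e n f) <= K%:E * L1norm f)%E,
          forall f, inL1 f ->
            (\forall x \ae lebesgue_measure, 0 <= f x) ->
            \forall x \ae lebesgue_measure, 0 <= pert_op h T e n f x &
          forall f, inL1 f -> cint (pert_op h T e n f) = cint f]) /\
   (exists K : R, forall (e : R) (k : nat) (v : int -> R -> R), 0 <= e < e1 -> linf_L10 v ->
      linf_L10 (iter k (shift_op (pert_op h T e)) v) /\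
      (linf L1norm (iter k (shift_op (pert_op h T e)) v)
         <= K%:E * linf L1norm v)%E)) /\
  exists mu : R -> int -> R -> R,
  let L := pert_op h T 0 in
  let g := source Y L (mu 0) in
  [/\ (* (b) *)
      (forall (e : R) (n : int), 0 <= e < e1 ->
         density (mu e n) /\
         \forall x \ae lebesgue_measure,
           mu e (n + 1) x = pert_op h T e n (mu e n) x) /\
      (ereal_sup [set W11norm (mu e n) | e in `[0%R, e1[ & n in [set: int]]
         < +oo)%E,
      (* (c) *)
      [/\ (linf W11norm g < +oo)%E,
          linf W11norm (fun n x =>
              e^-1 * (pert_op h T e n (mu 0 n) x - L n (mu 0 n) x) - g n x)
            @[e --> 0^'+] --> 0%E &
          ereal_sup [set L1norm (fun x => pert_op h T e n v x - L n v x)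
                      | n in [set: int] & v in [set v | W11norm v = 1%E]]
            @[e --> 0^'+] --> 0%E],
      (* (d) *)
      (exists C rho : R, [/\ 1 <= C, 0 < rho < 1 &
         forall (e : R) (m n : int) (v : R -> R), 0 <= e < e1 -> m < n -> inW110 v ->
           (W11norm (cocycle (pert_op h T e) m `|n - m|%N v)
              <= (C * rho ^ (n - m))%:E * W11norm v)%E]) &
      (* linear response *)
      exists eta : int -> R -> R,
      [/\ linf L1norm (fun n x => (mu e n x - mu 0 n x) / e - eta n x)
            @[e --> 0^'+] --> 0%E,
          linf_W110 eta /\ response_eq L g eta,
          forall eta' : int -> R -> R,
            linf_W110 eta' -> response_eq L g eta' ->
            forall n, \forall x \ae lebesgue_measure, eta' n x = eta n x,
          ereal_sup (range (fun n : int =>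
              (\sum_(N <= k <oo) W11norm (response_term L g n k))%E))
            @[N --> \oo] --> 0%E &
          linf W11norm (fun n x =>
              eta n x - \sum_(k < N) response_term L g n k x)
            @[N --> \oo] --> 0%E]].

Proof.
have d0 : (0 < d)%N by exact: ltnW.
have [K K0 TK] := linf_fin (@Cnorm_ge0 _ 4) hT_bound.
have [hd1 _] := hdelta; set lam := min_expansion Ts - delta.
have F0 n := near_expanding4 d0 hTs_C4 hd1 (hT_near n) (hT_C4 n) (TK n).
pose Tj j n := derive1n j (T n).
have F n : expanding4 d lam K (T n) (Tj 1%N n) (Tj 2%N n) (Tj 3%N n) (Tj 4%N n) := (F0 n).1.
have T1K n x : `|Tj 1%N n x| <= d%:R + K := (F0 n).2 x.
have E n := exp4_exp (F n); have lam1 := exp_gt1 (E 0).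
have hY j : (j < 3)%N -> has_deriv (derive1n j Y) (derive1n j.+1 Y) := Ck_deriv hY_C3.
have pYj j : (j <= 3)%N -> periodic (derive1n j Y) 1.
  by elim: j => [//|j ih] j3; exact: periodic_deriv (hY j j3) (ih (ltnW j3)).
have [KY KY0 YK] : exists2 KY, 0 <= KY & forall j x, (j <= 3)%N -> `|derive1n j Y x| <= KY.
  have b j (j3 : (j <= 3)%N) := periodic_bounded (hY_C3.2 j j3) (pYj j j3).
  have [B0 B00 h0] := b 0%N isT; have [B1 B10 h1] := b 1%N isT.
  have [B2 B20 h2] := b 2 isT; have [B3 B30 h3] := b 3 isT.
  exists (B0 + B1 + B2 + B3) => [|[|[|[|[|//]]]] x _]; first by rewrite !addr_ge0.
  - by have := h0 x; lra.
  - by have := h1 x; lra.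
  - by have := h2 x; lra.
  - by have := h3 x; lra.
pose k := 1 + KY; have k1 : 1 <= k by rewrite lerDl.
have k_gt0 : 0 < k := lt_le_trans ltr01 k1.
have near := diffeo_near_id he0 hh_diffeo hh_id hY_C3 k1 _ hh_exp.
have {}near : forall eta, 0 < eta -> exists2 a, 0 < a & forall e, 0 <= e < a ->
    near_id e eta k Y (derive1n 1 Y) (derive1n 2 Y)
      (h e) (derive1n 1 (h e)) (derive1n 2 (h e)).
  apply: near => j x j2; rewrite /k addrC addKr; apply: YK; exact: leq_trans j2 _.
have Yk x : [/\ `|Y x| <= k, `|derive1n 1 Y x| <= k, `|derive1n 2 Y x| <= k &
    `|derive1n 3 Y x| <= k].
  have b j : (j <= 3)%N -> `|derive1n j Y x| <= k.
    by move=> j3; apply: le_trans (YK j x j3) _; rewrite /k lerDr.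
  by split; [exact: (b 0%N)|exact: b..].
have [a0 a00 near1] := near 1 ltr01.
(* If e k <= lamf, the perturbed maps keep half of the excess lam - 1. *)
pose lamf := (lam - 1) / (2 * lam).
have lamf0 : 0 < lamf by rewrite divr_gt0 ?subr_gt0// mulr_gt0// (lt_trans ltr01).
pose e1 := Num.min (Num.min e0 a0) (Num.min (1 / 2 / k) (lamf / k)).
have h2k : 0 < 1 / 2 / k by rewrite !divr_gt0.
have lk : 0 < lamf / k by rewrite divr_gt0.
have e1_gt0 : 0 < e1 by rewrite !lt_min he0 a00 h2k lk.
have e1_le : [/\ e1 <= e0, e1 <= a0, e1 * k <= 1 / 2 & e1 * k <= lamf].
  by rewrite -!ler_pdivlMr// /e1; split; rewrite !ge_min lexx ?orbT.
have [e1e0 e1a0 e1k e1lam] := e1_le.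
have near_e e : 0 <= e < e1 -> near_id e 1 k Y (derive1n 1 Y) (derive1n 2 Y)
      (h e) (derive1n 1 (h e)) (derive1n 2 (h e)).
  by move=> /andP[e_0 ee]; apply: near1; rewrite e_0 (lt_le_trans ee).
have ek e : 0 <= e < e1 -> e * k <= e1 * k.
  by move=> /andP[_ ee]; rewrite ler_wpM2r// ltW.
pose lam' := (lam + 1) / 2; pose K' := (d%:R + K) ^+ 2 + 2 * K.
pose H1 e n x := derive1n 1 (h e) (T n x) * Tj 1%N n x.
pose H2 e n x := derive1n 2 (h e) (T n x) * Tj 1%N n x ^+ 2
  + derive1n 1 (h e) (T n x) * Tj 2%N n x.
have E' e n : 0 <= e < e1 -> expanding d lam' K' (h e \o T n) (H1 e n) (H2 e n).
  move=> ee; have Ne := near_e e ee; have eek := ek e ee.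
  apply: (expanding_comp (E n) (T1K n) (ni_lift Ne) (ni_h1 Ne) (ni_h2 Ne) (ni_cont Ne)
    (ni_d1 Ne) (ni_d2 Ne)); last exact: le_trans eek e1lam.
  by apply: le_trans eek _; apply: le_trans e1k _; lra.
have lam1' : 1 < lam' by rewrite /lam'; lra.
have K0' : 0 <= K' by rewrite addr_ge0 ?sqr_ge0// mulr_ge0.
have [A [m1 [m2 [m3 [hm1 hm2 hm3 mA]]]]] := equivariant_density_C3 F.
have h0T n : h 0 \o T n = T n by apply/funext => x /=; exact: hh_id.
have L0 : pert_op h T 0 = (fun n => transfer (T n)).
  by apply/funext => n; rewrite /pert_op h0T.
exists e1; split; first by rewrite e1_gt0.
split.
  split.
    exists (1 + K') => e n ee; have EE := E' e n ee; split.
    - by move=> f Wf; exact: (W11norm_transfer EE).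
    - move=> f If; split; first exact: (transfer_inL1 EE).
      apply: le_trans (transfer_L1norm (fun _ => EE) 0 If) _.
      by rewrite (L1normE If) -EFinM lee_fin ler_peMl ?l1_ge0// lerDl.
    - by move=> f If f0; exact: (transfer_ae_ge0 (fun _ => EE) 0 If f0).
    - by move=> f If; exact: (cint_transfer EE).
  exists 1 => e j v ee hv; rewrite mul1e.
  exact: (iter_shift_op (fun n => E' e n ee) j hv).
pose mu e := equivariant_density (fun n => h e \o T n).
have mu0 : mu 0 = equivariant_density T.
  by rewrite /mu; congr equivariant_density; apply/funext => n; rewrite h0T.
have [C C0 spec] := equivariant_density_spec lam1' K0'.
exists mu; rewrite L0 mu0 => L g.
have hY0 := hY 0%N isT; have hY1 := hY 1%N isT; have hY2 := hY 2 isT.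
split.
- split.
    move=> e n ee; have [pm m0 cm mS [mu1 hmu1]] := spec _ _ _ _ (fun n => E' e n ee).
    split; last by apply: aeT => x; exact: mS.
    have [dmu _ _] := hmu1 n.
    have Imu : inL1 (mu e n) by exact: inL1_continuous (has_deriv_continuous dmu) (pm n).
    have mu_ge0 : \forall x \ae lebesgue_measure, 0 <= mu e n x by exact: aeT (m0 n).
    by split => //; exact: (cm n).
  apply: (@le_lt_trans _ _ (C + C)%:E); last exact: ltry.
  apply: ub_ereal_sup => _ [e /= ee [n _ <-]]; rewrite in_itv/= in ee.
  have [pm _ _ _ [mu1 hmu1]] := spec _ _ _ _ (fun n => E' e n ee).
  have [dmu cd le] := hmu1 n.
  apply: (W11norm_le _ dmu cd (pm n) (aeT (fun=> erefl))) => [|x|x].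
  + exact: inL1_continuous (has_deriv_continuous dmu) (pm n).
  + exact: (le x).1.
  + exact: (le x).2.
- split.
  + apply: (@le_lt_trans _ _ (8 * (A * k))%:E); last exact: ltry.
    apply: linf_le => n.
    exact: (W11norm_source k1 E hY_per hY0 hY1 hY2 Yk hm1 hm2 hm3 mA).
  + exact: (source_expansion k1 e1_gt0 e1k E E' near hY_per hY0 hY1 hY2 Yk hm1 hm2 hm3 mA).
  + exact: (operator_cvg k1 e1_gt0 E E' near).
- have [Cd Cd0 hCd] := W11_decay lam1' K0'.
  exists (1 + Cd), (decay_rate lam' K'); split.
  + by rewrite lerDl.
  + exact: decay_rate_itv.
  + move=> e m n v ee mn Wv; have [_ le] := hCd _ _ _ _ (fun n => E' e n ee) m `|n - m|%N v Wv.
    apply: le_trans le _; apply: lee_wpmul2r; first exact: W11norm_ge0.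
    have nm : 0 <= n - m by rewrite subr_ge0 ltW.
    rewrite lee_fin -[in leRHS](gez0_abs nm); apply: ler_wpM2r.
      by apply: exprn_ge0; case/andP: (decay_rate_itvW lam1' K0').
    by rewrite lerDr.
- exists (response_sum L (classical_source T Y (derive1n 1 Y) m1)); split.
  + exact: (response_cvg k1 e1_gt0 e1k E E' near hY_per hY0 hY1 hY2 Yk hm1 hm2 hm3 mA).
  + split.
      exact: (response_linf k1 E hY_per hY0 hY1 hY2 Yk hm1 hm2 hm3 mA).
    exact: (response_solves k1 E hY_per hY0 hY1 hY2 Yk hm1 hm2 hm3 mA).
  + exact: (response_unique k1 E hY_per hY0 hY1 hY2 Yk hm1 hm2 hm3 mA).
  + exact: (response_series_tail k1 E hY_per hY0 hY1 hY2 Yk hm1 hm2 hm3 mA).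
  + exact: (response_partial_sums k1 E hY_per hY0 hY1 hY2 Yk hm1 hm2 hm3 mA).
Qed.
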